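(* Let $s\in\mathbb{C}$ with $\operatorname{Re}s>\log_bN$ and let $\kappa=\frac{b-1}{f}$. Then, as the real variable $m\to+\infty$, $\kappa^m m^s u_m(s)$ differs by $O(1/m)$ from the function $$G_s(m)=\frac{1}{\log b}\sum_{k=-\infty}^{\infty}e^{2\pi i k\log_b(m)}\,\Gamma\!\Bigl(s-\frac{2\pi i k}{\log b}\Bigr)\sum_{n\in\mathcal{B}}\frac{1}{(\kappa n+1)^{\,s-\frac{2\pi i k}{\log b}}},$$ which is a smooth $1$-periodic function of $\log_b(m)$ and equals $$G_s(m)=m^s\sum_{j=-\infty}^{\infty}b^{js}\sum_{n\in\mathcal{B}}e^{-(\kappa n+1)b^jm}.$$ Moreover the asymptotic average of the scaled integer moments is $$\lim_{p\to\infty}\ \sum_{\substack{m\in\mathbb{Z}\\ b^p<m\le b^{p+1}}} \kappa^m m^s u_m(s)\,\log_b\!\frac{m}{m-1}=\frac{\Gamma(s)}{\log b}\sum_{n\in\mathcal{B}}\frac{1}{(\kappa n+1)^s}.$$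
   Context: Let $b\ge 2$ be an integer and $A\subset\{0,1,\dots,b-1\}$ a nonempty set of digits with $N=\#A$ and $f=\max A>0$ (no assumption that $f=b-1$). For $s\in\mathbb{C}$ with $\operatorname{Re}s>\log_b N$, $\mu_s$ is the discrete complex Borel measure on $[0,1)$ $$\mu_s=\delta_0+\sum_{l=1}^{\infty}\ \sum_{(a_1,\dots,a_l)\in A^l} b^{-ls}\,\delta_{a_1b^{-1}+\cdots+a_lb^{-l}},$$ where $\delta_y$ denotes the unit Dirac mass at $y$, and for real $m\ge0$ its moments are $$u_m(s)=\int_{[0,1)}x^m\,\mu_s(dx)=0^m+\sum_{l=1}^\infty\sum_{(a_1,\dots,a_l)\in A^l}\bigl(a_1b^{-1}+\cdots+a_lb^{-l}\bigr)^m b^{-ls}\quad(0^0=1).$$ Let $B=\{f-a: a\in A\}$ and let $\mathcal{B}$ be the set of non-negative integers whose radix-$b$ representation uses only digits from $B$ (the integer $0$, represented by the empty word, always belongs to $\mathcal{B}$). Powers use the principal branch, and $\Gamma$ is Euler's Gamma function. *)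

(* Defs.v *)
From Stdlib Require Import Reals List Arith ZArith.
From Coquelicot Require Import Coquelicot.
Open Scope R_scope.

Definition cexp (z : C) : C :=
  pair (exp (Re z) * cos (Im z))%R (exp (Re z) * sin (Im z))%R.

(* x^z for a real base x >= 0 and complex exponent z (principal branch,
   exp (z ln x) for x > 0), with the convention 0^0 = 1 and 0^z = 0 for z <> 0. *)
Definition rcpow (x : R) (z : C) : C :=
  if Req_EM_T x 0 then
    (if Req_EM_T (Re z) 0 then (if Req_EM_T (Im z) 0 then RtoC 1 else RtoC 0)
     else RtoC 0)
  else cexp (Cmult z (RtoC (ln x))).

Definition csum (a : nat -> C) : C :=
  pair (Series (fun k => Re (a k))) (Series (fun k => Im (a k))).

Definition zsum (a : Z -> C) : C :=
  Cplus (csum (fun k => a (Z.of_nat k))) (csum (fun k => a (- Z.of_nat (S k))%Z)).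

Definition lsum (l : list C) : C := fold_right Cplus (RtoC 0) l.

Definition Gamma (z : C) : C :=
  RInt_gen (V := C_R_CompleteNormedModule)
    (fun t => Cmult (rcpow t (Cminus z (RtoC 1))) (RtoC (exp (- t))))
    (at_right 0) (Rbar_locally p_infty).

Definition maxA (A : list nat) : nat := fold_right Nat.max 0%nat A.

Definition kappa (b : nat) (A : list nat) : R := (INR b - 1) / INR (maxA A).

Fixpoint words (A : list nat) (l : nat) : list (list nat) :=
  match l with
  | O => nil :: nil
  | S k => flat_map (fun a => map (cons a) (words A k)) A
  end.

(* a_1 b^-1 + ... + a_l b^-l *)
Definition digval (b : nat) (w : list nat) : R :=
  fold_right (fun a acc => (INR a + acc) / INR b) 0 w.

Definition u (b : nat) (A : list nat) (m : R) (s : C) : C :=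
  Cplus (rcpow 0 (RtoC m))
    (csum (fun l => lsum (map (fun w =>
        Cmult (rcpow (digval b w) (RtoC m))
              (rcpow (INR b) (Cmult (RtoC (- INR (S l))) s)))
      (words A (S l))))).

(* radix-b digits of n (least significant first); empty for n = 0 *)
Fixpoint digits_aux (b fuel n : nat) : list nat :=
  match fuel with
  | O => nil
  | S k => if Nat.eqb n 0 then nil else (n mod b)%nat :: digits_aux b k (n / b)
  end.
Definition digits (b n : nat) : list nat := digits_aux b n n.

Definition inB (b : nat) (A : list nat) (n : nat) : bool :=
  forallb (fun d => existsb (fun a => Nat.eqb d (maxA A - a)) A) (digits b n).

Definition Dser (b : nat) (A : list nat) (z : C) : C :=
  csum (fun n => if inB b A n
                 then Cdiv (RtoC 1) (rcpow (kappa b A * INR n + 1) z)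
                 else RtoC 0).

Definition zk (b : nat) (s : C) (k : Z) : C :=
  Cminus s (pair 0%R (2 * PI * IZR k / ln (INR b))%R : C).

Definition logb (b : nat) (x : R) : R := ln x / ln (INR b).

Definition Gs (b : nat) (A : list nat) (s : C) (m : R) : C :=
  Cmult (RtoC (1 / ln (INR b)))
    (zsum (fun k => Cmult (Cmult (cexp (pair 0%R (2 * PI * IZR k * logb b m)%R : C))
                                 (Gamma (zk b s k)))
                          (Dser b A (zk b s k)))).

Definition Gs2 (b : nat) (A : list nat) (s : C) (m : R) : C :=
  Cmult (rcpow m s)
    (zsum (fun j => Cmult (rcpow (INR b) (Cmult (RtoC (IZR j)) s))
       (csum (fun n => if inB b A n
          then RtoC (exp (- (kappa b A * INR n + 1) * powerRZ (INR b) j * m))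
          else RtoC 0)))).

Definition smoothC (P : R -> C) : Prop :=
  forall (n : nat) (x : R),
    ex_derive_n (fun t => Re (P t)) n x /\ ex_derive_n (fun t => Im (P t)) n x.

Definition scaled_u (b : nat) (A : list nat) (s : C) (m : R) : C :=
  Cmult (Cmult (rcpow (kappa b A) (RtoC m)) (rcpow m s)) (u b A m s).

Definition avg_sum (b : nat) (A : list nat) (s : C) (p : nat) : C :=
  lsum (map (fun i => let m := INR (b ^ p + 1 + i) in
                      Cmult (scaled_u b A s m) (RtoC (logb b (m / (m - 1)))))
            (seq 0 (b ^ (p + 1) - b ^ p))).

(* Main.v *)
(* Writing a word [a_1 ... a_l] over [A] as [f - b_i], one finds
   [kappa * (a_1/b + ... + a_l/b^l) = 1 - (kappa n + 1) / b^l], where [n] runs over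
   the elements of the set B of integers with digits in [f - A] below [b^l].
   Hence, with [lam_n = kappa n + 1] and [X = m b^j],
     [kappa^m m^s u_m(s) = sum_j X^s sum_n (1 - lam_n X / m)_+^m],
   and replacing [(1 - y)_+^m] by [e^(-my)] costs at most [4 m y^2 e^(-my)], which
   sums to O(1/m).  The result is the second form of [G_s].

   Poisson summation applied to [x |-> e^(sx) exp(-e^x)], whose Fourier transform is
   [Gamma] on a vertical line, followed by summation over [n], turns it into the Fourier
   series.  The functional equation of [Gamma] makes the coefficients decrease faster than
   any power, so the series is smooth.  The averages are Riemann sums of a periodic function,
   and telescoping an explicit primitive of the Fourier series extracts its constant
   coefficient. *)

Require Import Defs.
From Stdlib Require Import Reals List Arith ZArith.
From Stdlib Require Import Psatz Permutation Bool.
From Coquelicot Require Import Coquelicot.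
Open Scope R_scope.

(** * Real and complex series *)

(** One product majorant drives every estimate on the double sum over [j] and [n]: a weight in [j]
    times [q n = chi n * lam_n^(-(Re s - eps))]. With [eps] half the gap between [Re s] and
    [log_b N], the series of [q] still converges. The [eps] set aside pays for the translation by
    [ln lam_n] that occurs when the decay of [e^(px) exp(-e^x)], taken at [x + ln lam_n], is
    compared with a weight taken at [x = ln (m b^j)]. The sums of this weight over [j] are bounded
    independently of [m], so the constant in [O(1/m)] is uniform.

    Poisson summation is reached through the symmetric partial sums of the Fourier side, which are
    integrals against the Dirichlet kernel: the line is cut into unit intervals centred at the
    integers, the Riemann-Lebesgue lemma acts on each one, and an exponential bound uniform in the
    order of the kernel allows the passage to the limit under the sum.

    [Series] has a value for every sequence, convergent or not, and complex sums are taken by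
    components; absolute summability therefore accompanies the algebraic steps on series. *)

Lemma Ceq (z w : C) : Re z = Re w -> Im z = Im w -> z = w.
Proof. destruct z, w; simpl; intros; subst; reflexivity. Qed.

Lemma im_le_Cmod (z : C) : Rabs (Im z) <= Cmod z.
Proof.
  eapply Rle_trans; [| apply Rmax_Cmod]. apply Rmax_r.
Qed.

Lemma Cmod_le_Re_Im (z : C) : Cmod z <= Rabs (Re z) + Rabs (Im z).
Proof.
  destruct z as [x y]. unfold Cmod; simpl.
  pose proof (Rabs_pos x). pose proof (Rabs_pos y).
  rewrite <- (sqrt_Rsqr (Rabs x + Rabs y)) by lra.
  apply sqrt_le_1_alt. unfold Rsqr.
  pose proof (Rsqr_abs x) as Hx. pose proof (Rsqr_abs y) as Hy. unfold Rsqr in *. nra.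
Qed.

Lemma sum_n_Sr (a : nat -> R) n : sum_n a (S n) = sum_n a n + a (S n).
Proof. rewrite sum_Sn. reflexivity. Qed.

Lemma sum_n_nonneg (a : nat -> R) n : (forall k, 0 <= a k) -> 0 <= sum_n a n.
Proof.
  intro H. induction n. rewrite sum_O; apply H. rewrite sum_n_Sr. specialize (H (S n)). lra.
Qed.

Lemma sum_n_le_Series (a : nat -> R) n :
  (forall k, 0 <= a k) -> ex_series a -> sum_n a n <= Series a.
Proof.
  intros Ha Hs.
  assert (H := Series_correct _ Hs).
  apply (is_lim_seq_incr_compare (sum_n a) (Series a) H).
  intro k. rewrite sum_n_Sr. specialize (Ha (S k)). lra.
Qed.

Lemma Series_nonneg (a : nat -> R) : (forall k, 0 <= a k) -> ex_series a -> 0 <= Series a.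
Proof.
  intros Ha Hs. eapply Rle_trans; [apply (Ha 0%nat)|].
  rewrite <- (sum_O a). now apply sum_n_le_Series.
Qed.

Lemma ex_series_nonneg_bounded (a : nat -> R) (M : R) :
  (forall k, 0 <= a k) -> (forall n, sum_n a n <= M) -> ex_series a.
Proof.
  intros Ha HM.
  destruct (ex_finite_lim_seq_incr (sum_n a) M) as [l Hl]; auto.
  - intro n. rewrite sum_n_Sr. specialize (Ha (S n)). lra.
  - now exists l.
Qed.

Lemma Series_le_of_sums (a : nat -> R) (M : R) :
  ex_series a -> (forall n, sum_n a n <= M) -> Series a <= M.
Proof.
  intros Hs HM. assert (H := Series_correct _ Hs).
  assert (Rbar_le (Series a) M).
  { eapply is_lim_seq_le; [| exact H | apply is_lim_seq_const]. exact HM. }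
  assumption.
Qed.

Lemma ex_series_abs_le (a p : nat -> R) :
  (forall n, Rabs (a n) <= p n) -> ex_series p -> ex_series a.
Proof. intros H Hp. eapply (ex_series_le (K := R_AbsRing) (V := R_CompleteNormedModule)); eauto. Qed.

Lemma Series_abs_le (a p : nat -> R) :
  (forall n, Rabs (a n) <= p n) -> ex_series p -> Rabs (Series a) <= Series p.
Proof.
  intros H Hp.
  assert (ex_series (fun n => Rabs (a n))).
  { eapply ex_series_abs_le; eauto. intro n. rewrite Rabs_Rabsolu. auto. }
  eapply Rle_trans; [now apply Series_Rabs|].
  apply Series_le; auto. intro n; split; [apply Rabs_pos | auto].
Qed.

Lemma ex_series_plus_R (a p : nat -> R) :
  ex_series a -> ex_series p -> ex_series (fun n => a n + p n).
Proof. intros. now apply (ex_series_plus (K := R_AbsRing) (V := R_NormedModule)). Qed.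

Lemma ex_series_scal_R (c : R) (a : nat -> R) :
  ex_series a -> ex_series (fun n => c * a n).
Proof. intros. now apply (ex_series_scal (K := R_AbsRing) (V := R_NormedModule)). Qed.

Lemma ex_series_scal_r_R (c : R) (a : nat -> R) :
  ex_series a -> ex_series (fun n => a n * c).
Proof.
  intro H. eapply ex_series_ext; [| apply (ex_series_scal_R c _ H)].
  intro n; simpl. apply Rmult_comm.
Qed.

Lemma ex_series_sum_n (a : nat -> nat -> R) M :
  (forall m, ex_series (fun n => a n m)) ->
  ex_series (fun n => sum_n (a n) M) /\
  Series (fun n => sum_n (a n) M) = sum_n (fun m => Series (fun n => a n m)) M.
Proof.
  intro H. induction M as [|M [IH1 IH2]].
  - split.
    + eapply ex_series_ext; [| apply (H 0%nat)]. intro n. now rewrite sum_O.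
    + rewrite sum_O. apply Series_ext. intro n. now rewrite sum_O.
  - split.
    + eapply ex_series_ext; [| apply (ex_series_plus_R _ _ IH1 (H (S M)))].
      intro n. simpl. now rewrite sum_n_Sr.
    + rewrite sum_n_Sr, <- IH2, <- Series_plus by auto.
      apply Series_ext. intro n. apply sum_n_Sr.
Qed.

(** The tail of [a] is dominated termwise by the tail of [q]. The resulting remainder estimate
    depends on the majorant only, hence is uniform over a family of sequences. *)
Lemma Series_minus_sum_n (a q : nat -> R) M :
  (forall n, Rabs (a n) <= q n) -> ex_series q ->
  Rabs (Series a - sum_n a M) <= Series q - sum_n q M.
Proof.
  intros H Hq.
  assert (Ha : ex_series a) by (eapply ex_series_abs_le; eauto).
  rewrite (Series_incr_n a (S M)), (Series_incr_n q (S M)) by (auto; lia).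
  simpl pred. rewrite !sum_n_Reals.
  replace (sum_f_R0 a M + Series (fun k => a (S M + k)%nat) - sum_f_R0 a M)
    with (Series (fun k => a (S M + k)%nat)) by ring.
  replace (sum_f_R0 q M + Series (fun k => q (S M + k)%nat) - sum_f_R0 q M)
    with (Series (fun k => q (S M + k)%nat)) by ring.
  apply Series_abs_le; auto.
  now apply (ex_series_incr_n q (S M)).
Qed.

(** Fubini for a product majorant: finitely many columns commute with the sum over rows, and the
    remainder is at most [Series p] times the tail of [q]. *)
Lemma Series_swap (a : nat -> nat -> R) (p q : nat -> R) :
  (forall n m, Rabs (a n m) <= p n * q m) -> ex_series p -> ex_series q ->
  (forall n, 0 <= p n) -> (forall m, 0 <= q m) ->
  Series (fun n => Series (fun m => a n m)) = Series (fun m => Series (fun n => a n m)).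
Proof.
  intros H Hp Hq Pp Pq. symmetry. apply is_series_unique.
  assert (Hrow : forall n, ex_series (a n)).
  { intro n. apply (ex_series_abs_le _ (fun m => p n * q m)); auto. now apply ex_series_scal_R. }
  assert (Hcol : forall m, ex_series (fun n => a n m)).
  { intro m. apply (ex_series_abs_le _ (fun n => p n * q m)); auto. now apply ex_series_scal_r_R. }
  assert (HS : ex_series (fun n => Series (a n))).
  { apply (ex_series_abs_le _ (fun n => p n * Series q)); [|now apply ex_series_scal_r_R].
    intro n. rewrite <- Series_scal_l. apply Series_abs_le; auto. now apply ex_series_scal_R. }
  set (T := Series (fun n => Series (fun m => a n m))).
  change (is_lim_seq (sum_n (fun m => Series (fun n => a n m))) T).
  assert (Hlim : is_lim_seq (fun M => Series p * (Series q - sum_n q M)) 0).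
  { replace 0 with (Series p * (Series q - Series q)) by ring.
    apply (is_lim_seq_scal_l _ (Series p) (Series q - Series q)).
    apply is_lim_seq_minus'; [apply is_lim_seq_const | apply (Series_correct _ Hq)]. }
  apply is_lim_seq_spec. intro eps.
  apply is_lim_seq_spec in Hlim. destruct (Hlim eps) as [N HN]. exists N. intros M HM.
  specialize (HN M HM). rewrite Rminus_0_r in HN. eapply Rle_lt_trans; [|apply (Rle_lt_trans _ _ _ (Rle_abs _) HN)].
  destruct (ex_series_sum_n a M Hcol) as [E1 E2]. rewrite <- E2.
  rewrite Rabs_minus_sym. unfold T. rewrite <- Series_minus by auto.
  rewrite <- Series_scal_r.
  apply Series_abs_le; [|now apply ex_series_scal_r_R].
  intro n. eapply Rle_trans.
  - apply (Series_minus_sum_n (a n) (fun m => p n * q m) M); auto. now apply ex_series_scal_R.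
  - apply Req_le. rewrite Series_scal_l.
    replace (sum_n (fun m => p n * q m) M) with (p n * sum_n q M); [ring|].
    symmetry. exact (sum_n_mult_l (K := R_Ring) (p n) q M).
Qed.

(* Tannery's theorem *)
Lemma Series_dominated_zero (e : nat -> nat -> R) (p : nat -> R) :
  (forall K n, Rabs (e K n) <= p n) -> ex_series p ->
  (forall n, is_lim_seq (fun K => e K n) 0) ->
  is_lim_seq (fun K => Series (e K)) 0.
Proof.
  intros H Hp Hl.
  assert (Hsum : forall J, is_lim_seq (fun K => sum_n (e K) J) 0).
  { induction J.
    - eapply is_lim_seq_ext; [|apply (Hl 0%nat)]. intro; now rewrite sum_O.
    - replace 0 with (0 + 0) by ring.
      eapply is_lim_seq_ext; [|apply (is_lim_seq_plus' _ _ _ _ IHJ (Hl (S J)))].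
      intro; simpl. now rewrite sum_n_Sr. }
  assert (Ht := Series_correct _ Hp). change (is_lim_seq (sum_n p) (Series p)) in Ht.
  apply is_lim_seq_spec in Ht. apply is_lim_seq_spec. intro eps.
  destruct (Ht (pos_div_2 eps)) as [J HJ]. specialize (HJ J (le_n _)).
  specialize (Hsum J). apply is_lim_seq_spec in Hsum.
  destruct (Hsum (pos_div_2 eps)) as [N HN]. exists N. intros K HK. specialize (HN K HK).
  pose proof (Series_minus_sum_n (e K) p J (H K) Hp) as HB.
  simpl in *. apply Rabs_def2 in HN. apply Rabs_def2 in HJ. apply Rabs_le_between in HB.
  apply Rabs_def1; lra.
Qed.

(** * Absolutely convergent complex series *)

Definition asum (a : nat -> C) : Prop := ex_series (fun n => Cmod (a n)).

Lemma asum_le (a : nat -> C) (p : nat -> R) :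
  (forall n, Cmod (a n) <= p n) -> ex_series p -> asum a.
Proof.
  intros H. apply ex_series_abs_le. intro n. rewrite Rabs_pos_eq; auto. apply Cmod_ge_0.
Qed.

Lemma asum_Re a : asum a -> ex_series (fun n => Re (a n)).
Proof. apply ex_series_abs_le. intro; apply re_le_Cmod. Qed.

Lemma asum_Im a : asum a -> ex_series (fun n => Im (a n)).
Proof. apply ex_series_abs_le. intro; apply im_le_Cmod. Qed.

Lemma asum_plus a c : asum a -> asum c -> asum (fun n => Cplus (a n) (c n)).
Proof.
  intros Ha Hc. eapply asum_le; [|apply (ex_series_plus_R _ _ Ha Hc)].
  intro n. apply Cmod_triangle.
Qed.

Lemma asum_scal c a : asum a -> asum (fun n => Cmult c (a n)).
Proof.
  intros Ha. eapply asum_le; [|apply (ex_series_scal_R (Cmod c) _ Ha)].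
  intro n. rewrite Cmod_mult. apply Rle_refl.
Qed.

Lemma csum_ext a c : (forall n, a n = c n) -> csum a = csum c.
Proof. intro H. unfold csum. f_equal; apply Series_ext; intro n; now rewrite H. Qed.

Lemma csum_plus a c : asum a -> asum c ->
  csum (fun n => Cplus (a n) (c n)) = Cplus (csum a) (csum c).
Proof.
  intros Ha Hc. apply Ceq; simpl.
  - rewrite <- Series_plus by now apply asum_Re. now apply Series_ext.
  - rewrite <- Series_plus by now apply asum_Im. now apply Series_ext.
Qed.

Lemma csum_scal z a : asum a -> csum (fun n => Cmult z (a n)) = Cmult z (csum a).
Proof.
  intros Ha. pose proof (asum_Re _ Ha). pose proof (asum_Im _ Ha).
  apply Ceq; simpl.
  - rewrite <- !Series_scal_l, <- Series_minus by now apply ex_series_scal_R. now apply Series_ext.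
  - rewrite <- !Series_scal_l, <- Series_plus by now apply ex_series_scal_R. now apply Series_ext.
Qed.

Lemma csum_minus a c : asum a -> asum c ->
  csum (fun n => Cminus (a n) (c n)) = Cminus (csum a) (csum c).
Proof.
  intros Ha Hc. rewrite (csum_ext _ (fun n => Cplus (a n) (Cmult (RtoC (-1)) (c n)))).
  - rewrite csum_plus by (auto; now apply asum_scal). rewrite csum_scal by auto.
    apply Ceq; simpl; ring.
  - intro n; apply Ceq; simpl; ring.
Qed.

Lemma csum_0 : csum (fun _ => RtoC 0) = RtoC 0.
Proof.
  unfold csum; simpl. rewrite (Series_ext _ (fun _ => 0 * 0)) by (intro; ring).
  rewrite Series_scal_l. unfold RtoC. f_equal; ring.
Qed.

(** The factor 2 comes from bounding the real and imaginary parts separately. *)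
Lemma csum_bound (a : nat -> C) (p : nat -> R) :
  (forall n, Cmod (a n) <= p n) -> ex_series p -> Cmod (csum a) <= 2 * Series p.
Proof.
  intros H Hp. eapply Rle_trans; [apply Cmod_le_Re_Im|]. simpl.
  assert (Rabs (Series (fun k => Re (a k))) <= Series p).
  { apply Series_abs_le; auto. intro; eapply Rle_trans; [apply re_le_Cmod|auto]. }
  assert (Rabs (Series (fun k => Im (a k))) <= Series p).
  { apply Series_abs_le; auto. intro; eapply Rle_trans; [apply im_le_Cmod|auto]. }
  lra.
Qed.

Lemma csum_incr_1 a : asum a -> csum a = Cplus (a 0%nat) (csum (fun n => a (S n))).
Proof.
  intro Ha. apply Ceq; simpl.
  - rewrite (Series_incr_1 (fun k => Re (a k))) by now apply asum_Re. reflexivity.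
  - rewrite (Series_incr_1 (fun k => Im (a k))) by now apply asum_Im. reflexivity.
Qed.

Lemma asum_incr_1 a : asum a -> asum (fun n => a (S n)).
Proof. apply (ex_series_incr_1 (fun n => Cmod (a n))). Qed.

Lemma csum_swap (a : nat -> nat -> C) (p q : nat -> R) :
  (forall n m, Cmod (a n m) <= p n * q m) -> ex_series p -> ex_series q ->
  (forall n, 0 <= p n) -> (forall m, 0 <= q m) ->
  csum (fun n => csum (fun m => a n m)) = csum (fun m => csum (fun n => a n m)).
Proof.
  intros H Hp Hq Pp Pq. apply Ceq; simpl; apply (Series_swap _ p q); auto;
  intros n m; eapply Rle_trans; [apply re_le_Cmod|auto|apply im_le_Cmod|auto].
Qed.

Lemma asum_csum (a : nat -> nat -> C) (p q : nat -> R) :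
  (forall n m, Cmod (a n m) <= p n * q m) -> ex_series p -> ex_series q ->
  asum (fun n => csum (a n)).
Proof.
  intros H Hp Hq. apply (asum_le _ (fun n => p n * (2 * Series q))).
  - intro n. replace (p n * (2 * Series q)) with (2 * Series (fun m => p n * q m)).
    + apply csum_bound; auto. now apply ex_series_scal_R.
    + rewrite Series_scal_l; ring.
  - now apply ex_series_scal_r_R.
Qed.

(** * Two-sided series over the integers *)

Definition zseries (p : Z -> R) : Prop :=
  ex_series (fun k => p (Z.of_nat k)) /\ ex_series (fun k => p (- Z.of_nat (S k))%Z).

Definition zasum (a : Z -> C) : Prop := zseries (fun k => Cmod (a k)).

Lemma zasum_le (a : Z -> C) (p : Z -> R) :
  (forall n, Cmod (a n) <= p n) -> zseries p -> zasum a.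
Proof.
  intros H [H1 H2]; split; [eapply asum_le with (2 := H1)|eapply asum_le with (2 := H2)];
  intro; apply H.
Qed.

Lemma zseries_scal c p : zseries p -> zseries (fun k => c * p k).
Proof. intros [H1 H2]; split; [now apply (ex_series_scal_R c _) in H1|now apply (ex_series_scal_R c _) in H2]. Qed.

Lemma zsum_ext a c : (forall k, a k = c k) -> zsum a = zsum c.
Proof. intro H. unfold zsum. f_equal; apply csum_ext; intro; apply H. Qed.

Lemma zsum_plus a c : zasum a -> zasum c ->
  zsum (fun k => Cplus (a k) (c k)) = Cplus (zsum a) (zsum c).
Proof.
  intros [A1 A2] [C1 C2]. unfold zsum.
  rewrite (csum_plus (fun k => a (Z.of_nat k)) (fun k => c (Z.of_nat k)) A1 C1).
  rewrite (csum_plus (fun k => a (- Z.of_nat (S k))%Z) (fun k => c (- Z.of_nat (S k))%Z) A2 C2).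
  apply Ceq; simpl; ring.
Qed.

Lemma zsum_scal z a : zasum a -> zsum (fun k => Cmult z (a k)) = Cmult z (zsum a).
Proof.
  intros [A1 A2]. unfold zsum.
  rewrite (csum_scal z (fun k => a (Z.of_nat k)) A1).
  rewrite (csum_scal z (fun k => a (- Z.of_nat (S k))%Z) A2).
  apply Ceq; simpl; ring.
Qed.

Lemma zasum_scal z a : zasum a -> zasum (fun k => Cmult z (a k)).
Proof. intros [A1 A2]; split; [apply (asum_scal z _ A1)|apply (asum_scal z _ A2)]. Qed.

Lemma zasum_plus a c : zasum a -> zasum c -> zasum (fun k => Cplus (a k) (c k)).
Proof. intros [A1 A2] [C1 C2]; split; [apply (asum_plus _ _ A1 C1)|apply (asum_plus _ _ A2 C2)]. Qed.

Lemma zasum_minus a c : zasum a -> zasum c -> zasum (fun k => Cminus (a k) (c k)).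
Proof.
  intros Ha [C1 C2]. apply zasum_plus; auto.
  split; [apply (ex_series_ext (fun k => Cmod (c (Z.of_nat k))))|apply (ex_series_ext (fun k => Cmod (c (- Z.of_nat (S k))%Z)))];
  auto; intro; now rewrite Cmod_opp.
Qed.

Lemma zsum_minus a c : zasum a -> zasum c ->
  zsum (fun k => Cminus (a k) (c k)) = Cminus (zsum a) (zsum c).
Proof.
  intros [A1 A2] [C1 C2]. unfold zsum.
  rewrite (csum_minus (fun k => a (Z.of_nat k)) (fun k => c (Z.of_nat k)) A1 C1).
  rewrite (csum_minus (fun k => a (- Z.of_nat (S k))%Z) (fun k => c (- Z.of_nat (S k))%Z) A2 C2).
  apply Ceq; simpl; ring.
Qed.

(** Dividing by [z] transfers summability from the products to [a]. This serves where an estimate is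
    available only for the complete term, with all its factors. *)
Lemma csum_scal_neq0 z a : z <> RtoC 0 -> asum (fun n => Cmult z (a n)) ->
  csum (fun n => Cmult z (a n)) = Cmult z (csum a).
Proof.
  intros Hz H. apply csum_scal. apply (ex_series_ext (fun n => / Cmod z * Cmod (Cmult z (a n)))).
  - intro n. rewrite Cmod_mult, <- Rmult_assoc, Rinv_l, Rmult_1_l; auto.
    intro H0. now apply Hz, Cmod_eq_0.
  - now apply ex_series_scal_R.
Qed.

Lemma zsum_scal_neq0 z a : z <> RtoC 0 -> zasum (fun n => Cmult z (a n)) ->
  zsum (fun n => Cmult z (a n)) = Cmult z (zsum a).
Proof.
  intros Hz [H1 H2]. unfold zsum.
  rewrite (csum_scal_neq0 z (fun k => a (Z.of_nat k)) Hz H1).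
  rewrite (csum_scal_neq0 z (fun k => a (- Z.of_nat (S k))%Z) Hz H2).
  apply Ceq; simpl; ring.
Qed.

Lemma zasum_csum (a : Z -> nat -> C) (p : Z -> R) (q : nat -> R) :
  (forall k n, Cmod (a k n) <= p k * q n) -> zseries p -> ex_series q ->
  zasum (fun k => csum (a k)).
Proof.
  intros H [P1 P2] Hq. split.
  - apply (asum_csum (fun k => a (Z.of_nat k)) (fun k => p (Z.of_nat k)) q); auto.
  - apply (asum_csum (fun k => a (- Z.of_nat (S k))%Z) (fun k => p (- Z.of_nat (S k))%Z) q); auto.
Qed.

Lemma zsum_bound (a : Z -> C) (p : Z -> R) :
  (forall k, Cmod (a k) <= p k) -> zseries p ->
  Cmod (zsum a) <= 2 * (Series (fun k => p (Z.of_nat k)) + Series (fun k => p (- Z.of_nat (S k))%Z)).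
Proof.
  intros H [P1 P2]. unfold zsum. eapply Rle_trans; [apply Cmod_triangle|].
  rewrite Rmult_plus_distr_l. apply Rplus_le_compat; apply csum_bound; auto.
Qed.

Lemma zsum_csum_swap (a : Z -> nat -> C) (p : Z -> R) (q : nat -> R) :
  (forall k n, Cmod (a k n) <= p k * q n) -> zseries p -> ex_series q ->
  (forall k, 0 <= p k) -> (forall n, 0 <= q n) ->
  zsum (fun k => csum (fun n => a k n)) = csum (fun n => zsum (fun k => a k n)).
Proof.
  intros H [P1 P2] Hq Pp Pq. unfold zsum.
  rewrite (csum_swap (fun k n => a (Z.of_nat k) n) (fun k => p (Z.of_nat k)) q) by auto.
  rewrite (csum_swap (fun k n => a (- Z.of_nat (S k))%Z n) (fun k => p (- Z.of_nat (S k))%Z) q) by auto.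
  rewrite csum_plus; auto.
  - apply (asum_csum (fun n k => a (Z.of_nat k) n) q (fun k => p (Z.of_nat k))); auto.
    intros; rewrite Rmult_comm; auto.
  - apply (asum_csum (fun n k => a (- Z.of_nat (S k))%Z n) q (fun k => p (- Z.of_nat (S k))%Z)); auto.
    intros; rewrite Rmult_comm; auto.
Qed.

(** Pairing [k] with [-k] matches the symmetric partial sums produced by the Dirichlet kernel. *)
Lemma zsum_sym a : zasum a ->
  zsum a = Cplus (a 0%Z) (csum (fun k => Cplus (a (Z.of_nat (S k))) (a (- Z.of_nat (S k))%Z))).
Proof.
  intros [A1 A2]. unfold zsum.
  rewrite (csum_incr_1 (fun k => a (Z.of_nat k)) A1).
  rewrite (csum_plus (fun k => a (Z.of_nat (S k))) (fun k => a (- Z.of_nat (S k))%Z)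
             (asum_incr_1 _ A1) A2).
  rewrite Cplus_assoc. reflexivity.
Qed.

(** Used to split the constant term off a Fourier series. *)
Lemma zsum_single (z : C) : zsum (fun k => if Z.eqb k 0 then z else RtoC 0) = z /\
  zasum (fun k => if Z.eqb k 0 then z else RtoC 0).
Proof.
  assert (HA : asum (fun k => if Z.eqb (Z.of_nat k) 0 then z else RtoC 0)).
  { apply (ex_series_incr_1 (fun k => Cmod (if Z.eqb (Z.of_nat k) 0 then z else RtoC 0))).
    simpl. apply (ex_series_ext (fun n => 0 * 0 ^ n)).
    - intro n. rewrite Cmod_0. apply Rmult_0_l.
    - apply ex_series_scal_R. exists (/ (1 - 0)). apply is_series_geom. rewrite Rabs_R0; lra. }
  assert (HB : zasum (fun k => if Z.eqb k 0 then z else RtoC 0)).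
  { split; [exact HA|]. simpl. apply (ex_series_ext (fun n => 0 * 0 ^ n)).
    - intro n. rewrite Cmod_0. apply Rmult_0_l.
    - apply ex_series_scal_R. exists (/ (1 - 0)). apply is_series_geom. rewrite Rabs_R0; lra. }
  split; auto. rewrite zsum_sym by auto. simpl.
  rewrite (csum_ext _ (fun _ => RtoC 0)) by (intro; apply Ceq; simpl; ring).
  rewrite csum_0. apply Cplus_0_r.
Qed.

(** * Integrals over the real line *)

Notation cont f := (forall x : R, continuous f x).

Lemma cont_ex_RInt (f : R -> R) a b : cont f -> ex_RInt f a b.
Proof. intro H. apply (ex_RInt_continuous (V := R_CompleteNormedModule)). auto. Qed.

Definition RI (f : R -> R) (a b : R) : R := RInt f a b.

Lemma RI_ext (f g : R -> R) a b : (forall x, f x = g x) -> RI f a b = RI g a b.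
Proof. intro H. apply RInt_ext. auto. Qed.

Lemma RI_ext_in (f g : R -> R) a b : a <= b ->
  (forall x, a < x < b -> f x = g x) -> RI f a b = RI g a b.
Proof.
  intros Hab H. apply RInt_ext. rewrite Rmin_left, Rmax_right by auto. auto.
Qed.

Lemma RI_point (f : R -> R) a : RI f a a = 0.
Proof. apply (RInt_point (V := R_CompleteNormedModule)). Qed.

Lemma RI_Chasles (f : R -> R) a b c : cont f -> RI f a b + RI f b c = RI f a c.
Proof.
  intro H. apply (RInt_Chasles (V := R_CompleteNormedModule)); now apply cont_ex_RInt.
Qed.

Lemma cont_mult (f g : R -> R) : cont f -> cont g -> cont (fun x => f x * g x).
Proof. intros Hf Hg x. apply (continuous_mult (K := R_AbsRing)); auto. Qed.

Lemma cont_plus (f g : R -> R) : cont f -> cont g -> cont (fun x => f x + g x).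
Proof. intros Hf Hg x. apply (continuous_plus (V := R_NormedModule)); auto. Qed.

Lemma cont_comp (f g : R -> R) : cont f -> cont g -> cont (fun x => f (g x)).
Proof. intros Hf Hg x. apply continuous_comp; auto. Qed.

Lemma cont_derivable (f : R -> R) : (forall x, ex_derive f x) -> cont f.
Proof. intros H x. apply (ex_derive_continuous (V := R_NormedModule)); auto. Qed.

Lemma RI_FTC (F f : R -> R) a b :
  (forall x, is_derive F x (f x)) -> cont f -> RI f a b = F b - F a.
Proof.
  intros HF Hf. apply is_RInt_unique.
  apply (is_RInt_derive (V := R_CompleteNormedModule)); auto.
Qed.

Lemma RI_plus (f g : R -> R) a b : cont f -> cont g ->
  RI (fun x => f x + g x) a b = RI f a b + RI g a b.
Proof. intros. apply (RInt_plus (V := R_CompleteNormedModule)); now apply cont_ex_RInt. Qed.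

Lemma RI_scal (f : R -> R) c a b : cont f ->
  RI (fun x => c * f x) a b = c * RI f a b.
Proof. intros. apply (RInt_scal (V := R_CompleteNormedModule)); now apply cont_ex_RInt. Qed.

Lemma RI_swap (f : R -> R) a b : cont f -> RI f b a = - RI f a b.
Proof.
  intros Hf. rewrite <- (opp_RInt_swap (V := R_CompleteNormedModule)).
  reflexivity. now apply cont_ex_RInt.
Qed.

Lemma RI_affine (f : R -> R) c x a b : cont f -> c <> 0 ->
  RI (fun y => f (x + c * y)) a b = RI f (x + c * a) (x + c * b) / c.
Proof.
  intros Hf Hc.
  assert (Cg : cont (fun y => f (x + c * y))).
  { apply (cont_comp f (fun y => x + c * y)); auto.
    apply cont_derivable. intro. auto_derive; auto. }
  apply Rmult_eq_reg_l with c; auto. rewrite <- RI_scal by auto.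
  replace (c * (RI f (x + c * a) (x + c * b) / c)) with (RI f (x + c * a) (x + c * b)) by (field; auto).
  rewrite (Rplus_comm x (c * a)), (Rplus_comm x (c * b)).
  unfold RI. rewrite <- (RInt_comp_lin (V := R_CompleteNormedModule)) by now apply cont_ex_RInt.
  apply RInt_ext. intros y _. unfold scal; simpl; unfold mult; simpl. now rewrite (Rplus_comm x).
Qed.

(** The two endpoints recede independently. This fits the product filter in the definition of
    [Gamma] after the substitution [t = e^x], and the asymmetric intervals met when the line is cut
    at half-integers. *)
Definition is_LInt (f : R -> R) (l : R) : Prop :=
  forall eps, 0 < eps -> exists X, forall u v, u <= - X -> X <= v -> Rabs (RI f u v - l) < eps.

Lemma is_LInt_unique f l l' : is_LInt f l -> is_LInt f l' -> l = l'.
Proof.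
  intros H H'. apply cond_eq. intros eps He.
  destruct (H (eps / 2)) as [X HX]; [lra|]. destruct (H' (eps / 2)) as [Y HY]; [lra|].
  pose proof (Rmax_l X Y). pose proof (Rmax_r X Y).
  assert (A := HX (- Rmax X Y) (Rmax X Y) ltac:(lra) ltac:(lra)).
  assert (B := HY (- Rmax X Y) (Rmax X Y) ltac:(lra) ltac:(lra)).
  apply Rabs_def2 in A. apply Rabs_def2 in B. apply Rabs_def1; lra.
Qed.

Lemma is_LInt_ext f g l : (forall x, f x = g x) -> is_LInt f l -> is_LInt g l.
Proof.
  intros E H eps He. destruct (H eps He) as [X HX]. exists X. intros u v Hu Hv.
  rewrite <- (RI_ext f g); auto.
Qed.

Lemma is_LInt_plus f g l l' : cont f -> cont g -> is_LInt f l -> is_LInt g l' ->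
  is_LInt (fun x => f x + g x) (l + l').
Proof.
  intros Cf Cg H H' eps He.
  destruct (H (eps / 2)) as [X HX]; [lra|]. destruct (H' (eps / 2)) as [Y HY]; [lra|].
  pose proof (Rmax_l X Y). pose proof (Rmax_r X Y).
  exists (Rmax X Y). intros u v Hu Hv. rewrite RI_plus by auto.
  assert (A := HX u v ltac:(lra) ltac:(lra)).
  assert (B := HY u v ltac:(lra) ltac:(lra)).
  apply Rabs_def2 in A. apply Rabs_def2 in B. apply Rabs_def1; lra.
Qed.

Lemma is_LInt_scal f c l : cont f -> is_LInt f l -> is_LInt (fun x => c * f x) (c * l).
Proof.
  intros Cf H eps He.
  pose proof (Rabs_pos c).
  destruct (H (eps / (Rabs c + 1))) as [X HX]; [apply Rdiv_lt_0_compat; lra|].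
  exists X. intros u v Hu Hv. rewrite RI_scal by auto.
  rewrite <- Rmult_minus_distr_l, Rabs_mult.
  specialize (HX u v Hu Hv).
  apply Rle_lt_trans with (Rabs c * (eps / (Rabs c + 1))).
  - apply Rmult_le_compat_l; lra.
  - apply Rmult_lt_reg_r with (Rabs c + 1); [lra|]. field_simplify; [|lra]. nra.
Qed.

Lemma Rle_div_mult c u y : 0 < c -> y / c <= u -> y <= c * u.
Proof.
  intros Hc H. apply Rmult_le_compat_l with (r := c) in H; [|lra].
  replace (c * (y / c)) with y in H by (field; lra). auto.
Qed.

Lemma is_LInt_affine f c x l : cont f -> 0 < c -> is_LInt f l ->
  is_LInt (fun y => f (x + c * y)) (l / c).
Proof.
  intros Cf Hc H eps He.
  destruct (H (eps * c)) as [X HX]; [nra|].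
  exists ((Rabs X + Rabs x) / c). intros u v Hu Hv.
  rewrite RI_affine by (auto; lra).
  assert (Hu' : (Rabs X + Rabs x) / c <= - u) by lra.
  apply Rle_div_mult in Hu'; auto. apply Rle_div_mult in Hv; auto.
  pose proof (Rle_abs X). pose proof (Rle_abs x). pose proof (Rle_abs (- x)). rewrite Rabs_Ropp in *.
  assert (A := HX (x + c * u) (x + c * v) ltac:(lra) ltac:(lra)).
  unfold Rdiv. rewrite <- Rmult_minus_distr_r, Rabs_mult, (Rabs_pos_eq (/ c)).
  - apply Rmult_lt_reg_r with c; auto. rewrite Rmult_assoc, Rinv_l by lra. lra.
  - left. now apply Rinv_0_lt_compat.
Qed.

Lemma RI_exp_bound (f : R -> R) C eps u v : cont f -> 0 < eps -> 0 <= u <= v ->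
  (forall x, 0 <= x -> Rabs (f x) <= C * exp (- eps * x)) ->
  Rabs (RI f u v) <= C / eps * (exp (- eps * u) - exp (- eps * v)).
Proof.
  intros Cf He Huv Hf.
  assert (D : is_RInt (fun x => C * exp (- eps * x)) u v
     (minus (- C / eps * exp (- eps * v)) (- C / eps * exp (- eps * u)))).
  { apply (is_RInt_derive (V := R_CompleteNormedModule) (fun x => - C / eps * exp (- eps * x))).
    - intros x _. auto_derive; auto. field. lra.
    - intros x _. apply cont_derivable. intro. auto_derive; auto. }
  unfold minus, plus, opp in D; simpl in D.
  replace (C / eps * (exp (- eps * u) - exp (- eps * v))) with
    (- C / eps * exp (- eps * v) + - (- C / eps * exp (- eps * u))) by (field; lra).
  eapply (norm_RInt_le (V := R_NormedModule) f (fun x => C * exp (- eps * x)) u v); eauto; try lra.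
  - intros x Hx. apply Hf. lra.
  - apply (RInt_correct (V := R_CompleteNormedModule)). now apply cont_ex_RInt.
Qed.

(** Subtracting [C / eps * exp (- eps * n)] turns the integrals up to the integers [n] into an
    increasing bounded sequence; its limit is the integral over the half-line, with an explicit
    rate. *)
Lemma half_line_integral (f : R -> R) C eps : cont f -> 0 < eps ->
  (forall x, 0 <= x -> Rabs (f x) <= C * exp (- eps * x)) ->
  exists l, Rabs l <= C / eps /\
    forall v, 0 <= v -> Rabs (RI f 0 v - l) <= C / eps * exp (- eps * v).
Proof.
  intros Cf He Hf.
  assert (HC : 0 <= C).
  { specialize (Hf 0 (Rle_refl _)). rewrite Rmult_0_r, exp_0 in Hf. pose proof (Rabs_pos (f 0)). lra. }
  assert (HCe : 0 <= C / eps).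
  { apply Rmult_le_pos; auto. left. now apply Rinv_0_lt_compat. }
  assert (Hpos : forall v, 0 <= C / eps * exp (- eps * v)).
  { intro v. apply Rmult_le_pos; auto. left; apply exp_pos. }
  assert (Hinc : forall u v, 0 <= u <= v ->
    Rabs (RI f 0 v - RI f 0 u) <= C / eps * (exp (- eps * u) - exp (- eps * v))).
  { intros u v Huv. rewrite <- (RI_Chasles f 0 u v) by auto.
    replace (RI f 0 u + RI f u v - RI f 0 u) with (RI f u v) by ring.
    now apply RI_exp_bound. }
  destruct (ex_finite_lim_seq_incr (fun n => RI f 0 (INR n) - C / eps * exp (- eps * INR n)) (C / eps))
    as [l Hl].
  - intro n. pose proof (pos_INR n).
    assert (H1 := Hinc (INR n) (INR (S n)) ltac:(rewrite S_INR; lra)).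
    apply Rabs_le_between in H1. lra.
  - intro n. pose proof (pos_INR n).
    assert (H1 := RI_exp_bound f C eps 0 (INR n) Cf He ltac:(lra) Hf). apply Rabs_le_between in H1.
    rewrite Rmult_0_r, exp_0 in H1. specialize (Hpos (INR n)). lra.
  - assert (K : forall v, 0 <= v -> Rabs (RI f 0 v - l) <= C / eps * exp (- eps * v)).
    { intros v Hv. rewrite Rabs_minus_sym.
      destruct (INR_unbounded v) as [N HN].
      assert (E1 : forall n, (N <= n)%nat -> - (C / eps * exp (- eps * v)) <=
        RI f 0 (INR n) - C / eps * exp (- eps * INR n) - RI f 0 v <= C / eps * exp (- eps * v)).
      { intros n Hn. apply le_INR in Hn. assert (H1 := Hinc v (INR n) ltac:(lra)).
        apply Rabs_le_between in H1. specialize (Hpos (INR n)). lra. }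
      assert (Hl' : is_lim_seq (fun n => RI f 0 (INR n) - C / eps * exp (- eps * INR n) - RI f 0 v)
        (l - RI f 0 v)).
      { apply is_lim_seq_minus'; [auto|apply is_lim_seq_const]. }
      assert (U : Rbar_le (l - RI f 0 v) (C / eps * exp (- eps * v))).
      { eapply is_lim_seq_le_loc; [|exact Hl'|apply is_lim_seq_const].
        exists N. intros n Hn. now apply E1. }
      assert (L : Rbar_le (- (C / eps * exp (- eps * v))) (l - RI f 0 v)).
      { eapply is_lim_seq_le_loc; [|apply is_lim_seq_const|exact Hl'].
        exists N. intros n Hn. now apply E1. }
      simpl in U, L. apply Rabs_le_between. lra. }
    exists l. split; auto.
    specialize (K 0 (Rle_refl _)). rewrite Rmult_0_r, exp_0, RI_point in K.
   rewrite Rminus_0_l, Rabs_Ropp in K. lra.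
Qed.

Lemma exp_eventually_small C eps eta : 0 <= C -> 0 < eps -> 0 < eta ->
  exists X, 0 <= X /\ forall v, X <= v -> C * exp (- eps * v) < eta.
Proof.
  intros HC He Ht. exists ((C / eta) / eps).
  assert (0 <= C / eta) by (apply Rmult_le_pos; auto; left; now apply Rinv_0_lt_compat).
  split. { apply Rmult_le_pos; auto; left; now apply Rinv_0_lt_compat. }
  intros v Hv. apply Rle_div_mult in Hv; auto.
  replace (- eps * v) with (- (eps * v)) by ring. rewrite exp_Ropp.
  assert (H1 := exp_ineq1_le (eps * v)).
  assert (C < eta * exp (eps * v)).
  { apply Rlt_le_trans with (eta * (1 + C / eta)).
    - field_simplify; lra.
    - apply Rmult_le_compat_l; lra. }
  apply Rmult_lt_reg_r with (exp (eps * v)); [apply exp_pos|].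
  rewrite Rmult_assoc, Rinv_l; [lra|]. pose proof (exp_pos (eps * v)). lra.
Qed.

Lemma LInt_ex (f : R -> R) C eps : cont f -> 0 < eps ->
  (forall x, Rabs (f x) <= C * exp (- eps * Rabs x)) ->
  exists l, is_LInt f l /\ Rabs l <= 2 * (C / eps).
Proof.
  intros Cf He Hf.
  destruct (half_line_integral f C eps) as [l1 [B1 H1]]; auto.
  { intros x Hx. specialize (Hf x). rewrite (Rabs_pos_eq x) in Hf; auto. }
  assert (Cg : cont (fun x => f (- x))).
  { apply (cont_comp f (fun x => - x)); auto. apply cont_derivable. intro; auto_derive; auto. }
  destruct (half_line_integral (fun x => f (- x)) C eps) as [l2 [B2 H2]]; auto.
  { intros x Hx. specialize (Hf (- x)). rewrite Rabs_Ropp, (Rabs_pos_eq x) in Hf; auto. }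
  assert (HC : 0 <= C / eps) by (pose proof (Rabs_pos l1); lra).
  exists (l1 + l2). split.
  - intros eta Ht.
    destruct (exp_eventually_small (C / eps) eps (eta / 2)) as [X [HX0 HX]]; auto; [lra|].
    exists X. intros u v Hu Hv.
    rewrite <- (RI_Chasles f u 0 v) by auto.
    assert (E : RI f u 0 = RI (fun x => f (- x)) 0 (- u)).
    { rewrite (RI_ext (fun x => f (- x)) (fun y => f (0 + (-1) * y))) by (intros; f_equal; ring).
      rewrite RI_affine by (auto; lra).
      replace (0 + -1 * 0) with 0 by ring. replace (0 + -1 * - u) with u by ring.
      rewrite (RI_swap f u 0) by auto. field. }
    rewrite E.
    assert (A := H1 v ltac:(lra)). assert (B := H2 (- u) ltac:(lra)).
    assert (A' := HX v Hv). assert (B' := HX (- u) ltac:(lra)).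
    apply Rabs_le_between in A. apply Rabs_le_between in B. apply Rabs_def1; lra.
  - eapply Rle_trans; [apply Rabs_triang|]. lra.
Qed.

(** * Riemann-Lebesgue lemma and Poisson summation *)

Lemma cont_sin_lin l : cont (fun y => sin (l * y)).
Proof. apply cont_derivable. intro; auto_derive; auto. Qed.

Lemma cont_mono_ex_RInt (h : R -> R) a b : a <= b ->
  (forall y, a <= y <= b -> continuous h y) -> ex_RInt h a b.
Proof.
  intros Hab H. apply (ex_RInt_continuous (V := R_CompleteNormedModule)).
  intros z Hz. rewrite Rmin_left, Rmax_right in Hz; auto.
Qed.

(** Uniform continuity gives a subdivision on whose pieces [h] varies by less than [e0]. Freezing
    [h] at the left end of a piece of width [w] costs at most [w * e0], and a constant times the
    sine integrates to [O(1/l)]. Mere continuity of [h] is assumed because the function of interest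
    is a quotient with a removable singularity. *)
Lemma riemann_lebesgue (h : R -> R) a b : a < b ->
  (forall y, a <= y <= b -> continuous h y) ->
  forall eps, 0 < eps -> exists L, forall l, L < l ->
    Rabs (RI (fun y => h y * sin (l * y)) a b) < eps.
Proof.
  intros Hab Hh eps He.
  (* The freezing errors then add up to [(b - a) * e0 = eps / 2]; the other half is left for the
     oscillating part. *)
  pose (e0 := eps / (2 * (b - a))).
  assert (He0 : 0 < e0) by (apply Rdiv_lt_0_compat; lra).
  destruct (unifcont_1d h a b Hh (mkposreal _ He0)) as [d Hd].
  destruct (INR_unbounded ((b - a) / d)) as [n Hn].
  assert (Hd0 := cond_pos d).
  assert (Hn0 : 0 < INR n).
  { apply Rlt_trans with ((b - a) / d); auto. apply Rdiv_lt_0_compat; lra. }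
  pose (w := (b - a) / INR n).
  assert (Hw : 0 < w) by (apply Rdiv_lt_0_compat; lra).
  assert (Hwd : w < d).
  { unfold w. apply Rmult_lt_reg_r with (INR n / d). apply Rdiv_lt_0_compat; lra.
    replace ((b - a) / INR n * (INR n / d)) with ((b - a) / d) by (field; lra).
    replace (d * (INR n / d)) with (INR n) by (field; lra). auto. }
  assert (Hwn : a + INR n * w = b) by (unfold w; field; lra).
  assert (Cs : forall l y, a <= y <= b -> continuous (fun y => h y * sin (l * y)) y).
  { intros l y Hy. apply (continuous_mult (K := R_AbsRing)); auto. apply cont_sin_lin. }
  (* [M] collects [2 * |h|] at the left ends of the first [i] pieces; it does not depend on [l]. *)
  assert (IND : forall i, (i <= n)%nat -> exists M, 0 <= M /\ forall l, 0 < l ->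
     Rabs (RI (fun y => h y * sin (l * y)) a (a + INR i * w)) <= INR i * w * e0 + M / l).
  { induction i as [|i IH]; intro Hi.
    - exists 0. split; [lra|]. intros l Hl. simpl. rewrite Rmult_0_l, Rplus_0_r, RI_point.
       rewrite Rabs_R0. unfold Rdiv. lra.
    - destruct IH as [M [HM0 HM]]; [lia|].
      pose (y0 := a + INR i * w). pose (y1 := a + INR (S i) * w).
      assert (Hy01 : y1 = y0 + w) by (unfold y0, y1; rewrite S_INR; ring).
      assert (Ha : a <= y0) by (unfold y0; pose proof (pos_INR i); nra).
      assert (Hb : y1 <= b).
      { rewrite <- Hwn. unfold y1. apply le_INR in Hi. nra. }
      exists (M + 2 * Rabs (h y0)). pose proof (Rabs_pos (h y0)). split; [lra|]. intros l Hl.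
      fold y1. fold y0 in HM. specialize (HM l Hl).
      assert (X1 : ex_RInt (fun y => h y * sin (l * y)) a y0).
      { apply cont_mono_ex_RInt; auto. intros; apply Cs; lra. }
      assert (X2 : ex_RInt (fun y => h y * sin (l * y)) y0 y1).
      { apply cont_mono_ex_RInt; [lra|]. intros; apply Cs; lra. }
      assert (EC : RI (fun y => h y * sin (l * y)) a y1 = RI (fun y => h y * sin (l * y)) a y0 + RI (fun y => h y * sin (l * y)) y0 y1).
      { symmetry. apply (RInt_Chasles (V := R_CompleteNormedModule) _ a y0 y1 X1 X2). }
      rewrite EC.
      assert (P1 : ex_RInt (fun y => (h y - h y0) * sin (l * y)) y0 y1).
      { apply cont_mono_ex_RInt; [lra|]. intros y Hy. apply (continuous_mult (K := R_AbsRing)).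
        - apply (continuous_minus (V := R_NormedModule)); [apply Hh; lra | apply continuous_const].
        - apply cont_sin_lin. }
      assert (P2 : is_RInt (fun y => h y0 * sin (l * y)) y0 y1
         (minus (- (h y0 / l) * cos (l * y1)) (- (h y0 / l) * cos (l * y0)))).
      { apply (is_RInt_derive (V := R_CompleteNormedModule) (fun y => - (h y0 / l) * cos (l * y))).
        - intros x _. auto_derive; auto. field. lra.
        - intros x _. apply (cont_mult (fun _ => h y0) (fun y => sin (l * y))).
          intro; apply continuous_const. apply cont_sin_lin. }
      assert (E : RI (fun y => h y * sin (l * y)) y0 y1 =
         RI (fun y => (h y - h y0) * sin (l * y)) y0 y1 +
         (- (h y0 / l) * cos (l * y1) - (- (h y0 / l) * cos (l * y0)))).
      { apply is_RInt_unique.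
        apply (is_RInt_ext (fun y => plus ((h y - h y0) * sin (l * y)) (h y0 * sin (l * y)))).
        - intros y _. unfold plus; simpl. ring.
        - apply (is_RInt_plus (V := R_NormedModule)); [now apply (RInt_correct (V := R_CompleteNormedModule)) | exact P2]. }
      rewrite E.
      assert (Q1 : Rabs (RI (fun y => (h y - h y0) * sin (l * y)) y0 y1) <= (y1 - y0) * e0).
      { apply abs_RInt_le_const; [lra|auto|]. intros y Hy. rewrite Rabs_mult.
        assert (Rabs (sin (l * y)) <= 1) by (apply Rabs_le; apply SIN_bound).
        assert (Hball : Rabs (h y - h y0) < e0).
        { apply Rnot_le_lt. intro Hc. apply (Hd y0 y); [lra|lra| |].
          - unfold ball; simpl. unfold AbsRing_ball, abs, minus, plus, opp; simpl.
            apply Rabs_def1; lra.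
          - intro Hb'. unfold ball in Hb'; simpl in Hb'.
            unfold AbsRing_ball, abs, minus, plus, opp in Hb'; simpl in Hb'. unfold Rminus in Hc. lra. }
        pose proof (Rabs_pos (h y - h y0)). pose proof (Rabs_pos (sin (l * y))). nra. }
      assert (Q2 : Rabs (- (h y0 / l) * cos (l * y1) - (- (h y0 / l) * cos (l * y0))) <= 2 * Rabs (h y0) / l).
      { replace (- (h y0 / l) * cos (l * y1) - (- (h y0 / l) * cos (l * y0)))
          with (h y0 * (cos (l * y0) - cos (l * y1)) / l) by (field; lra).
        unfold Rdiv. rewrite !Rabs_mult, (Rabs_pos_eq (/ l)) by (left; now apply Rinv_0_lt_compat).
        apply Rmult_le_compat_r; [left; now apply Rinv_0_lt_compat|].
        assert (Rabs (cos (l * y0) - cos (l * y1)) <= 2).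
        { pose proof (COS_bound (l * y0)). pose proof (COS_bound (l * y1)). apply Rabs_le; lra. }
        nra. }
      eapply Rle_trans; [apply Rabs_triang|].
      apply Rle_trans with ((INR i * w * e0 + M / l) + ((y1 - y0) * e0 + 2 * Rabs (h y0) / l)).
      + apply Rplus_le_compat; auto. eapply Rle_trans; [apply Rabs_triang|]. lra.
      + rewrite S_INR. apply Req_le. rewrite Hy01. field. lra. }
  destruct (IND n (le_n _)) as [M [HM0 HM]].
  exists (2 * (M + 1) / eps). intros l Hl.
  assert (0 < 2 * (M + 1) / eps) by (apply Rdiv_lt_0_compat; lra).
  specialize (HM l ltac:(lra)). rewrite Hwn in HM.
  eapply Rle_lt_trans; [apply HM|].
  replace (INR n * w * e0) with (eps / 2) by (unfold e0, w; field; lra).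
  assert (M / l < eps / 2).
  { apply Rmult_lt_reg_r with l; [lra|]. unfold Rdiv at 1. rewrite Rmult_assoc, Rinv_l by lra.
    apply Rmult_lt_compat_r with (r := eps) in Hl; [|lra].
    unfold Rdiv in Hl. rewrite Rmult_assoc, Rinv_l in Hl by lra. lra. }
  lra.
Qed.

Lemma cont_bounded (h : R -> R) a b : a <= b ->
  (forall y, a <= y <= b -> continuous h y) ->
  exists M, 0 <= M /\ forall y, a <= y <= b -> Rabs (h y) <= M.
Proof.
  intros Hab H.
  assert (H' : forall c, a <= c <= b -> continuity_pt h c).
  { intros c Hc. apply continuity_pt_filterlim. now apply H. }
  destruct (continuity_ab_maj h a b Hab H') as [x [Hx _]].
  destruct (continuity_ab_min h a b Hab H') as [z [Hz _]].
  exists (Rabs (h x) + Rabs (h z)).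
  pose proof (Rabs_pos (h x)). pose proof (Rabs_pos (h z)). split; [lra|].
  intros y Hy. specialize (Hx y Hy). specialize (Hz y Hy).
  pose proof (Rle_abs (h x)). pose proof (Rle_abs (- h z)). rewrite Rabs_Ropp in *.
  apply Rabs_le. lra.
Qed.

(** The value at 0 is prescribed, so that the difference quotient becomes continuous there when [d]
    is the derivative of [f] at 0. *)
Definition slope (f : R -> R) (d y : R) : R :=
  if Req_EM_T y 0 then d else (f y - f 0) / y.

Lemma slope_continuous f d y : continuous f y -> is_derive f 0 d -> continuous (slope f d) y.
Proof.
  intros Cf Hd. destruct (Req_EM_T y 0) as [->|Hy].
  - apply is_derive_Reals in Hd. apply filterlim_locally. intro eps.
    destruct (Hd eps (cond_pos eps)) as [dl Hdl]. exists dl. intros h Hh.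
    unfold ball in *; simpl in *; unfold AbsRing_ball, abs, minus, plus, opp in *; simpl in *.
    unfold slope. destruct (Req_EM_T 0 0) as [_|]; [|lra]. destruct (Req_EM_T h 0) as [_|Hh0].
    + rewrite Rplus_opp_r, Rabs_R0. apply cond_pos.
    + rewrite Ropp_0, Rplus_0_r in Hh. specialize (Hdl h Hh0 Hh). rewrite Rplus_0_l in Hdl. exact Hdl.
  - apply (continuous_ext_loc _ (fun y => (f y - f 0) * / y)).
    + assert (Hp : 0 < Rabs y) by now apply Rabs_pos_lt.
      exists (mkposreal _ Hp). intros z Hz.
      unfold ball in *; simpl in *; unfold AbsRing_ball, abs, minus, plus, opp in *; simpl in *.
      unfold slope. destruct (Req_EM_T z 0) as [->|]; [|reflexivity].
      rewrite Rplus_0_l, Rabs_Ropp in Hz. lra.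
    + apply (continuous_mult (K := R_AbsRing)).
      * apply (continuous_minus (V := R_NormedModule)); [auto|apply continuous_const].
      * apply continuous_Rinv; auto.
Qed.

Lemma sin_PI_mult_neq_0 y : - (1 / 2) <= y <= 1 / 2 -> y <> 0 -> sin (PI * y) <> 0.
Proof.
  intros Hy H0. pose proof PI_RGT_0.
  destruct (Rtotal_order y 0) as [H1|[H1|H1]]; [| contradiction |].
  - assert (0 < sin (PI * - y)) by (apply sin_gt_0; nra).
    replace (PI * - y) with (- (PI * y)) in H2 by ring. rewrite sin_neg in H2. lra.
  - assert (0 < sin (PI * y)) by (apply sin_gt_0; nra). lra.
Qed.

(** This is [y / sin (PI * y)], extended by [1 / PI] at 0. *)
Definition csc_weight (y : R) : R := / slope (fun t => sin (PI * t)) PI y.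

Lemma csc_weight_continuous y : - (1 / 2) <= y <= 1 / 2 -> continuous csc_weight y.
Proof.
  intro Hy. apply (continuous_comp (slope (fun t => sin (PI * t)) PI) Rinv).
  - apply slope_continuous.
    + apply cont_sin_lin.
    + auto_derive; auto. rewrite Rmult_0_r, cos_0. ring.
  - apply continuous_Rinv. unfold slope. pose proof PI_RGT_0.
    destruct (Req_EM_T y 0); [lra|].
    rewrite Rmult_0_r, sin_0, Rminus_0_r. apply Rmult_integral_contrapositive_currified.
    + now apply sin_PI_mult_neq_0.
    + now apply Rinv_neq_0_compat.
Qed.

Fixpoint dirichlet (K : nat) (y : R) : R :=
  match K with
  | O => 1
  | S k => dirichlet k y + 2 * cos (2 * PI * INR (S k) * y)
  end.

(** Telescoping of [2 cos a sin b = sin (a + b) - sin (a - b)]. *)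
Lemma dirichlet_sin K y : dirichlet K y * sin (PI * y) = sin ((2 * INR K + 1) * PI * y).
Proof.
  induction K.
  - simpl. rewrite Rmult_1_l. f_equal. ring.
  - unfold dirichlet; fold dirichlet. rewrite Rmult_plus_distr_r, IHK, S_INR.
    replace ((2 * INR K + 1) * PI * y) with (2 * PI * (INR K + 1) * y - PI * y) by ring.
    replace ((2 * (INR K + 1) + 1) * PI * y) with (2 * PI * (INR K + 1) * y + PI * y) by ring.
    rewrite sin_minus, sin_plus. ring.
Qed.

Lemma dirichlet_cont K : cont (dirichlet K).
Proof.
  induction K.
  - intro; apply continuous_const.
  - apply (cont_plus (dirichlet K)); auto. apply cont_derivable. intro; auto_derive; auto.
Qed.

Lemma cos_Zperiod x n : cos (x + 2 * PI * IZR n) = cos x.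
Proof.
  assert (H : forall x k, cos (x + 2 * PI * INR k) = cos x).
  { intros z k. rewrite <- (cos_period z k). f_equal. ring. }
  destruct n as [|p|p].
  - f_equal; ring.
  - rewrite <- (positive_nat_Z p), <- INR_IZR_INZ. apply H.
  - rewrite <- (H _ (Pos.to_nat p)). f_equal. rewrite INR_IZR_INZ, positive_nat_Z.
    change (Z.neg p) with (- Z.pos p)%Z. rewrite opp_IZR. ring.
Qed.

Lemma sin_Zperiod x n : sin (x + 2 * PI * IZR n) = sin x.
Proof.
  rewrite <- (cos_shift x), <- (cos_shift (x + 2 * PI * IZR n)).
  replace (PI / 2 - x) with ((PI / 2 - (x + 2 * PI * IZR n)) + 2 * PI * IZR n) by ring.
  now rewrite cos_Zperiod.
Qed.

Lemma dirichlet_Zperiod K n y : dirichlet K (IZR n + y) = dirichlet K y.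
Proof.
  induction K; auto. unfold dirichlet; fold dirichlet. rewrite IHK. do 2 f_equal.
  replace (2 * PI * INR (S K) * (IZR n + y))
    with (2 * PI * INR (S K) * y + 2 * PI * IZR (Z.of_nat (S K) * n)).
  - apply cos_Zperiod.
  - rewrite mult_IZR, <- INR_IZR_INZ. ring.
Qed.

Lemma RI_dirichlet K : RI (dirichlet K) (- (1 / 2)) (1 / 2) = 1.
Proof.
  induction K.
  - unfold RI. rewrite (RInt_ext _ (fun _ => 1)) by auto. rewrite RInt_const.
    unfold scal; simpl; unfold mult; simpl. lra.
  - change (RI (fun y => dirichlet K y + 2 * cos (2 * PI * INR (S K) * y)) (- (1 / 2)) (1 / 2) = 1).
    rewrite RI_plus; [| apply dirichlet_cont | apply cont_derivable; intro; auto_derive; auto].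
    rewrite IHK.
    pose proof PI_RGT_0. pose proof (lt_0_INR (S K) ltac:(lia)).
    rewrite (RI_FTC (fun y => / (PI * INR (S K)) * sin (2 * PI * INR (S K) * y))).
    + replace (2 * PI * INR (S K) * (1 / 2)) with (IZR (Z.of_nat (S K)) * PI) by (rewrite <- INR_IZR_INZ; field).
      replace (2 * PI * INR (S K) * - (1 / 2)) with (IZR (- Z.of_nat (S K)) * PI)
        by (rewrite opp_IZR, <- INR_IZR_INZ; field).
      rewrite !(sin_eq_0_1 (IZR _ * PI)) by eauto. ring.
    + intro x. auto_derive; auto. change (match K with 0%nat => 1 | S _ => INR K + 1 end) with (INR (S K)). field. lra.
    + apply cont_derivable; intro; auto_derive; auto.
Qed.

Lemma exp_le_mono x y : x <= y -> exp x <= exp y.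
Proof. intros [H| ->]; [left; now apply exp_increasing | apply Rle_refl]. Qed.

Lemma exp_pow_n x n : (exp x) ^ n = exp (INR n * x).
Proof.
  induction n.
  - simpl. now rewrite Rmult_0_l, exp_0.
  - rewrite <- tech_pow_Rmult, IHn, <- exp_plus, S_INR. f_equal. ring.
Qed.

Lemma ex_series_exp eps : 0 < eps -> ex_series (fun n => exp (- eps * INR n)).
Proof.
  intro He. apply (ex_series_ext (fun n => (exp (- eps)) ^ n)).
  - intro n. rewrite exp_pow_n. f_equal. ring.
  - exists (/ (1 - exp (- eps))). apply is_series_geom. rewrite Rabs_pos_eq by (left; apply exp_pos).
    rewrite <- exp_0. apply exp_increasing. lra.
Qed.

(** * Poisson summation for real functions with exponential decay *)

Section Poisson.

Variables (r r' : R -> R) (C eps : R) (A : nat -> R).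
Hypothesis eps_pos : 0 < eps.
Hypothesis Hr' : forall x, is_derive r x (r' x).
Hypothesis r_bound : forall x, Rabs (r x) <= C * exp (- eps * Rabs x).
Hypothesis r'_bound : forall x, Rabs (r' x) <= C * exp (- eps * Rabs x).
Hypothesis HA : forall K, is_LInt (fun y => r y * dirichlet K y) (A K).

Let r_cont : cont r.
Proof. apply cont_derivable. intro x. now exists (r' x). Qed.

Let C_nonneg : 0 <= C.
Proof.
  assert (H := r_bound 0). rewrite Rabs_R0, Rmult_0_r, exp_0 in H. pose proof (Rabs_pos (r 0)). lra.
Qed.

(** The error made when the kernel of order [K] is asked to reproduce [r j] from the unit interval
    centred at [j]. Summed over all [j], these errors are [A K] minus the sum of [r] over the
    integers. *)
Let defect (K : nat) (j : Z) : R :=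
  RI (fun y => r y * dirichlet K y) (IZR j - 1 / 2) (IZR j + 1 / 2) - r (IZR j).

(** A continuous version of [(r (j + y) - r j) / sin (PI * y)]: the factor [y] cancels between the
    two pieces, and differentiability of [r] at [j] removes the singularity. *)
Let quotient (j : Z) (y : R) : R := slope (fun t => r (IZR j + t)) (r' (IZR j)) y * csc_weight y.

Let shift_derive j t : is_derive (fun t => r (j + t)) t (r' (j + t)).
Proof.
  replace (r' (j + t)) with (1 * r' (j + t)) by ring.
  apply (is_derive_comp (V := R_NormedModule) r (fun t => j + t)); auto.
  auto_derive; auto.
Qed.

Let quotient_continuous j y : - (1 / 2) <= y <= 1 / 2 -> continuous (quotient j) y.
Proof.
  intro Hy. apply (continuous_mult (K := R_AbsRing)).
  - apply slope_continuous.
    + apply (cont_comp r (fun t => IZR j + t)); auto. apply cont_derivable. intro; auto_derive; auto.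
    + assert (H := shift_derive (IZR j) 0). now rewrite Rplus_0_r in H.
  - now apply csc_weight_continuous.
Qed.

(* Dirichlet's kernel has total mass 1 on the period and equals
   [sin ((2K+1) pi y) / sin (pi y)]. *)
Let defect_eq K j :
  defect K j = RI (fun y => quotient j y * sin ((2 * INR K + 1) * PI * y)) (- (1 / 2)) (1 / 2).
Proof.
  unfold defect.
  assert (E := RI_affine (fun y => r y * dirichlet K y) 1 (IZR j) (- (1 / 2)) (1 / 2)
    (cont_mult _ _ r_cont (dirichlet_cont K)) ltac:(lra)).
  replace (IZR j + 1 * - (1 / 2)) with (IZR j - 1 / 2) in E by ring.
  rewrite Rmult_1_l, Rdiv_1_r in E. rewrite <- E.
  rewrite (RI_ext _ (fun y => r (IZR j + y) * dirichlet K y))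
    by (intro; rewrite Rmult_1_l, dirichlet_Zperiod; reflexivity).
  assert (Cj : cont (fun y => r (IZR j + y))).
  { apply (cont_comp r (fun t => IZR j + t)); auto. apply cont_derivable. intro; auto_derive; auto. }
  replace (r (IZR j)) with (- (- r (IZR j) * RI (dirichlet K) (- (1 / 2)) (1 / 2))) by (rewrite RI_dirichlet; ring).
  unfold Rminus. rewrite Ropp_involutive, <- RI_scal, <- RI_plus.
  - apply RI_ext_in; [lra|]. intros y Hy.
    rewrite <- dirichlet_sin. unfold quotient, csc_weight, slope.
    destruct (Req_EM_T y 0) as [->|Hy0].
    + rewrite Rplus_0_r, Rmult_0_r, sin_0. ring.
    + rewrite Rplus_0_r, Rmult_0_r, sin_0, Rminus_0_r. field. split; auto. apply sin_PI_mult_neq_0; lra.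
  - apply (cont_mult (fun y => r (IZR j + y))); auto. apply dirichlet_cont.
  - apply (cont_mult (fun _ => - r (IZR j))). intro; apply continuous_const. apply dirichlet_cont.
  - apply dirichlet_cont.
Qed.

Let defect_lim j : is_lim_seq (fun K => defect K j) 0.
Proof.
  apply is_lim_seq_spec. intro eta.
  destruct (riemann_lebesgue (quotient j) (- (1 / 2)) (1 / 2) ltac:(lra) (quotient_continuous j) eta (cond_pos eta))
    as [L HL].
  destruct (INR_unbounded L) as [N HN]. exists N. intros K HK.
  rewrite Rminus_0_r, defect_eq. apply HL.
  apply le_INR in HK. pose proof (pos_INR K). pose proof PI2_1. nra.
Qed.

(** By the mean value theorem the slope is a value of [r'] at distance at most 1/2 from [j]; the
    factor [exp eps] absorbs this shift in the exponential bound. *)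
Let slope_bound j y : - (1 / 2) <= y <= 1 / 2 ->
  Rabs (slope (fun t => r (IZR j + t)) (r' (IZR j)) y) <= C * exp eps * exp (- eps * Rabs (IZR j)).
Proof.
  intro Hy.
  assert (B : forall c, Rabs c <= 1 / 2 -> Rabs (r' (IZR j + c)) <= C * exp eps * exp (- eps * Rabs (IZR j))).
  { intros c Hc. eapply Rle_trans; [apply r'_bound|]. rewrite Rmult_assoc, <- exp_plus.
    apply Rmult_le_compat_l; auto. apply exp_le_mono.
    assert (Rabs (IZR j) <= Rabs (IZR j + c) + Rabs c).
    { replace (IZR j) with ((IZR j + c) + - c) at 1 by ring. rewrite <- (Rabs_Ropp c). apply Rabs_triang. }
    nra. }
  unfold slope. destruct (Req_EM_T y 0) as [_|Hy0].
  - rewrite <- (Rplus_0_r (IZR j)) at 1. apply B. rewrite Rabs_R0. lra.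
  - destruct (MVT_gen (fun t => r (IZR j + t)) 0 y (fun t => r' (IZR j + t))) as [c [Hc1 Hc2]].
    + intros x _. apply shift_derive.
    + intros x _. apply continuity_pt_filterlim.
      apply (cont_comp r (fun t => IZR j + t)); auto. apply cont_derivable. intro; auto_derive; auto.
    + rewrite Hc2, Rminus_0_r. replace (r' (IZR j + c) * y / y) with (r' (IZR j + c)) by (field; auto).
      apply B. apply Rabs_le. revert Hc1. unfold Rmin, Rmax. destruct (Rle_dec 0 y); lra.
Qed.

(** The sine is bounded by 1, so the bound does not see [K]; it is the dominating sequence for the
    passage to the limit. *)
Let defect_bound : exists M, forall K j, Rabs (defect K j) <= M * exp (- eps * Rabs (IZR j)).
Proof.
  destruct (cont_bounded csc_weight (- (1 / 2)) (1 / 2)) as [W [HW0 HW]]; [lra|apply csc_weight_continuous|].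
  exists (C * exp eps * W). intros K j. rewrite defect_eq.
  replace (C * exp eps * W * exp (- eps * Rabs (IZR j)))
    with ((1 / 2 - - (1 / 2)) * (C * exp eps * exp (- eps * Rabs (IZR j)) * W)) by field.
  apply abs_RInt_le_const; [lra| |].
  - apply cont_mono_ex_RInt; [lra|]. intros y Hy. apply (continuous_mult (K := R_AbsRing)).
    + now apply quotient_continuous.
    + apply cont_sin_lin.
  - intros y Hy. unfold quotient. rewrite !Rabs_mult.
    assert (Rabs (sin ((2 * INR K + 1) * PI * y)) <= 1) by (apply Rabs_le; apply SIN_bound).
    pose proof (slope_bound j y Hy). specialize (HW y Hy).
    pose proof (Rabs_pos (sin ((2 * INR K + 1) * PI * y))).
    pose proof (Rabs_pos (slope (fun t => r (IZR j + t)) (r' (IZR j)) y)).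
    pose proof (Rabs_pos (csc_weight y)).
    rewrite <- (Rmult_1_r (C * exp eps * exp (- eps * Rabs (IZR j)) * W)).
    apply Rmult_le_compat; auto; [now apply Rmult_le_pos|]. apply Rmult_le_compat; auto.
Qed.

Let fold_exp_ex : ex_series (fun n => exp (- eps * Rabs (IZR (Z.of_nat n))) + exp (- eps * Rabs (IZR (- Z.of_nat (S n))))).
Proof.
  apply ex_series_plus_R.
  - apply (ex_series_ext (fun n => exp (- eps * INR n))); [|now apply ex_series_exp].
    intro n. rewrite <- INR_IZR_INZ, Rabs_pos_eq; auto. apply pos_INR.
  - apply (ex_series_ext (fun n => exp (- eps * INR (S n)))).
    + intro n. rewrite opp_IZR, Rabs_Ropp, <- INR_IZR_INZ, Rabs_pos_eq; auto. apply pos_INR.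
    + apply (ex_series_incr_1 (fun n => exp (- eps * INR n))). now apply ex_series_exp.
Qed.

(** With the line cut at half-integers, [A K - S0] is the series of the defects. Each defect tends
    to 0 as [K] grows and all obey one summable bound, so Tannery's theorem applies. *)
Lemma poisson_real :
  is_lim_seq A (Series (fun n => r (IZR (Z.of_nat n)) + r (IZR (- Z.of_nat (S n))))).
Proof.
  set (S0 := Series _).
  pose (e := fun K n => defect K (Z.of_nat n) + defect K (- Z.of_nat (S n))%Z).
  assert (Hex : ex_series (fun n => r (IZR (Z.of_nat n)) + r (IZR (- Z.of_nat (S n))))).
  { apply (ex_series_abs_le _ (fun n => C * (exp (- eps * Rabs (IZR (Z.of_nat n))) + exp (- eps * Rabs (IZR (- Z.of_nat (S n)))))));
    [|now apply ex_series_scal_R]. intro n. eapply Rle_trans; [apply Rabs_triang|].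
    rewrite Rmult_plus_distr_l. apply Rplus_le_compat; apply r_bound. }
  assert (HS : forall K, Series (e K) = A K - S0).
  { intro K. apply is_series_unique.
    change (is_lim_seq (sum_n (e K)) (A K - S0)).
    assert (Crd : cont (fun y => r y * dirichlet K y)) by (apply cont_mult; auto; apply dirichlet_cont).
    (* The partial sum of order [J] covers the integers from [-(J+1)] to [J], hence the interval
       from [-J - 3/2] to [J + 1/2]. *)
    apply (is_lim_seq_ext (fun J => RI (fun y => r y * dirichlet K y) (- INR J - 3 / 2) (INR J + 1 / 2)
       - sum_n (fun n => r (IZR (Z.of_nat n)) + r (IZR (- Z.of_nat (S n)))) J)).
    - induction n.
      + rewrite !sum_O. unfold e, defect. simpl.
        rewrite <- (RI_Chasles _ (- 0 - 3 / 2) (0 - 1 / 2) (0 + 1 / 2)) by auto.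
        replace (-1 - 1 / 2) with (- 0 - 3 / 2) by field. replace (-1 + 1 / 2) with (0 - 1 / 2) by field. ring.
      + rewrite !sum_n_Sr, <- IHn. unfold e, defect.
        rewrite !opp_IZR, <- !INR_IZR_INZ, !S_INR.
        rewrite <- (RI_Chasles _ (- (INR n + 1) - 3 / 2) (- INR n - 3 / 2) (INR n + 1 + 1 / 2)) by auto.
        rewrite <- (RI_Chasles _ (- INR n - 3 / 2) (INR n + 1 / 2) (INR n + 1 + 1 / 2)) by auto.
        replace (INR n + 1 - 1 / 2) with (INR n + 1 / 2) by field.
        replace (- (INR n + 1 + 1) - 1 / 2) with (- (INR n + 1) - 3 / 2) by field.
        replace (- (INR n + 1 + 1) + 1 / 2) with (- INR n - 3 / 2) by field. ring.
    - apply is_lim_seq_minus'; [|apply (Series_correct _ Hex)].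
      apply is_lim_seq_spec. intro eta. destruct (HA K eta (cond_pos eta)) as [X HX].
      destruct (INR_unbounded X) as [N HN]. exists N. intros n Hn. apply le_INR in Hn.
      apply HX; lra. }
  destruct defect_bound as [M HM].
  assert (L : is_lim_seq (fun K => Series (e K)) 0).
  { apply (Series_dominated_zero e (fun n => M * (exp (- eps * Rabs (IZR (Z.of_nat n))) + exp (- eps * Rabs (IZR (- Z.of_nat (S n))))))).
    - intros K n. eapply Rle_trans; [apply Rabs_triang|]. rewrite Rmult_plus_distr_l. apply Rplus_le_compat; apply HM.
    - now apply ex_series_scal_R.
    - intro n. replace 0 with (0 + 0) by ring. apply is_lim_seq_plus'; apply defect_lim. }
  apply (is_lim_seq_ext (fun K => Series (e K) + S0)).
  - intro K. rewrite HS. ring.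
  - rewrite <- (Rplus_0_l S0) at 1. apply is_lim_seq_plus'; [auto|apply is_lim_seq_const].
Qed.

End Poisson.

(** * The Gamma function *)

(* [e^(z x) exp(-e^x)]: the integrand of [Gamma z] after the substitution [t = e^x]. *)
Definition gker (z : C) (x : R) : C :=
  pair (exp (Re z * x - exp x) * cos (Im z * x))%R (exp (Re z * x - exp x) * sin (Im z * x))%R.

(** The maximum is attained at [x = ln q]; the inequality is [1 + y <= e^y] at [y = x - ln q]. *)
Lemma lin_minus_exp_le q x : 0 < q -> q * x - exp x <= q * ln q - q.
Proof.
  intro Hq. assert (H := exp_ineq1_le (x - ln q)).
  unfold Rminus in H. rewrite exp_plus, exp_Ropp, exp_ln in H by auto.
  apply Rmult_le_compat_l with (r := q) in H; [|lra].
  replace (q * (exp x * / q)) with (exp x) in H by (field; lra). lra.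
Qed.

(** For [x >= 0] the maximum of [(p + eps) x - e^x] leaves a factor [e^(-eps x)]; for [x < 0] the
    factor [e^(px)] decays fast enough because [eps <= p]. The two summands of the constant serve
    the two half-lines. *)
Lemma exp_lin_minus_exp_decay p eps : 0 < eps <= p ->
  exists C, 0 < C /\ forall x, exp (p * x - exp x) <= C * exp (- eps * Rabs x).
Proof.
  intros [He Hp]. pose (q := p + eps).
  assert (P1 := exp_pos (q * ln q - q)).
  exists (1 + exp (q * ln q - q)). split; [lra|].
  intro x. assert (P2 := exp_pos (- eps * Rabs x)).
  destruct (Rle_dec 0 x) as [Hx|Hx].
  - rewrite Rabs_pos_eq in * by auto.
    apply Rle_trans with (exp (q * ln q - q) * exp (- eps * x)).
    + rewrite <- exp_plus. apply exp_le_mono.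
      assert (H := lin_minus_exp_le q x ltac:(unfold q; lra)). unfold q in *. lra.
    + apply Rmult_le_compat_r; lra.
  - rewrite Rabs_left in * by lra.
    apply Rle_trans with (exp (- eps * - x)).
    + apply exp_le_mono. assert (H := exp_pos x). nra.
    + rewrite <- (Rmult_1_l (exp (- eps * - x))) at 1. apply Rmult_le_compat_r; lra.
Qed.

Lemma Cmod_polar a t : 0 <= a -> Cmod (pair (a * cos t)%R (a * sin t)%R) = a.
Proof.
  intro Ha. unfold Cmod; simpl.
  replace (a * cos t * (a * cos t * 1) + a * sin t * (a * sin t * 1))
    with (a * a * (Rsqr (sin t) + Rsqr (cos t))) by (unfold Rsqr; ring).
  rewrite sin2_cos2, Rmult_1_r. now apply sqrt_square.
Qed.

Lemma Cmod_gker z x : Cmod (gker z x) = exp (Re z * x - exp x).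
Proof. apply Cmod_polar. left; apply exp_pos. Qed.

Lemma Cmod_cexp z : Cmod (cexp z) = exp (Re z).
Proof. apply Cmod_polar. left; apply exp_pos. Qed.

Definition Ccont (f : R -> C) : Prop := cont (fun x => Re (f x)) /\ cont (fun x => Im (f x)).

Lemma gker_cont z : Ccont (gker z).
Proof. split; simpl; apply cont_derivable; intro; auto_derive; auto. Qed.

Definition is_CLInt (f : R -> C) (l : C) : Prop :=
  is_LInt (fun x => Re (f x)) (Re l) /\ is_LInt (fun x => Im (f x)) (Im l).

Lemma is_CLInt_unique f l l' : is_CLInt f l -> is_CLInt f l' -> l = l'.
Proof. intros [A B] [A' B']. apply Ceq; eapply is_LInt_unique; eauto. Qed.

Lemma is_CLInt_ext f g l : (forall x, f x = g x) -> is_CLInt f l -> is_CLInt g l.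
Proof.
  intros E [A B]; split; [eapply is_LInt_ext with (2 := A)|eapply is_LInt_ext with (2 := B)];
  intro; now rewrite E.
Qed.

Lemma is_CLInt_plus f g l l' : Ccont f -> Ccont g -> is_CLInt f l -> is_CLInt g l' ->
  is_CLInt (fun x => Cplus (f x) (g x)) (Cplus l l').
Proof.
  intros [C1 C2] [D1 D2] [A B] [A' B']; split; simpl.
  - now apply (is_LInt_plus (fun x => Re (f x)) (fun x => Re (g x))).
  - now apply (is_LInt_plus (fun x => Im (f x)) (fun x => Im (g x))).
Qed.

Lemma Ccont_scal c f : Ccont f -> Ccont (fun x => Cmult c (f x)).
Proof.
  intros [C1 C2]; split; simpl; intro x.
  - apply (continuous_minus (V := R_NormedModule)).
    apply (cont_mult (fun _ => fst c)); auto. intro; apply continuous_const.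
    apply (cont_mult (fun _ => snd c)); auto. intro; apply continuous_const.
  - apply (continuous_plus (V := R_NormedModule)).
    apply (cont_mult (fun _ => fst c)); auto. intro; apply continuous_const.
    apply (cont_mult (fun _ => snd c)); auto. intro; apply continuous_const.
Qed.

Lemma is_CLInt_scal f c l : Ccont f -> is_CLInt f l ->
  is_CLInt (fun x => Cmult c (f x)) (Cmult c l).
Proof.
  intros [C1 C2] [A B].
  assert (H : forall f' k, cont f' -> cont (fun x => k * f' x)).
  { intros f' k H. apply (cont_mult (fun _ => k)); auto. intro; apply continuous_const. }
  split; simpl.
  - apply (is_LInt_ext (fun x => Re c * Re (f x) + (- Im c) * Im (f x))).
    intro; simpl; unfold Re, Im; ring.
    replace (fst c * fst l - snd c * snd l) with (Re c * Re l + (- Im c) * Im l) by (unfold Re, Im; ring).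
    apply is_LInt_plus; auto; now apply is_LInt_scal.
  - apply (is_LInt_plus (fun x => Re c * Im (f x)) (fun x => Im c * Re (f x))); auto;
    now apply (is_LInt_scal).
Qed.

Lemma is_CLInt_affine f c x l : Ccont f -> 0 < c -> is_CLInt f l ->
  is_CLInt (fun y => f (x + c * y)) (Cmult (RtoC (1 / c)) l).
Proof.
  intros [C1 C2] Hc [A B]; split; simpl.
  - replace (1 / c * fst l - 0 * snd l) with (Re l / c) by (unfold Re; field; lra).
    now apply (is_LInt_affine (fun x => Re (f x))).
  - replace (1 / c * snd l + 0 * fst l) with (Im l / c) by (unfold Im; field; lra).
    now apply (is_LInt_affine (fun x => Im (f x))).
Qed.

(** The form of integration by parts needed below: the boundary terms of a decaying primitive vanish
    at both ends. *)
Lemma is_LInt_derive (F f : R -> R) C eps : (forall x, is_derive F x (f x)) -> cont f -> 0 < eps ->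
  0 <= C -> (forall x, Rabs (F x) <= C * exp (- eps * Rabs x)) -> is_LInt f 0.
Proof.
  intros HF Cf He HC HB eta Ht.
  destruct (exp_eventually_small C eps (eta / 2)) as [X [HX0 HX]]; auto; [lra|].
  exists X. intros u v Hu Hv. rewrite (RI_FTC F) by auto.
  assert (A := HB u). assert (B := HB v).
  assert (A' := HX (Rabs u)). assert (B' := HX (Rabs v)).
  rewrite (Rabs_pos_eq v) in * by lra. rewrite (Rabs_left1 u) in * by lra.
  specialize (A' ltac:(lra)). specialize (B' Hv).
  apply Rabs_le_between in A. apply Rabs_le_between in B. apply Rabs_def1; lra.
Qed.

(** The modulus of the integrand depends on [Re z] alone, which makes [M] uniform on the vertical
    line. *)
Lemma gker_LInt_ex p : 0 < p -> exists M, forall z, Re z = p ->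
  exists l, is_CLInt (gker z) l /\ Cmod l <= M.
Proof.
  intro Hp. destruct (exp_lin_minus_exp_decay p p) as [C [HC0 HC]]; [lra|].
  exists (2 * (C / p) + 2 * (C / p)). intros z Hz.
  destruct (LInt_ex (fun x => Re (gker z x)) C p) as [l1 [H1 B1]]; auto.
  { apply gker_cont. }
  { intro x. eapply Rle_trans; [apply re_le_Cmod|]. rewrite Cmod_gker, Hz. apply HC. }
  destruct (LInt_ex (fun x => Im (gker z x)) C p) as [l2 [H2 B2]]; auto.
  { apply gker_cont. }
  { intro x. eapply Rle_trans; [apply im_le_Cmod|]. rewrite Cmod_gker, Hz. apply HC. }
  exists (pair l1 l2). split; [now split|].
  eapply Rle_trans; [apply Cmod_le_Re_Im|]. simpl. lra.
Qed.

Lemma rcpow_pos x z : 0 < x -> rcpow x z = cexp (Cmult z (RtoC (ln x))).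
Proof. intro H. unfold rcpow. destruct (Req_EM_T x 0); [lra|reflexivity]. Qed.

Lemma cexp_mult_real z y :
  cexp (Cmult z (RtoC y)) = pair (exp (Re z * y) * cos (Im z * y))%R (exp (Re z * y) * sin (Im z * y))%R.
Proof. unfold cexp. simpl. unfold Re, Im. f_equal; f_equal; f_equal; ring. Qed.

(** The factor [/ t] is the Jacobian of [x = ln t]. *)
Lemma Gamma_integrand z t : 0 < t ->
  Cmult (rcpow t (Cminus z (RtoC 1))) (RtoC (exp (- t)))
  = pair (/ t * Re (gker z (ln t)))%R (/ t * Im (gker z (ln t)))%R.
Proof.
  intro Ht. rewrite rcpow_pos, cexp_mult_real by auto.
  assert (E : exp (Re (Cminus z (RtoC 1)) * ln t) * exp (- t) = / t * exp (Re z * ln t - t)).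
  { rewrite <- (exp_ln t Ht) at 3. rewrite <- exp_Ropp, <- !exp_plus. f_equal. simpl. unfold Re. ring. }
  assert (E2 : Im (Cminus z (RtoC 1)) = Im z) by (simpl; unfold Im; ring).
  rewrite E2. apply Ceq; simpl; rewrite exp_ln, <- ?Rmult_assoc by auto.
  - rewrite <- E. simpl. ring.
  - rewrite <- E. simpl. ring.
Qed.

(** Under [x = ln t] the neighbourhoods of [0+] and of infinity become lower ends below [-Z] and
    upper ends above [Z], that is, the filter behind [is_LInt]. *)
Lemma Gamma_of_LInt z l : is_CLInt (gker z) l -> Gamma z = l.
Proof.
  intros [H1 H2]. unfold Gamma.
  apply (is_RInt_gen_unique (V := C_R_CompleteNormedModule)).
  intros P [eps HP].
  destruct (H1 eps (cond_pos eps)) as [X HX]. destruct (H2 eps (cond_pos eps)) as [Y HY].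
  pose (Z := Rmax X Y). assert (HXZ : X <= Z) by apply Rmax_l. assert (HYZ : Y <= Z) by apply Rmax_r.
  apply (Filter_prod _ _ _ (fun a => 0 < a < exp (- Z)) (fun b => exp Z < b)).
  - exists (mkposreal _ (exp_pos (- Z))). intros a Ha Ha0.
    unfold ball in Ha; simpl in Ha; unfold AbsRing_ball, abs, minus, plus, opp in Ha; simpl in Ha.
    apply Rabs_def2 in Ha. lra.
  - exists (exp Z). auto.
  - intros a b0 Ha Hb. simpl.
    assert (Hb0 : 0 < b0) by (pose proof (exp_pos Z); lra).
    assert (La : ln a <= - Z).
    { left. apply exp_lt_inv. now rewrite exp_ln by lra. }
    assert (Lb : Z <= ln b0).
    { left. apply exp_lt_inv. now rewrite exp_ln by lra. }
    assert (Hpos : forall x, Rmin a b0 <= x <= Rmax a b0 -> 0 < x).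
    { intros x [Hx _]. apply Rlt_le_trans with (Rmin a b0); auto. apply Rmin_glb_lt; lra. }
    assert (Sub : forall f, cont f ->
      is_RInt (fun y => / y * f (ln y)) a b0 (RI f (ln a) (ln b0))).
    { intros f Cf.
      apply (is_RInt_comp (V := R_CompleteNormedModule) f ln (fun y => / y)).
      - intros; apply Cf.
      - intros x Hx. specialize (Hpos x Hx). split.
        + auto_derive; auto. field. lra.
        + apply continuous_Rinv. lra. }
    destruct (gker_cont z) as [C1 C2].
    exists (pair (RI (fun x => Re (gker z x)) (ln a) (ln b0)) (RI (fun x => Im (gker z x)) (ln a) (ln b0))). split.
    + simpl. apply (is_RInt_fct_extend_pair (U := R_NormedModule) (V := R_NormedModule)).
      * eapply is_RInt_ext; [|apply (Sub (fun x => Re (gker z x))); apply gker_cont].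
        intros t Ht. rewrite Gamma_integrand; [reflexivity|]. apply Hpos. lra.
      * eapply is_RInt_ext; [|apply (Sub (fun x => Im (gker z x))); apply gker_cont].
        intros t Ht. rewrite Gamma_integrand; [reflexivity|]. apply Hpos. lra.
    + apply HP. split.
      * apply HX; lra.
      * apply HY; lra.
Qed.

Lemma Gamma_LInt z : 0 < Re z -> is_CLInt (gker z) (Gamma z).
Proof.
  intro Hz. destruct (gker_LInt_ex (Re z) Hz) as [M HM].
  destruct (HM z eq_refl) as [l [Hl _]]. now rewrite (Gamma_of_LInt z l).
Qed.

Lemma Gamma_bound p : 0 < p -> exists M, forall z, Re z = p -> Cmod (Gamma z) <= M.
Proof.
  intro Hp. destruct (gker_LInt_ex p Hp) as [M HM]. exists M. intros z Hz.
  destruct (HM z Hz) as [l [Hl B]]. now rewrite (Gamma_of_LInt z l).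
Qed.

(** The derivative of [gker z] is [z * gker z - gker (z + 1)], since an extra factor [e^x] raises
    the parameter by 1. The integral of this derivative over the line is 0. *)
Lemma Gamma_functional z : 0 < Re z -> Cmult z (Gamma z) = Gamma (Cplus z (RtoC 1)).
Proof.
  intro Hz.
  assert (E : Cplus (Cmult z (Gamma z)) (Cmult (RtoC (-1)) (Gamma (Cplus z (RtoC 1)))) = RtoC 0).
  { eapply is_CLInt_unique.
    - apply (is_CLInt_plus (fun x => Cmult z (gker z x)) (fun x => Cmult (RtoC (-1)) (gker (Cplus z (RtoC 1)) x))).
      + apply Ccont_scal, gker_cont.
      + apply Ccont_scal, gker_cont.
      + apply is_CLInt_scal; [apply gker_cont|now apply Gamma_LInt].
      + apply is_CLInt_scal; [apply gker_cont|apply Gamma_LInt; simpl; unfold Re in *; lra].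
    - destruct (exp_lin_minus_exp_decay (Re z) (Re z)) as [C [HC0 HC]]; [lra|].
      assert (Cd : Ccont (fun x => Cplus (Cmult z (gker z x)) (Cmult (RtoC (-1)) (gker (Cplus z (RtoC 1)) x)))).
      { destruct (Ccont_scal z _ (gker_cont z)) as [A1 A2].
        destruct (Ccont_scal (RtoC (-1)) _ (gker_cont (Cplus z (RtoC 1)))) as [B1 B2].
        split; [apply (cont_plus _ _ A1 B1)|apply (cont_plus _ _ A2 B2)]. }
      assert (X : forall x, exp ((fst z + 1) * x - exp x) = exp (fst z * x - exp x) * exp x).
      { intro x. rewrite <- exp_plus. f_equal. ring. }
      split.
      + apply (is_LInt_derive (fun x => Re (gker z x)) _ C (Re z)); auto; try lra.
        * intro x. simpl. unfold Re, Im; simpl. auto_derive; auto.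
          rewrite X, Rplus_0_r. unfold Rminus. ring.
        * apply Cd.
        * intro x. eapply Rle_trans; [apply re_le_Cmod|]. rewrite Cmod_gker. apply HC.
      + apply (is_LInt_derive (fun x => Im (gker z x)) _ C (Re z)); auto; try lra.
        * intro x. simpl. unfold Re, Im; simpl. auto_derive; auto.
          rewrite X, Rplus_0_r. unfold Rminus. ring.
        * apply Cd.
        * intro x. eapply Rle_trans; [apply im_le_Cmod|]. rewrite Cmod_gker. apply HC. }
  replace (Cmult z (Gamma z)) with
    (Cplus (Cplus (Cmult z (Gamma z)) (Cmult (RtoC (-1)) (Gamma (Cplus z (RtoC 1))))) (Gamma (Cplus z (RtoC 1))))
    by (apply Ceq; simpl; ring).
  rewrite E. apply Cplus_0_l.
Qed.

(** Each use of the functional equation trades a factor [|z|] for a move of the vertical line one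
    unit to the right; hence the induction is over all [p] at once. *)
Lemma Gamma_vertical_decay n : forall p, 0 < p ->
  exists M, forall z, Re z = p -> (Rabs (Im z)) ^ n * Cmod (Gamma z) <= M.
Proof.
  induction n; intros p Hp.
  - destruct (Gamma_bound p Hp) as [M HM]. exists M. intros z Hz. simpl. rewrite Rmult_1_l. auto.
  - destruct (IHn (p + 1) ltac:(lra)) as [M HM]. exists M. intros z Hz.
    eapply Rle_trans; [|apply (HM (Cplus z (RtoC 1))); simpl; unfold Re in *; lra].
    rewrite <- Gamma_functional, Cmod_mult by lra.
    replace (Im (Cplus z (RtoC 1))) with (Im z) by (simpl; unfold Im; ring).
    rewrite <- tech_pow_Rmult.
    assert (0 <= Rabs (Im z) ^ n) by (apply pow_le, Rabs_pos).
    assert (Rabs (Im z) <= Cmod z) by apply im_le_Cmod.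
    assert (0 <= Cmod (Gamma z)) by apply Cmod_ge_0.
    replace (Rabs (Im z) * Rabs (Im z) ^ n * Cmod (Gamma z)) with (Rabs (Im z) ^ n * (Rabs (Im z) * Cmod (Gamma z))) by ring.
    apply Rmult_le_compat_l; auto. now apply Rmult_le_compat_r.
Qed.

(** * Rapidly decreasing sequences *)

(** These are the Fourier coefficient sequences of smooth 1-periodic functions. *)
Definition rapid (c : Z -> C) : Prop :=
  forall n, exists M, forall k, Cmod (c k) * (1 + Rabs (IZR k)) ^ n <= M.

Lemma rapid_le (c d : Z -> C) (B : R) :
  (forall k, Cmod (d k) <= B * Cmod (c k)) -> 0 <= B -> rapid c -> rapid d.
Proof.
  intros H HB Hc n. destruct (Hc n) as [M HM]. exists (B * M). intro k.
  assert (0 <= (1 + Rabs (IZR k)) ^ n) by (apply pow_le; pose proof (Rabs_pos (IZR k)); lra).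
  apply Rle_trans with (B * (Cmod (c k) * (1 + Rabs (IZR k)) ^ n)).
  - rewrite <- Rmult_assoc. now apply Rmult_le_compat_r.
  - apply Rmult_le_compat_l; auto.
Qed.

Lemma rapid_mult_index c : rapid c -> rapid (fun k => Cmult (RtoC (IZR k)) (c k)).
Proof.
  intros H n. destruct (H (S n)) as [M HM]. exists M. intro k. eapply Rle_trans; [|apply (HM k)].
  rewrite Cmod_mult, Cmod_R, <- tech_pow_Rmult.
  assert (0 <= (1 + Rabs (IZR k)) ^ n) by (apply pow_le; pose proof (Rabs_pos (IZR k)); lra).
  assert (0 <= Cmod (c k)) by apply Cmod_ge_0.
  assert (0 <= Cmod (c k) * (1 + Rabs (IZR k)) ^ n) by now apply Rmult_le_pos. nra.
Qed.

(** Comparison with the telescoping differences of [1 / (1 + n)]. *)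
Lemma ex_series_inv_sq : ex_series (fun n => / (1 + INR n) ^ 2).
Proof.
  apply (ex_series_nonneg_bounded _ 2).
  - intro k. left. apply Rinv_0_lt_compat, pow_lt. pose proof (pos_INR k). lra.
  - intro n. apply Rle_trans with (2 - / (1 + INR n)).
    + induction n.
      * rewrite sum_O. simpl. lra.
      * rewrite sum_n_Sr, S_INR. pose proof (pos_INR n).
        assert (/ (1 + (INR n + 1)) ^ 2 <= / (1 + INR n) - / (1 + (INR n + 1))); [|lra].
        replace (/ (1 + INR n) - / (1 + (INR n + 1))) with (/ ((1 + INR n) * (1 + (INR n + 1)))) by (field; lra).
        apply Rinv_le_contravar; nra.
    + pose proof (pos_INR n). assert (0 < / (1 + INR n)) by (apply Rinv_0_lt_compat; lra). lra.
Qed.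

Lemma zseries_inv_sq : zseries (fun k => / (1 + Rabs (IZR k)) ^ 2).
Proof.
  split.
  - eapply ex_series_ext; [|apply ex_series_inv_sq]. intro n.
    rewrite <- INR_IZR_INZ, Rabs_pos_eq; auto. apply pos_INR.
  - eapply ex_series_ext; [|apply (proj1 (ex_series_incr_1 (fun n => / (1 + INR n) ^ 2)) ex_series_inv_sq)].
    intro n. cbv beta. rewrite opp_IZR, Rabs_Ropp, <- INR_IZR_INZ, Rabs_pos_eq; auto. apply pos_INR.
Qed.

Lemma rapid_zasum c : rapid c -> zasum c.
Proof.
  intro H. destruct (H 2%nat) as [M HM].
  apply (zasum_le _ (fun k => M * / (1 + Rabs (IZR k)) ^ 2)); [|apply zseries_scal, zseries_inv_sq].
  intro k. assert (P : 0 < (1 + Rabs (IZR k)) ^ 2) by (apply pow_lt; pose proof (Rabs_pos (IZR k)); lra).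
  apply Rmult_le_reg_r with ((1 + Rabs (IZR k)) ^ 2); auto.
  rewrite Rmult_assoc, Rinv_l, Rmult_1_r by lra. apply HM.
Qed.

Lemma pow_1_plus_le a n : 0 <= a -> (1 + a) ^ n <= 2 ^ n * (1 + a ^ n).
Proof.
  intro Ha. destruct (Rle_dec a 1) as [H|H].
  - apply Rle_trans with (2 ^ n * 1).
    + rewrite Rmult_1_r. apply pow_incr; lra.
    + apply Rmult_le_compat_l; [apply pow_le; lra|]. assert (0 <= a ^ n) by now apply pow_le. lra.
  - apply Rle_trans with ((2 * a) ^ n).
    + apply pow_incr; lra.
    + rewrite Rpow_mult_distr. apply Rmult_le_compat_l; [apply pow_le; lra|]. lra.
Qed.

(** The points [zk] with an arbitrary period [l] in place of [ln b], to which [zk] reduces by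
    conversion. *)
Definition zkl (l : R) (s : C) (k : Z) : C := Cminus s (pair 0%R (2 * PI * IZR k / l)%R : C).

(** The points lie on one vertical line and their imaginary parts form an arithmetic progression of
    step [2 PI / l], so [1 + |k|] is at most [B] times [1 + |Im|]. Powers of the latter are
    controlled by the vertical decay of orders 0 and [n]. *)
Lemma rapid_Gamma l s : 0 < l -> 0 < Re s -> rapid (fun k => Gamma (zkl l s k)).
Proof.
  intros Hl Hs n.
  destruct (Gamma_vertical_decay 0 (Re s) Hs) as [M0 HM0].
  destruct (Gamma_vertical_decay n (Re s) Hs) as [M HM].
  pose (w := 2 * PI / l). assert (Hw : 0 < w).
  { apply Rdiv_lt_0_compat; auto. pose proof PI_RGT_0. lra. }
  pose (B := 1 + Rabs (Im s) / w + / w).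
  assert (HB1 : 0 <= Rabs (Im s) / w) by (apply Rmult_le_pos; [apply Rabs_pos|left; now apply Rinv_0_lt_compat]).
  assert (HB2 : 0 < / w) by now apply Rinv_0_lt_compat.
  assert (HB : 0 <= B) by (unfold B; lra).
  exists (B ^ n * (2 ^ n * (M0 + M))). intro k.
  assert (HR : Re (zkl l s k) = Re s) by (simpl; unfold Re; ring).
  specialize (HM0 _ HR). specialize (HM _ HR). simpl in HM0. rewrite Rmult_1_l in HM0.
  set (y := Rabs (Im (zkl l s k))) in *.
  assert (Hy : 0 <= y) by apply Rabs_pos.
  assert (HG : 0 <= Cmod (Gamma (zkl l s k))) by apply Cmod_ge_0.
  assert (K1 : Rabs (IZR k) * w <= y + Rabs (Im s)).
  { rewrite <- (Rabs_pos_eq w) by lra. rewrite <- Rabs_mult.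
    replace (IZR k * w) with (- Im (zkl l s k) + Im s).
    - eapply Rle_trans; [apply Rabs_triang|]. rewrite Rabs_Ropp. apply Rle_refl.
    - simpl. unfold Im, w. field. lra. }
  assert (K2 : 1 + Rabs (IZR k) <= B * (1 + y)).
  { assert (Rabs (IZR k) <= y * / w + Rabs (Im s) / w).
    { apply Rmult_le_reg_r with w; auto. eapply Rle_trans; [apply K1|]. right. field. lra. }
    unfold B. nra. }
  assert (K3 : (1 + Rabs (IZR k)) ^ n <= B ^ n * (2 ^ n * (1 + y ^ n))).
  { apply Rle_trans with ((B * (1 + y)) ^ n).
    - apply pow_incr. pose proof (Rabs_pos (IZR k)). lra.
    - rewrite Rpow_mult_distr. apply Rmult_le_compat_l; [now apply pow_le|]. now apply pow_1_plus_le. }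
  apply Rle_trans with (Cmod (Gamma (zkl l s k)) * (B ^ n * (2 ^ n * (1 + y ^ n)))).
  - now apply Rmult_le_compat_l.
  - replace (Cmod (Gamma (zkl l s k)) * (B ^ n * (2 ^ n * (1 + y ^ n)))) with
      (B ^ n * (2 ^ n * (Cmod (Gamma (zkl l s k)) + y ^ n * Cmod (Gamma (zkl l s k))))) by ring.
    apply Rmult_le_compat_l; [now apply pow_le|]. apply Rmult_le_compat_l; [apply pow_le; lra|]. lra.
Qed.

(** * Poisson summation for the Gamma integrand *)

Definition cis (t : R) : C := cexp (pair 0%R t : C).

Lemma cis_eq t : cis t = pair (cos t) (sin t).
Proof. unfold cis, cexp; simpl. now rewrite exp_0, !Rmult_1_l. Qed.

Lemma Cmod_cis t : Cmod (cis t) = 1.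
Proof. unfold cis. rewrite Cmod_cexp. simpl. apply exp_0. Qed.

Fixpoint zpartial (F : Z -> C) (K : nat) : C :=
  match K with
  | O => F 0%Z
  | S k => Cplus (zpartial F k) (Cplus (F (Z.of_nat (S k))) (F (- Z.of_nat (S k))%Z))
  end.

Lemma zpartial_lim F : zasum F ->
  is_lim_seq (fun K => Re (zpartial F K)) (Re (zsum F)) /\
  is_lim_seq (fun K => Im (zpartial F K)) (Im (zsum F)).
Proof.
  intros HF. rewrite zsum_sym by auto. destruct HF as [H1 H2].
  assert (HA : asum (fun k => Cplus (F (Z.of_nat (S k))) (F (- Z.of_nat (S k))%Z))).
  { apply (asum_plus (fun k => F (Z.of_nat (S k)))); auto. now apply (asum_incr_1 (fun k => F (Z.of_nat k))). }
  split; apply is_lim_seq_incr_1.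
  - apply (is_lim_seq_ext (fun K => Re (F 0%Z) + sum_n (fun k => Re (Cplus (F (Z.of_nat (S k))) (F (- Z.of_nat (S k))%Z))) K)).
    + induction n; [rewrite sum_O; reflexivity|]. rewrite sum_n_Sr, <- Rplus_assoc, IHn. reflexivity.
    + apply is_lim_seq_plus'; [apply is_lim_seq_const|]. apply (Series_correct _ (asum_Re _ HA)).
  - apply (is_lim_seq_ext (fun K => Im (F 0%Z) + sum_n (fun k => Im (Cplus (F (Z.of_nat (S k))) (F (- Z.of_nat (S k))%Z))) K)).
    + induction n; [rewrite sum_O; reflexivity|]. rewrite sum_n_Sr, <- Rplus_assoc, IHn. reflexivity.
    + apply is_lim_seq_plus'; [apply is_lim_seq_const|]. apply (Series_correct _ (asum_Im _ HA)).
Qed.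

Section GammaPoisson.

Variables (l : R) (s : C) (x : R).
Hypothesis l_pos : 0 < l.
Hypothesis s_pos : 0 < Re s.

(** The Fourier transform of [y |-> gker s (x + l * y)] at the integer frequency [k], as
    [coeff_LInt] shows. *)
Let F (k : Z) : C :=
  Cmult (RtoC (1 / l)) (Cmult (cis (2 * PI * IZR k / l * x)) (Gamma (zkl l s k))).

Lemma zasum_Gamma_coeff : zasum F.
Proof.
  apply rapid_zasum. apply (rapid_le (fun k => Gamma (zkl l s k)) _ (Rabs (1 / l))).
  - intro k. unfold F. rewrite !Cmod_mult, Cmod_cis, Cmod_R, Rmult_1_l. apply Rle_refl.
  - apply Rabs_pos.
  - now apply rapid_Gamma.
Qed.

Let gl (y : R) : C := gker s (x + l * y).

Let Ccont_affine z : Ccont (fun y => gker z (x + l * y)).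
Proof.
  destruct (gker_cont z) as [A B].
  assert (L : cont (fun y => x + l * y)) by (apply cont_derivable; intro; auto_derive; auto).
  split; [apply (cont_comp _ _ A L)|apply (cont_comp _ _ B L)].
Qed.

(** The character in [y] moves the imaginary part of the parameter by [-2 PI k / l]; the phase in
    [x] compensates for the argument being [x + l * y] rather than [l * y]. *)
Let coeff_LInt k : is_CLInt (fun y => Cmult (gl y) (cis (- (2 * PI * IZR k * y)))) (F k).
Proof.
  assert (HR : Re (zkl l s k) = Re s) by (simpl; unfold Re; ring).
  unfold F. rewrite Cmult_assoc, (Cmult_comm (RtoC (1 / l))), <- Cmult_assoc.
  eapply is_CLInt_ext; [|apply (is_CLInt_scal (fun y => gker (zkl l s k) (x + l * y)) (cis (2 * PI * IZR k / l * x)));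
    [apply Ccont_affine|]].
  - intro y. unfold gl. rewrite !cis_eq. unfold gker. rewrite HR.
    assert (E : Im (zkl l s k) * (x + l * y) = Im s * (x + l * y) - (2 * PI * IZR k / l * x + 2 * PI * IZR k * y)).
    { simpl. unfold Im. field. lra. }
    rewrite E, sin_minus, cos_minus, sin_plus, cos_plus, sin_neg, cos_neg.
    (* The phase [a] occurs once with each sign and cancels only through this identity, inserted as
       a factor 1 before [ring]. *)
    pose proof (sin2_cos2 (2 * PI * IZR k / l * x)) as P. unfold Rsqr in P.
    set (a := 2 * PI * IZR k / l * x) in *.
    apply Ceq; simpl.
    + rewrite <- (Rmult_1_l (_ - _ * - _)). rewrite <- P. ring.
    + rewrite <- (Rmult_1_l (_ * - _ + _)). rewrite <- P. ring.
  - apply is_CLInt_affine; [apply gker_cont|auto|]. apply Gamma_LInt. now rewrite HR.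
Qed.

Let gl_mult_cont (h : R -> R) : cont h -> Ccont (fun y => Cmult (gl y) (RtoC (h y))).
Proof.
  intro Hh. destruct (Ccont_affine s) as [A B]. split; simpl; intro y.
  - apply (continuous_ext (fun y => Re (gl y) * h y)); [intro; simpl; unfold Re; ring|].
    now apply (cont_mult (fun y => Re (gl y))).
  - apply (continuous_ext (fun y => Im (gl y) * h y)); [intro; simpl; unfold Im; ring|].
    now apply (cont_mult (fun y => Im (gl y))).
Qed.

Let gl_cis_cont k : Ccont (fun y => Cmult (gl y) (cis (- (2 * PI * IZR k * y)))).
Proof.
  destruct (Ccont_affine s) as [A B].
  assert (Cc : cont (fun y => cos (- (2 * PI * IZR k * y)))) by (apply cont_derivable; intro; auto_derive; auto).
  assert (Cs : cont (fun y => sin (- (2 * PI * IZR k * y)))) by (apply cont_derivable; intro; auto_derive; auto).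
  split; intro y.
  - apply (continuous_ext (fun y => Re (gl y) * cos (- (2 * PI * IZR k * y)) - Im (gl y) * sin (- (2 * PI * IZR k * y)))).
    { intro; rewrite cis_eq; reflexivity. }
    apply (continuous_minus (V := R_NormedModule)).
    apply (cont_mult (fun y => Re (gl y))); auto. apply (cont_mult (fun y => Im (gl y))); auto.
  - apply (continuous_ext (fun y => Re (gl y) * sin (- (2 * PI * IZR k * y)) + Im (gl y) * cos (- (2 * PI * IZR k * y)))).
    { intro; rewrite cis_eq; reflexivity. }
    apply (continuous_plus (V := R_NormedModule)).
    apply (cont_mult (fun y => Re (gl y))); auto. apply (cont_mult (fun y => Im (gl y))); auto.
Qed.

(** Each cosine of the kernel is half the sum of two opposite characters, so the integral against
    the kernel is the symmetric partial sum of [F]. This supplies the hypothesis on [A] in the real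
    Poisson formula. *)
Let dirichlet_LInt K : is_CLInt (fun y => Cmult (gl y) (RtoC (dirichlet K y))) (zpartial F K).
Proof.
  induction K.
  - apply (is_CLInt_ext (fun y => Cmult (gl y) (cis (- (2 * PI * IZR 0 * y))))); [|apply coeff_LInt].
    intro y. rewrite cis_eq. simpl. rewrite Rmult_0_r, Rmult_0_l, Ropp_0, cos_0, sin_0. reflexivity.
  - assert (H2 : is_CLInt (fun y => Cplus (Cmult (gl y) (cis (- (2 * PI * IZR (Z.of_nat (S K)) * y))))
        (Cmult (gl y) (cis (- (2 * PI * IZR (- Z.of_nat (S K)) * y)))))
        (Cplus (F (Z.of_nat (S K))) (F (- Z.of_nat (S K))%Z))).
    { apply is_CLInt_plus; try apply gl_cis_cont; apply coeff_LInt. }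
    assert (C2 : Ccont (fun y => Cplus (Cmult (gl y) (cis (- (2 * PI * IZR (Z.of_nat (S K)) * y))))
        (Cmult (gl y) (cis (- (2 * PI * IZR (- Z.of_nat (S K)) * y)))))).
    { destruct (gl_cis_cont (Z.of_nat (S K))) as [A1 A2], (gl_cis_cont (- Z.of_nat (S K))%Z) as [B1 B2].
      split; [apply (cont_plus _ _ A1 B1)|apply (cont_plus _ _ A2 B2)]. }
    unfold zpartial; fold zpartial.
    eapply is_CLInt_ext; [|apply (is_CLInt_plus _ _ _ _ (gl_mult_cont _ (dirichlet_cont K)) C2 IHK H2)].
    + intro y. unfold dirichlet; fold dirichlet. rewrite !cis_eq, opp_IZR, <- INR_IZR_INZ.
      replace (- (2 * PI * - INR (S K) * y)) with (2 * PI * INR (S K) * y) by ring.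
      rewrite sin_neg, cos_neg. apply Ceq; simpl; ring.
Qed.

(** The two bounds concern the modulus of [gl] and of its derivative [l * (s - e^v) * gl], where
    [v = x + l * y]; the real Poisson formula wants the same constants for both. *)
Lemma exp_decay_affine : exists C eps, 0 < eps /\ forall y,
  exp (Re s * (x + l * y) - exp (x + l * y)) <= C * exp (- eps * Rabs y) /\
  l * (Cmod s + exp (x + l * y)) * exp (Re s * (x + l * y) - exp (x + l * y)) <= C * exp (- eps * Rabs y).
Proof.
  destruct (exp_lin_minus_exp_decay (Re s) (Re s)) as [C1 [HC1 H1]]; [lra|].
  destruct (exp_lin_minus_exp_decay (Re s + 1) (Re s)) as [C2 [HC2 H2]]; [lra|].
  pose (e := exp (Re s * Rabs x)). assert (He : 0 < e) by apply exp_pos.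
  pose proof (Cmod_ge_0 s) as Hc.
  assert (HC : 0 <= l * (Cmod s * C1 + C2)).
  { apply Rmult_le_pos; [lra|]. assert (0 <= Cmod s * C1) by (apply Rmult_le_pos; lra). lra. }
  exists ((C1 + l * (Cmod s * C1 + C2)) * e), (Re s * l).
  split; [nra|]. intro y.
  assert (Hy : exp (- Re s * Rabs (x + l * y)) <= e * exp (- (Re s * l) * Rabs y)).
  { unfold e. rewrite <- exp_plus. apply exp_le_mono.
    assert (l * Rabs y <= Rabs (x + l * y) + Rabs x).
    { rewrite <- (Rabs_pos_eq l) at 1 by lra. rewrite <- Rabs_mult.
      replace (l * y) with ((x + l * y) + - x) at 1 by ring. rewrite <- (Rabs_Ropp x). apply Rabs_triang. }
    nra. }
  specialize (H1 (x + l * y)). specialize (H2 (x + l * y)). set (v := x + l * y) in *.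
  set (D := exp (- Re s * Rabs v)) in *. set (D' := exp (- (Re s * l) * Rabs y)) in *.
  assert (HD : 0 < D) by apply exp_pos. assert (HD' : 0 < D') by apply exp_pos.
  assert (HeD : 0 <= e * D') by (apply Rmult_le_pos; lra).
  split.
  - apply Rle_trans with (C1 * (e * D')); [nra|]. nra.
  - replace ((Re s + 1) * v - exp v) with (v + (Re s * v - exp v)) in H2 by ring. rewrite exp_plus in H2.
    apply Rle_trans with (l * (Cmod s * C1 + C2) * D).
    + rewrite Rmult_assoc, (Rmult_assoc l). apply Rmult_le_compat_l; [lra|].
      rewrite !Rmult_plus_distr_r, (Rmult_assoc (Cmod s) C1). apply Rplus_le_compat; auto.
      now apply Rmult_le_compat_l.
    + apply Rle_trans with (l * (Cmod s * C1 + C2) * (e * D')).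
      * now apply Rmult_le_compat_l.
      * nra.
Qed.

Lemma zasum_gker : zasum (fun j => gker s (x + l * IZR j)).
Proof.
  destruct exp_decay_affine as [C [eps [He H]]].
  assert (Z0 : zseries (fun j => exp (- eps * Rabs (IZR j)))).
  { split.
    - eapply ex_series_ext; [|apply (ex_series_exp eps He)]. intro n.
      rewrite <- INR_IZR_INZ, Rabs_pos_eq; auto. apply pos_INR.
    - eapply ex_series_ext; [|apply (proj1 (ex_series_incr_1 (fun n => exp (- eps * INR n))) (ex_series_exp eps He))].
      intro n. cbv beta. rewrite opp_IZR, Rabs_Ropp, <- INR_IZR_INZ, Rabs_pos_eq; auto. apply pos_INR. }
  eapply zasum_le; [|apply (zseries_scal C _ Z0)].
  intro j. rewrite Cmod_gker. apply H.
Qed.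

(** The symmetric partial sums of [F] have two limits, the sum of [F] by absolute convergence and
    the sum over the integers by the real Poisson formula applied to each component. *)
Lemma Gamma_poisson :
  zsum (fun j => gker s (x + l * IZR j)) = zsum F.
Proof.
  destruct exp_decay_affine as [C [eps [He H]]].
  destruct zasum_gker as [G1 G2].
  destruct (zpartial_lim F zasum_Gamma_coeff) as [L1 L2].
  (* The derivative of [gl]. *)
  pose (g' := fun y => Cmult (RtoC l) (Cmult (Cminus s (RtoC (exp (x + l * y)))) (gl y))).
  assert (Hg' : forall y, Cmod (g' y) <= C * exp (- eps * Rabs y)).
  { intro y. unfold g', gl. rewrite !Cmod_mult, Cmod_gker, Cmod_R, (Rabs_pos_eq l) by lra.
    eapply Rle_trans; [|apply H]. rewrite Rmult_assoc. apply Rmult_le_compat_l; [lra|].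
    apply Rmult_le_compat_r; [left; apply exp_pos|].
    eapply Rle_trans; [apply Cmod_triangle|]. rewrite Cmod_opp, Cmod_R, (Rabs_pos_eq (exp _)); [lra|].
    left; apply exp_pos. }
  apply Ceq.
  - assert (P : is_lim_seq (fun K => Re (zpartial F K))
      (Series (fun n => Re (gl (IZR (Z.of_nat n))) + Re (gl (IZR (- Z.of_nat (S n))))))).
    { apply (poisson_real (fun y => Re (gl y)) (fun y => Re (g' y)) C eps _ He).
      + intro y. unfold g', gl, Re, Im; simpl. auto_derive; auto. unfold Re, Im, Rminus. ring.
      + intro y. eapply Rle_trans; [apply re_le_Cmod|]. unfold gl. rewrite Cmod_gker. apply H.
      + intro y. eapply Rle_trans; [apply re_le_Cmod|]. auto.
      + intro K. destruct (dirichlet_LInt K) as [D1 D2]. eapply is_LInt_ext; [|exact D1].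
        intro y; simpl; unfold Re; ring. }
    apply is_lim_seq_unique in L1. apply is_lim_seq_unique in P. rewrite P in L1.
    apply Rbar_finite_eq in L1. rewrite <- L1. unfold zsum; simpl.
    rewrite <- Series_plus; [reflexivity|now apply (asum_Re (fun n => gker s (x + l * IZR (Z.of_nat n))))|
      now apply (asum_Re (fun n => gker s (x + l * IZR (- Z.of_nat (S n)))))].
  - assert (P : is_lim_seq (fun K => Im (zpartial F K))
      (Series (fun n => Im (gl (IZR (Z.of_nat n))) + Im (gl (IZR (- Z.of_nat (S n))))))).
    { apply (poisson_real (fun y => Im (gl y)) (fun y => Im (g' y)) C eps _ He).
      + intro y. unfold g', gl, Re, Im; simpl. auto_derive; auto. unfold Re, Im, Rminus. ring.
      + intro y. eapply Rle_trans; [apply im_le_Cmod|]. unfold gl. rewrite Cmod_gker. apply H.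
      + intro y. eapply Rle_trans; [apply im_le_Cmod|]. auto.
      + intro K. destruct (dirichlet_LInt K) as [D1 D2]. eapply is_LInt_ext; [|exact D2].
        intro y; simpl; unfold Im; ring. }
    apply is_lim_seq_unique in L2. apply is_lim_seq_unique in P. rewrite P in L2.
    apply Rbar_finite_eq in L2. rewrite <- L2. unfold zsum; simpl.
    rewrite <- Series_plus; [reflexivity|now apply (asum_Im (fun n => gker s (x + l * IZR (Z.of_nat n))))|
      now apply (asum_Im (fun n => gker s (x + l * IZR (- Z.of_nat (S n)))))].
Qed.

End GammaPoisson.

(** * Finite complex sums *)

Lemma lsum_app l1 l2 : lsum (l1 ++ l2) = Cplus (lsum l1) (lsum l2).
Proof.
  induction l1; simpl.
  - now rewrite Cplus_0_l.
  - fold (lsum (l1 ++ l2)). rewrite IHl1. fold (lsum l1). now rewrite Cplus_assoc.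
Qed.

Lemma lsum_cons z l : lsum (z :: l) = Cplus z (lsum l).
Proof. reflexivity. Qed.

Lemma lsum_flat_map {X Y : Type} (g : Y -> C) (F : X -> list Y) L :
  lsum (map g (flat_map F L)) = lsum (map (fun a => lsum (map g (F a))) L).
Proof.
  induction L; simpl; auto. rewrite map_app, lsum_app, IHL. reflexivity.
Qed.

Lemma lsum_Permutation l1 l2 : Permutation l1 l2 -> lsum l1 = lsum l2.
Proof.
  induction 1; rewrite ?lsum_cons; try congruence.
  rewrite !Cplus_assoc. now rewrite (Cplus_comm y x).
Qed.

Lemma lsum_filter (p : nat -> bool) (g : nat -> C) L :
  lsum (map (fun d => if p d then g d else RtoC 0) L) = lsum (map g (filter p L)).
Proof.
  induction L; auto. simpl map. simpl filter. rewrite lsum_cons, IHL.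
  destruct (p a); [reflexivity|]. now rewrite Cplus_0_l.
Qed.

Lemma lsum_zero {X : Type} (g : X -> C) L : (forall x, In x L -> g x = RtoC 0) -> lsum (map g L) = RtoC 0.
Proof.
  induction L; intro H; auto. simpl map. rewrite lsum_cons, IHL by (intros; apply H; now right).
  rewrite H by now left. apply Cplus_0_l.
Qed.

Lemma map_seq_shift {X : Type} (h : nat -> X) k p : map h (seq k p) = map (fun n => h (k + n)%nat) (seq 0 p).
Proof.
  revert h k. induction p; intros h k; simpl; auto.
  f_equal; [now rewrite Nat.add_0_r|]. rewrite IHp, (IHp (fun n => h (k + n)%nat) 1%nat).
  apply map_ext. intro n. f_equal. lia.
Qed.

Lemma lsum_block (h : nat -> C) m p :
  lsum (map h (seq 0 (m * p))) =
  lsum (map (fun d => lsum (map (fun n => h (d * p + n)%nat) (seq 0 p))) (seq 0 m)).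
Proof.
  induction m; auto.
  rewrite seq_S, map_app, lsum_app, <- IHm.
  replace (S m * p)%nat with (m * p + p)%nat by lia.
  rewrite seq_app, map_app, lsum_app. f_equal. simpl. rewrite Cplus_0_r.
  now rewrite map_seq_shift.
Qed.

Lemma lsum_RtoC (h : nat -> R) n : lsum (map (fun i => RtoC (h i)) (seq 0 (S n))) = RtoC (sum_n h n).
Proof.
  induction n.
  - simpl. rewrite sum_O. apply Cplus_0_r.
  - rewrite seq_S, map_app, lsum_app, IHn, sum_n_Sr. simpl. rewrite Cplus_0_r. now rewrite <- RtoC_plus.
Qed.

Lemma csum_finite (a : nat -> C) M : (forall n, (M <= n)%nat -> a n = RtoC 0) ->
  csum a = lsum (map a (seq 0 M)).
Proof.
  revert a. induction M; intros a H.
  - simpl. rewrite <- csum_0. apply csum_ext. intro; apply H; lia.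
  - assert (HA : asum a).
    { unfold asum. apply (ex_series_nonneg_bounded _ (sum_n (fun n => Cmod (a n)) M)).
      - intro; apply Cmod_ge_0.
      - intro n. assert (Hm : forall k m, sum_n (fun n => Cmod (a n)) m <= sum_n (fun n => Cmod (a n)) (k + m)).
        { induction k; intro m; simpl; [apply Rle_refl|]. rewrite sum_n_Sr.
          specialize (IHk m). pose proof (Cmod_ge_0 (a (S (k + m)))). lra. }
        destruct (le_lt_dec n M) as [Hn|Hn].
        + replace M with ((M - n) + n)%nat by lia. apply Hm.
        + replace n with ((n - M) + M)%nat by lia. right. clear Hn. generalize (n - M)%nat as k.
          induction k; simpl; auto. rewrite sum_n_Sr, IHk, H by lia. rewrite Cmod_0. lra. }
    rewrite csum_incr_1 by auto. rewrite (IHM (fun n => a (S n))) by (intros; apply H; lia).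
    simpl seq. simpl map. rewrite lsum_cons. now rewrite (map_seq_shift a 1).
Qed.

(** * Words and integers with restricted digits *)

(** The recursion on [n / b] inherits more fuel than [n / b] itself would supply; since quotients
    decrease strictly, the excess is harmless. *)
Lemma digits_aux_fuel b : (2 <= b)%nat -> forall f1 f2 n, (n <= f1)%nat -> (n <= f2)%nat ->
  digits_aux b f1 n = digits_aux b f2 n.
Proof.
  intro Hb. induction f1; intros f2 n H1 H2.
  - assert (n = 0)%nat by lia. subst. destruct f2; reflexivity.
  - destruct f2; simpl.
    + assert (n = 0)%nat by lia. subst. reflexivity.
    + destruct (Nat.eqb_spec n 0); auto. f_equal.
      assert (n / b < n)%nat by (apply Nat.div_lt; lia).
      apply IHf1; lia.
Qed.

Lemma maxA_ge A a : In a A -> (a <= maxA A)%nat.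
Proof.
  induction A; simpl; [easy|]. intros [->|H]; [lia|]. specialize (IHA H). fold (maxA A). lia.
Qed.

Lemma maxA_In A : A <> nil -> In (maxA A) A.
Proof.
  induction A as [|a A IH]; [easy|]. intros _. simpl. fold (maxA A).
  destruct A as [|a' A'].
  - left. simpl. lia.
  - destruct (Nat.max_spec a (maxA (a' :: A'))) as [[_ ->]|[_ ->]]; [right; now apply IH|now left].
Qed.

Lemma ln_b_pos b : (2 <= b)%nat -> 0 < ln (INR b).
Proof.
  intro Hb. rewrite <- ln_1. apply ln_increasing; [lra|]. change 1 with (INR 1). apply lt_INR. lia.
Qed.

Lemma length_A_ge_1 (A : list nat) : A <> nil -> 1 <= INR (length A).
Proof.
  intro Hnil. change 1 with (INR 1). apply le_INR. destruct A; [contradiction|simpl; lia].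
Qed.

Section Digits.

Variables (b : nat) (A : list nat).
Hypothesis Hb : (2 <= b)%nat.
Hypothesis HND : NoDup A.
Hypothesis Hnil : A <> nil.
Hypothesis Hlt : List.Forall (fun a => (a < b)%nat) A.
Hypothesis Hmax : (0 < maxA A)%nat.

Definition digit_ok (d : nat) : bool := existsb (fun a => Nat.eqb d (maxA A - a)) A.

Let max_lt : (maxA A < b)%nat.
Proof. rewrite List.Forall_forall in Hlt. apply Hlt. now apply maxA_In. Qed.

Let digit_ok_0 : digit_ok 0 = true.
Proof.
  apply existsb_exists. exists (maxA A). split; [now apply maxA_In|]. apply Nat.eqb_eq. lia.
Qed.

(** At [n = 0] the digit list is empty while the right side tests the digit 0. Both agree because
    the maximum of [A] belongs to [A], which makes 0 an admissible digit. *)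
Let inB_rec n : inB b A n = digit_ok (n mod b) && inB b A (n / b).
Proof.
  unfold inB, digits. fold digit_ok. destruct n as [|n].
  - rewrite Nat.Div0.mod_0_l, Nat.Div0.div_0_l, digit_ok_0. reflexivity.
  - simpl digits_aux at 1. cbn [forallb]. f_equal. f_equal.
    assert (S n / b < S n)%nat by (apply Nat.div_lt; lia).
    apply digits_aux_fuel; auto; lia.
Qed.

(** Detaches the leading digit although digits are listed from the least significant one. A number
    below [b ^ k] may need padding by zeros to fill [k] places, and zero is admissible. *)
Let inB_split k : forall d n, (n < b ^ k)%nat -> (d < b)%nat ->
  inB b A (d * b ^ k + n) = digit_ok d && inB b A n.
Proof.
  induction k; intros d n Hn Hd.
  - simpl in Hn. assert (n = 0)%nat by lia. subst. simpl.
    rewrite Nat.mul_1_r, Nat.add_0_r, inB_rec, Nat.mod_small, Nat.div_small by auto. reflexivity.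
  - rewrite (inB_rec n), (inB_rec (d * b ^ S k + n)).
    replace (d * b ^ S k + n)%nat with (n + (d * b ^ k) * b)%nat by (simpl; ring).
    rewrite Nat.Div0.mod_add, Nat.div_add by lia.
    rewrite (Nat.add_comm (n / b)), IHk; auto.
    + rewrite !andb_assoc. f_equal. apply andb_comm.
    + apply Nat.Div0.div_lt_upper_bound. simpl in Hn. lia.
Qed.

(** The integer [n] attached to a word; the first letter gives its most significant digit. *)
Fixpoint wval (w : list nat) : nat :=
  match w with
  | nil => 0
  | a :: w' => (maxA A - a) * b ^ length w' + wval w'
  end.

Lemma words_length l w : In w (words A l) -> length w = l /\ List.Forall (fun a => In a A) w.
Proof.
  revert w. induction l; simpl; intros w H.
  - destruct H as [<-|[]]. auto.
  - apply in_flat_map in H. destruct H as [a [Ha H]]. apply in_map_iff in H.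
    destruct H as [w' [<- H]]. destruct (IHl _ H). simpl. split; auto.
Qed.

(** The map [a |-> maxA A - a] is injective on [A] in spite of truncated subtraction, as no element
    exceeds the maximum, and it reaches exactly the admissible digits. *)
Let sum_over_digits (g : nat -> C) :
  lsum (map (fun d => if digit_ok d then g d else RtoC 0) (seq 0 b)) =
  lsum (map (fun a => g (maxA A - a)%nat) A).
Proof.
  rewrite lsum_filter, <- (map_map (fun a => maxA A - a)%nat g).
  apply lsum_Permutation, Permutation_map, NoDup_Permutation.
  - apply NoDup_filter, seq_NoDup.
  - assert (H : forall L, (forall a, In a L -> In a A) -> NoDup L -> NoDup (map (fun a => maxA A - a)%nat L)).
    { induction L; intros HL HN; simpl; [constructor|].
      inversion HN; subst. constructor.
      - intro Hin. apply in_map_iff in Hin. destruct Hin as [a' [E Ha']].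
        assert (a' <= maxA A)%nat by (apply maxA_ge, HL; now right).
        assert (a <= maxA A)%nat by (apply maxA_ge, HL; now left).
        assert (a' = a) by lia. now subst.
      - apply IHL; auto. intros; apply HL; now right. }
    now apply H.
  - intro d. rewrite filter_In, in_seq, in_map_iff. unfold digit_ok. rewrite existsb_exists. split.
    + intros [_ [a [Ha E]]]. apply Nat.eqb_eq in E. exists a; auto.
    + intros [a [E Ha]]. split; [lia|]. exists a. split; auto. apply Nat.eqb_eq. auto.
Qed.

(** This is the bijection between words of length [l] and elements of B below [b ^ l], expressed by
    sums so that no inverse map is needed. The step cuts the range into [b] blocks according to the
    leading digit. *)
Lemma words_sum l : forall phi : nat -> C,
  lsum (map (fun w => phi (wval w)) (words A l)) =
  lsum (map (fun n => if inB b A n then phi n else RtoC 0) (seq 0 (b ^ l))).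
Proof.
  induction l; intro phi.
  - reflexivity.
  - simpl words. rewrite lsum_flat_map. simpl Nat.pow. rewrite lsum_block.
    transitivity (lsum (map (fun d => if digit_ok d then
       lsum (map (fun n => if inB b A n then phi (d * b ^ l + n)%nat else RtoC 0) (seq 0 (b ^ l)))
       else RtoC 0) (seq 0 b))).
    + rewrite sum_over_digits. f_equal. apply map_ext. intro a.
      rewrite map_map, <- (IHl (fun n => phi ((maxA A - a) * b ^ l + n)%nat)). f_equal.
      apply map_ext_in. intros w Hw. apply words_length in Hw. destruct Hw as [Hw _]. simpl. now rewrite Hw.
    + f_equal. apply map_ext_in. intros d Hd. apply in_seq in Hd.
      destruct (digit_ok d) eqn:E.
      * f_equal. apply map_ext_in. intros n Hn. apply in_seq in Hn.
        rewrite inB_split by lia. now rewrite E.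
      * symmetry. apply lsum_zero. intros n Hn. apply in_seq in Hn.
        rewrite inB_split by lia. now rewrite E.
Qed.

Let b_pos : 0 < INR b.
Proof. apply lt_0_INR. lia. Qed.

Let f_pos : 0 < INR (maxA A).
Proof. now apply lt_0_INR. Qed.

Lemma kappa_ge_1 : 1 <= kappa b A.
Proof.
  unfold kappa. apply Rmult_le_reg_r with (INR (maxA A)); auto.
  replace ((INR b - 1) / INR (maxA A) * INR (maxA A)) with (INR b - 1) by (field; lra).
  assert (H : (maxA A + 1 <= b)%nat) by lia. apply le_INR in H. rewrite plus_INR in H. simpl in H. lra.
Qed.

(** The induction closes because [kappa * f = b - 1]: replacing a letter [a] by [f - (f - a)]
    contributes [b - 1] minus [kappa] times the new digit. *)
Lemma kappa_digval w : List.Forall (fun a => In a A) w ->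
  kappa b A * digval b w = 1 - (kappa b A * INR (wval w) + 1) / INR b ^ length w.
Proof.
  induction 1 as [|a w Ha Hw IH]; simpl.
  - field.
  - fold (digval b w). apply maxA_ge in Ha.
    rewrite plus_INR, mult_INR, minus_INR, pow_INR by auto.
    assert (Hp : 0 < INR b ^ length w) by now apply pow_lt.
    replace (kappa b A * ((INR a + digval b w) / INR b)) with ((kappa b A * INR a + kappa b A * digval b w) / INR b) by (field; lra).
    rewrite IH. unfold kappa. field. repeat split; lra.
Qed.

Definition chi (n : nat) : R := if inB b A n then 1 else 0.

Lemma chi_nonneg n : 0 <= chi n.
Proof. unfold chi. destruct (inB b A n); lra. Qed.

(** The bijection with words applied to the constant 1. The upper index is [b ^ l - 1] because
    [sum_n] includes its last term. *)
Let chi_count l : sum_n chi (b ^ l - 1) = INR (length A) ^ l.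
Proof.
  assert (E : RtoC (sum_n chi (b ^ l - 1)) = RtoC (INR (length A) ^ l)); [|now inversion E].
  assert (Hp : (0 < b ^ l)%nat) by (apply Nat.neq_0_lt_0, Nat.pow_nonzero; lia).
  rewrite <- lsum_RtoC. replace (S (b ^ l - 1)) with (b ^ l)%nat by lia.
  transitivity (lsum (map (fun n => if inB b A n then RtoC 1 else RtoC 0) (seq 0 (b ^ l)))).
  - f_equal. apply map_ext. intro n. unfold chi. now destruct (inB b A n).
  - rewrite <- (words_sum l (fun _ => RtoC 1)).
    assert (H1 : forall (X : Type) (L : list X), lsum (map (fun _ => RtoC 1) L) = RtoC (INR (length L))).
    { induction L; auto. simpl length. rewrite S_INR. simpl map. rewrite lsum_cons, IHL.
      rewrite <- RtoC_plus. f_equal. ring. }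
    rewrite H1. f_equal. rewrite <- pow_INR. f_equal.
    induction l; auto. simpl.
    assert (H2 : forall L, length (flat_map (fun a => map (cons a) (words A l)) L) = (length L * length (words A l))%nat).
    { induction L; auto. simpl. rewrite length_app, length_map, IHL. reflexivity. }
    rewrite H2, IHl; auto. apply Nat.neq_0_lt_0, Nat.pow_nonzero; lia.
Qed.

Let sum_n_tail_le (h : nat -> R) c P M : (forall n, (P < n)%nat -> h n <= c * chi n) -> 0 <= c -> (P <= M)%nat ->
  sum_n h M <= sum_n h P + c * sum_n chi M.
Proof.
  intros H Hc HM. induction HM as [|M HM IH].
  - assert (0 <= sum_n chi P) by (apply sum_n_nonneg, chi_nonneg). nra.
  - rewrite !sum_n_Sr. specialize (H (S M) ltac:(lia)). lra.
Qed.

Definition lam (n : nat) : R := kappa b A * INR n + 1.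

Lemma lam_ge n : INR n + 1 <= lam n.
Proof. unfold lam. pose proof kappa_ge_1. pose proof (pos_INR n). nra. Qed.

Lemma lam_ge_1 n : 1 <= lam n.
Proof. pose proof (lam_ge n). pose proof (pos_INR n). lra. Qed.

(** Between [b^l] and [b^(l+1)] there are at most [N^(l+1)] elements of B, each contributing at most
    [b^(-theta l)]; a block is thus at most [N * rho^l] with [rho = N b^(-theta) < 1]. *)
Lemma summable_B theta : ln (INR (length A)) / ln (INR b) < theta ->
  ex_series (fun n => chi n * exp (- theta * ln (lam n))).
Proof.
  intro Ht. pose proof (ln_b_pos b Hb) as Hl. pose proof (length_A_ge_1 A Hnil) as HN.
  pose (N := INR (length A)). fold N in HN, Ht.
  pose (rho := exp (ln N - theta * ln (INR b))).
  assert (Hrho : 0 < rho < 1).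
  { split; [apply exp_pos|]. rewrite <- exp_0. apply exp_increasing.
    apply Rmult_lt_compat_r with (r := ln (INR b)) in Ht; auto.
    unfold Rdiv in Ht. rewrite Rmult_assoc, Rinv_l in Ht by lra. lra. }
  assert (Ht0 : 0 <= theta).
  { assert (0 <= ln N).
    { rewrite <- ln_1. destruct HN as [HN| <-]; [left; apply ln_increasing; lra|lra]. }
    assert (0 <= ln N / ln (INR b)) by (apply Rmult_le_pos; auto; left; now apply Rinv_0_lt_compat). lra. }
  pose (h := fun n => chi n * exp (- theta * ln (lam n))).
  assert (Hh : forall n, 0 <= h n).
  { intro n. apply Rmult_le_pos; [apply chi_nonneg|left; apply exp_pos]. }
  (* The 1 covers [n = 0]; the rest is the geometric sum of the blocks before [l]. *)
  assert (Hbound : forall l, sum_n h (b ^ l - 1) <= 1 + N * (1 - rho ^ l) / (1 - rho)).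
  { induction l.
    - simpl. rewrite sum_O. unfold h, chi, lam. simpl INR. rewrite Rmult_0_r, Rplus_0_l, ln_1, Rmult_0_r, exp_0.
      replace (1 + N * (1 - 1) / (1 - rho)) with 1 by (field; lra). destruct (inB b A 0); lra.
    - eapply Rle_trans; [apply (sum_n_tail_le h (exp (- theta * (INR l * ln (INR b)))) (b ^ l - 1))|].
      + intros n Hn. unfold h. rewrite Rmult_comm. apply Rmult_le_compat_r; [apply chi_nonneg|].
        apply exp_le_mono. rewrite !Ropp_mult_distr_l_reverse. apply Ropp_le_contravar.
        apply Rmult_le_compat_l; auto. rewrite <- ln_pow by auto.
        assert (Hn' : (b ^ l <= n)%nat) by lia. apply le_INR in Hn'. rewrite pow_INR in Hn'.
        pose proof (lam_ge n). assert (0 < INR b ^ l) by now apply pow_lt.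
        apply ln_le; lra.
      + left; apply exp_pos.
      + assert (b ^ l <= b ^ S l)%nat by (apply Nat.pow_le_mono_r; lia). lia.
      + rewrite chi_count. fold N.
        assert (E : exp (- theta * (INR l * ln (INR b))) * N ^ S l = N * rho ^ l).
        { simpl. rewrite <- Rmult_assoc, (Rmult_comm _ N), Rmult_assoc. f_equal.
          unfold rho. rewrite exp_pow_n. rewrite <- (exp_ln N) at 1 by lra.
          rewrite exp_pow_n, <- exp_plus. f_equal. ring. }
        rewrite E. apply Rle_trans with (1 + N * (1 - rho ^ l) / (1 - rho) + N * rho ^ l); [lra|].
        right. simpl. field. lra. }
  apply (ex_series_nonneg_bounded h (1 + N / (1 - rho))); auto.
  intro n.
  assert (Hn : (n <= b ^ n - 1)%nat) by (assert (n < b ^ n)%nat by (apply Nat.pow_gt_lin_r; lia); lia).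
  apply Rle_trans with (sum_n h (b ^ n - 1)).
  - replace (b ^ n - 1)%nat with ((b ^ n - 1 - n) + n)%nat by lia.
    generalize (b ^ n - 1 - n)%nat as k. induction k; simpl; [apply Rle_refl|].
    rewrite sum_n_Sr. specialize (Hh (S (k + n))). lra.
  - eapply Rle_trans; [apply Hbound|]. apply Rplus_le_compat_l.
    unfold Rdiv. apply Rmult_le_compat_r; [left; apply Rinv_0_lt_compat; lra|].
    assert (0 <= rho ^ n) by (apply pow_le; lra). nra.
Qed.

End Digits.

(** * Trigonometric series with rapidly decreasing coefficients *)

Definition trig (c : Z -> C) (t : R) : C := zsum (fun k => Cmult (c k) (cis (2 * PI * IZR k * t))).

Definition trig_deriv (c : Z -> C) (k : Z) : C := Cmult (pair 0 (2 * PI * IZR k) : C) (c k).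

Lemma Cmod_imag y : Cmod (pair 0 y : C) = Rabs y.
Proof.
  unfold Cmod; simpl. replace (0 * (0 * 1) + y * (y * 1)) with (Rsqr y) by (unfold Rsqr; ring).
  apply sqrt_Rsqr_abs.
Qed.

Lemma rapid_deriv c : rapid c -> rapid (trig_deriv c).
Proof.
  intro H. apply (rapid_le (fun k => Cmult (RtoC (IZR k)) (c k)) _ (2 * PI)).
  - intro k. unfold trig_deriv. rewrite !Cmod_mult, Cmod_imag, Cmod_R, Rabs_mult.
    rewrite (Rabs_pos_eq (2 * PI)) by (pose proof PI_RGT_0; lra). lra.
  - pose proof PI_RGT_0; lra.
  - now apply rapid_mult_index.
Qed.

Lemma zasum_trig c t : rapid c -> zasum (fun k => Cmult (c k) (cis (2 * PI * IZR k * t))).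
Proof.
  intro H. apply (zasum_le _ (fun k => Cmod (c k))); [|now apply rapid_zasum].
  intro k. rewrite Cmod_mult, Cmod_cis, Rmult_1_r. apply Rle_refl.
Qed.

Lemma abs_sin_le x : Rabs (sin x) <= Rabs x.
Proof.
  destruct (MVT_gen sin 0 x cos) as [c [_ H]].
  - intros; apply is_derive_Reals, derivable_pt_lim_sin.
  - intros; apply continuity_sin.
  - rewrite sin_0, !Rminus_0_r in H. rewrite H, Rabs_mult.
    assert (Rabs (cos c) <= 1) by (apply Rabs_le, COS_bound).
    pose proof (Rabs_pos x). nra.
Qed.

(** A crude constant: the real part contributes [x^2 / 2] and the imaginary part [x^2]. *)
Lemma cis_taylor x : Cmod (Cminus (Cminus (cis x) (RtoC 1)) (pair 0 x : C)) <= 2 * x ^ 2.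
Proof.
  assert (Hc : forall y, Rabs (cos y - 1) <= y ^ 2 / 2).
  { intro y. replace y with (2 * (y / 2)) at 1 by field. rewrite cos_2a_sin.
    replace (1 - 2 * sin (y / 2) * sin (y / 2) - 1) with (- (2 * Rsqr (sin (y / 2)))) by (unfold Rsqr; ring).
    rewrite Rabs_Ropp, Rabs_pos_eq by (pose proof (Rle_0_sqr (sin (y / 2))); lra).
    assert (H := abs_sin_le (y / 2)). apply Rsqr_le_abs_1 in H.
    unfold Rsqr in H. unfold Rsqr. nra. }
  assert (Hs : Rabs (sin x - x) <= x ^ 2).
  { destruct (MVT_gen (fun y => sin y - y) 0 x (fun y => cos y - 1)) as [c [Hc1 H]].
    - intros. auto_derive; auto. ring.
    - intros y _. apply continuity_pt_filterlim. apply (cont_derivable (fun z => sin z - z)). intro; auto_derive; auto.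
    - rewrite sin_0, !Rminus_0_r in H. rewrite H, Rabs_mult.
      assert (Hcx : Rabs c <= Rabs x).
      { revert Hc1. unfold Rmin, Rmax, Rabs. destruct (Rle_dec 0 x), (Rcase_abs c), (Rcase_abs x); lra. }
      (* The quadratic bound suffices for [|c| <= 2]; beyond that the trivial bound 2 does. *)
      assert (B : Rabs (cos c - 1) <= Rabs c).
      { destruct (Rle_dec (Rabs c) 1) as [H1|H1].
        - eapply Rle_trans; [apply Hc|]. rewrite <- (pow2_abs c). pose proof (Rabs_pos c). nra.
        - destruct (Rle_dec (Rabs c) 2) as [H2|H2].
          + eapply Rle_trans; [apply Hc|]. rewrite <- (pow2_abs c). nra.
          + pose proof (COS_bound c). apply Rabs_le. lra. }
      rewrite <- (pow2_abs x). pose proof (Rabs_pos x). nra. }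
  specialize (Hc x). rewrite cis_eq.
  eapply Rle_trans; [apply Cmod_le_Re_Im|]. simpl.
  replace (cos x + - (1) + - 0) with (cos x - 1) by ring.
  replace (sin x + - 0 + - x) with (sin x - x) by ring.
  pose proof (pow2_ge_0 x). simpl in *. lra.
Qed.

Lemma cis_plus x y : cis (x + y) = Cmult (cis x) (cis y).
Proof. rewrite !cis_eq, cos_plus, sin_plus. apply Ceq; simpl; ring. Qed.

(** The second-order remainders are summed termwise against the coefficients of the second
    derivative. A quadratic remainder uniform in [t] yields both the differentiation of the series
    and the error of the Riemann sums. *)
Lemma trig_taylor c : rapid c -> exists M, 0 <= M /\ forall t h,
  Cmod (Cminus (Cminus (trig c (t + h)) (trig c t)) (Cmult (RtoC h) (trig (trig_deriv c) t))) <= M * h ^ 2.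
Proof.
  intro Hc. pose proof (rapid_deriv _ Hc) as Hd.
  pose proof (rapid_zasum _ (rapid_deriv _ Hd)) as Z2.
  set (S1 := Series (fun k => 2 * Cmod (trig_deriv (trig_deriv c) (Z.of_nat k)))).
  set (S2 := Series (fun k => 2 * Cmod (trig_deriv (trig_deriv c) (- Z.of_nat (S k))))).
  exists (2 * (S1 + S2)). split.
  { destruct Z2 as [ZA ZB].
    assert (0 <= S1) by (apply Series_nonneg; [intro; pose proof (Cmod_ge_0 (trig_deriv (trig_deriv c) (Z.of_nat k))); lra | now apply (ex_series_scal_R 2)]).
    assert (0 <= S2) by (apply Series_nonneg; [intro; pose proof (Cmod_ge_0 (trig_deriv (trig_deriv c) (- Z.of_nat (S k)))); lra | now apply (ex_series_scal_R 2 (fun k => Cmod (trig_deriv (trig_deriv c) (- Z.of_nat (S k)))))]).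
    lra. }
  intros t h.
  assert (E : Cminus (Cminus (trig c (t + h)) (trig c t)) (Cmult (RtoC h) (trig (trig_deriv c) t)) =
    zsum (fun k => Cmult (Cmult (c k) (cis (2 * PI * IZR k * t)))
       (Cminus (Cminus (cis (2 * PI * IZR k * h)) (RtoC 1)) (pair 0 (2 * PI * IZR k * h) : C)))).
  { unfold trig.
    pose proof (zasum_trig c (t + h) Hc) as A1. pose proof (zasum_trig c t Hc) as A2.
    pose proof (zasum_trig (trig_deriv c) t Hd) as A3.
    rewrite <- (zsum_scal _ _ A3).
    rewrite <- (zsum_minus _ _ A1 A2).
    rewrite <- (zsum_minus _ _ (zasum_minus _ _ A1 A2) (zasum_scal (RtoC h) _ A3)).
    apply zsum_ext. intro k.
    replace (2 * PI * IZR k * (t + h)) with (2 * PI * IZR k * t + 2 * PI * IZR k * h) by ring.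
    rewrite cis_plus. unfold trig_deriv. apply Ceq; simpl; ring. }
  rewrite E. clear E.
  eapply Rle_trans.
  - apply (zsum_bound _ (fun k => h ^ 2 * (2 * Cmod (trig_deriv (trig_deriv c) k)))).
    + intro k. rewrite !Cmod_mult, Cmod_cis, Rmult_1_r.
      unfold trig_deriv. rewrite !Cmod_mult, !Cmod_imag.
      pose proof (cis_taylor (2 * PI * IZR k * h)) as B. pose proof (Cmod_ge_0 (c k)) as Hck.
      apply Rle_trans with (Cmod (c k) * (2 * (2 * PI * IZR k * h) ^ 2)); [now apply Rmult_le_compat_l|].
      replace (Rabs (2 * PI * IZR k) * (Rabs (2 * PI * IZR k) * Cmod (c k))) with ((Rabs (2 * PI * IZR k)) ^ 2 * Cmod (c k)) by ring.
      rewrite pow2_abs. right. ring.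
    + apply zseries_scal. now apply zseries_scal.
  - rewrite !Series_scal_l. fold S1 S2. unfold S1, S2. rewrite !Series_scal_l. right. ring.
Qed.

Lemma quadratic_derive (f : R -> R) (d M x : R) : 0 <= M ->
  (forall h, Rabs (f (x + h) - f x - h * d) <= M * h ^ 2) -> is_derive f x d.
Proof.
  intros HM H. apply is_derive_Reals. intros eps He.
  assert (Hd : 0 < eps / (M + 1)) by (apply Rdiv_lt_0_compat; lra).
  exists (mkposreal _ Hd). intros h Hh0 Hh. simpl in Hh.
  replace ((f (x + h) - f x) / h - d) with ((f (x + h) - f x - h * d) / h) by (field; auto).
  unfold Rdiv. rewrite Rabs_mult, Rabs_inv.
  pose proof (Rabs_pos_lt h Hh0) as Hp.
  apply Rle_lt_trans with (M * Rabs h).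
  - apply Rmult_le_reg_r with (Rabs h); auto. rewrite Rmult_assoc, Rinv_l, Rmult_1_r by lra.
    eapply Rle_trans; [apply H|]. rewrite <- (pow2_abs h). right. ring.
  - apply Rle_lt_trans with (M * (eps / (M + 1))); [apply Rmult_le_compat_l; lra|].
    apply Rmult_lt_reg_r with (M + 1); [lra|]. field_simplify; [|lra]. nra.
Qed.

Lemma trig_derive c t : rapid c ->
  is_derive (fun t => Re (trig c t)) t (Re (trig (trig_deriv c) t)) /\
  is_derive (fun t => Im (trig c t)) t (Im (trig (trig_deriv c) t)).
Proof.
  intro Hc. destruct (trig_taylor c Hc) as [M [HM H]].
  split; apply (quadratic_derive _ _ M); auto; intro h; eapply Rle_trans; try apply (H t h).
  - eapply Rle_trans; [|apply re_le_Cmod]. right. f_equal. simpl. unfold Re. ring.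
  - eapply Rle_trans; [|apply im_le_Cmod]. right. f_equal. simpl. unfold Im. ring.
Qed.

Lemma rapid_deriv_iter c n : rapid c -> rapid (Nat.iter n trig_deriv c).
Proof. intro H. induction n; simpl; auto. now apply rapid_deriv. Qed.

Lemma trig_Derive_n c n t : rapid c ->
  Derive_n (fun t => Re (trig c t)) n t = Re (trig (Nat.iter n trig_deriv c) t) /\
  Derive_n (fun t => Im (trig c t)) n t = Im (trig (Nat.iter n trig_deriv c) t).
Proof.
  intro Hc. revert t. induction n; intro t; [now split|].
  destruct (trig_derive _ t (rapid_deriv_iter c n Hc)) as [D1 D2].
  split; simpl.
  - rewrite (Derive_ext _ (fun t => Re (trig (Nat.iter n trig_deriv c) t))) by apply IHn.
    now apply is_derive_unique.
  - rewrite (Derive_ext _ (fun t => Im (trig (Nat.iter n trig_deriv c) t))) by apply IHn.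
    now apply is_derive_unique.
Qed.

Lemma trig_smooth c : rapid c -> smoothC (trig c).
Proof.
  intros Hc n t. destruct n; [now split|]. simpl.
  destruct (trig_derive _ t (rapid_deriv_iter c n Hc)) as [D1 D2].
  split.
  - apply (ex_derive_ext (fun t => Re (trig (Nat.iter n trig_deriv c) t))).
    + intro; symmetry; now apply trig_Derive_n.
    + eexists; apply D1.
  - apply (ex_derive_ext (fun t => Im (trig (Nat.iter n trig_deriv c) t))).
    + intro; symmetry; now apply trig_Derive_n.
    + eexists; apply D2.
Qed.

Lemma trig_periodic c t : trig c (t + 1) = trig c t.
Proof.
  apply zsum_ext. intro k. f_equal. rewrite !cis_eq.
  replace (2 * PI * IZR k * (t + 1)) with (2 * PI * IZR k * t + 2 * PI * IZR k) by ring.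
  now rewrite cos_Zperiod, sin_Zperiod.
Qed.

(** The factor is [1 / (2 PI i k)]. Index 0 is set aside, since the mean integrates to a linear term
    and not to a periodic one. *)
Definition trig_primitive_coeff (c : Z -> C) (k : Z) : C :=
  if Z.eqb k 0 then RtoC 0 else Cmult (pair 0 (- / (2 * PI * IZR k)) : C) (c k).

Definition trig_primitive (c : Z -> C) (t : R) : C :=
  Cplus (Cmult (RtoC t) (c 0%Z)) (trig (trig_primitive_coeff c) t).

Lemma rapid_primitive c : rapid c -> rapid (trig_primitive_coeff c).
Proof.
  intro H. apply (rapid_le c _ 1); auto; [|lra].
  intro k. unfold trig_primitive_coeff. destruct (Z.eqb_spec k 0).
  - rewrite Cmod_0, Rmult_1_l. apply Cmod_ge_0.
  - rewrite Cmod_mult, Cmod_imag. apply Rmult_le_compat_r; [apply Cmod_ge_0|].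
    rewrite Rabs_Ropp, Rabs_inv.
    assert (H1 : 1 <= Rabs (2 * PI * IZR k)).
    { rewrite Rabs_mult, (Rabs_pos_eq (2 * PI)) by (pose proof PI_RGT_0; lra).
      assert (1 <= Rabs (IZR k)) by (rewrite <- abs_IZR; apply IZR_le; lia).
      pose proof PI2_1. nra. }
    rewrite <- Rinv_1. apply Rinv_le_contravar; lra.
Qed.

Lemma trig_primitive_deriv c t : rapid c ->
  trig c t = Cplus (c 0%Z) (trig (trig_deriv (trig_primitive_coeff c)) t).
Proof.
  intro Hc. destruct (zsum_single (c 0%Z)) as [E HZ]. rewrite <- E at 1.
  unfold trig. rewrite <- zsum_plus; auto.
  - apply zsum_ext. intro k. unfold trig_deriv, trig_primitive_coeff.
    destruct (Z.eqb_spec k 0) as [->|Hk].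
    + rewrite Rmult_0_r, Rmult_0_l, cis_eq, cos_0, sin_0. apply Ceq; simpl; ring.
    + assert (IZR k <> 0) by now apply not_0_IZR. pose proof PI_RGT_0.
      apply Ceq; simpl; field; lra.
  - apply zasum_trig. now apply rapid_deriv, rapid_primitive.
Qed.

(** The error of the rectangle rule at the right endpoint, that is, Taylor's formula for the
    primitive with step [-h]. The right endpoint is the relevant one because the weight of [m] in
    the average is the increment of [log_b] from [m - 1] to [m]. *)
Lemma trig_primitive_taylor c : rapid c -> exists M, 0 <= M /\ forall t h,
  Cmod (Cminus (Cmult (trig c t) (RtoC h)) (Cminus (trig_primitive c t) (trig_primitive c (t - h)))) <= M * h ^ 2.
Proof.
  intro Hc. destruct (trig_taylor _ (rapid_primitive c Hc)) as [M [HM H]].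
  exists M. split; auto. intros t h. specialize (H t (- h)).
  replace (M * (- h) ^ 2) with (M * h ^ 2) in H by ring.
  eapply Rle_trans; [|apply H]. right. f_equal.
  rewrite (trig_primitive_deriv c t Hc). unfold trig_primitive, Rminus.
  apply Ceq; simpl; ring.
Qed.

(** Over one period only the linear term moves. *)
Lemma trig_primitive_period c t : Cminus (trig_primitive c (t + 1)) (trig_primitive c t) = c 0%Z.
Proof.
  unfold trig_primitive. rewrite trig_periodic.
  generalize (trig (trig_primitive_coeff c) t) (c 0%Z). intros u v. apply Ceq; simpl; unfold Re, Im; ring.
Qed.

(** * A summable weight on the shifts of the logarithmic scale *)

(** Up to the factor [eps], the derivative of the logistic function. It is comparable to
    [e^(-eps |x|)], but its sums over arithmetic progressions telescope up to a constant and its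
    behaviour under translation is explicit. *)
Definition om (eps x : R) : R := exp (eps * x) / (1 + exp (eps * x)) ^ 2.

Lemma om_pos eps x : 0 < om eps x.
Proof. apply Rdiv_lt_0_compat; [apply exp_pos|]. apply pow_lt. pose proof (exp_pos (eps * x)). lra. Qed.

(** The factor 4 comes from [(1 + E)^2 <= 4 max(1, E^2)] with [E = e^(eps x)]. *)
Lemma exp_lin_minus_exp_le_om p eps : 0 < eps <= p ->
  exists C, 0 < C /\ forall x, exp (p * x - exp x) <= C * om eps x.
Proof.
  intro H. destruct (exp_lin_minus_exp_decay p eps H) as [C [HC0 HC]].
  exists (C * 4). split; [lra|]. intro x. eapply Rle_trans; [apply HC|].
  rewrite Rmult_assoc. apply Rmult_le_compat_l; [lra|]. unfold om.
  pose proof (exp_pos (eps * x)) as HE.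
  assert (HP : 0 < (1 + exp (eps * x)) ^ 2) by (apply pow_lt; lra).
  apply Rmult_le_reg_r with ((1 + exp (eps * x)) ^ 2); auto.
  replace (4 * (exp (eps * x) / (1 + exp (eps * x)) ^ 2) * (1 + exp (eps * x)) ^ 2)
    with (4 * exp (eps * x)) by (field; lra).
  destruct (Rle_dec 0 x) as [Hx|Hx].
  - rewrite Rabs_pos_eq by auto. replace (- eps * x) with (- (eps * x)) by ring. rewrite exp_Ropp.
    assert (H1 : 1 <= exp (eps * x)) by (rewrite <- exp_0; apply exp_le_mono; nra).
    set (E := exp (eps * x)) in *. apply Rmult_le_reg_l with E; auto.
    rewrite <- Rmult_assoc, Rinv_r, Rmult_1_l by lra. nra.
  - rewrite Rabs_left by lra. replace (- eps * - x) with (eps * x) by ring.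
    assert (H1 : exp (eps * x) <= 1) by (rewrite <- exp_0; apply exp_le_mono; nra).
    set (E := exp (eps * x)) in *. nra.
Qed.

(** The numerator is multiplied by [e^(eps y)] and the denominator only grows. With [y = ln lam_n]
    the price is [lam_n^eps]. *)
Lemma om_shift eps x y : 0 < eps -> 0 <= y -> om eps (x + y) <= exp (eps * y) * om eps x.
Proof.
  intros He Hy. unfold om. rewrite Rmult_plus_distr_l, exp_plus.
  assert (H1 : 1 <= exp (eps * y)) by (rewrite <- exp_0; apply exp_le_mono; nra).
  pose proof (exp_pos (eps * x)) as HE. set (E := exp (eps * x)) in *. set (Y := exp (eps * y)) in *.
  unfold Rdiv. rewrite (Rmult_comm E Y), Rmult_assoc.
  apply Rmult_le_compat_l; [lra|]. apply Rmult_le_compat_l; [lra|].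
  apply Rinv_le_contravar; [apply pow_lt; lra|]. apply pow_incr. nra.
Qed.

(* [om eps x] is bounded by the increment over [x, x + l] of the bounded
   increasing function [1 - 1 / (1 + e^(eps x))]. *)
Lemma om_sum eps l : 0 < eps -> 0 < l -> exists B, 0 <= B /\ forall x K,
  sum_n (fun k => om eps (x + l * INR k)) K <= B /\
  sum_n (fun k => om eps (x - l * INR (S k))) K <= B.
Proof.
  intros He Hl. pose (b := exp (eps * l)).
  assert (Hb : 1 < b) by (unfold b; rewrite <- exp_0; apply exp_increasing; nra).
  pose (B := b / (b - 1)). assert (HB : 0 < B) by (apply Rdiv_lt_0_compat; lra).
  pose (Phi := fun x => - / (1 + exp (eps * x))).
  assert (HPhi : forall x, - 1 <= Phi x <= 0).
  { intro x. unfold Phi. pose proof (exp_pos (eps * x)).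
    assert (0 < / (1 + exp (eps * x))) by (apply Rinv_0_lt_compat; lra).
    assert (/ (1 + exp (eps * x)) <= / 1) by (apply Rinv_le_contravar; lra). rewrite Rinv_1 in *. lra. }
  assert (Hstep : forall x, om eps x <= B * (Phi (x + l) - Phi x)).
  { intro x. unfold Phi, om, B. rewrite Rmult_plus_distr_l, exp_plus. fold b.
    pose proof (exp_pos (eps * x)) as HE. set (E := exp (eps * x)) in *.
    assert (HEb : 0 < E * b) by (apply Rmult_lt_0_compat; lra).
    replace (b / (b - 1) * (- / (1 + E * b) - - / (1 + E))) with (b * E / ((1 + E) * (1 + E * b))) by (field; repeat split; lra).
    replace (E / (1 + E) ^ 2) with (b * E / ((1 + E) * (b * (1 + E)))) by (field; repeat split; lra).
    unfold Rdiv. apply Rmult_le_compat_l; [nra|]. apply Rinv_le_contravar; [nra|].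
    apply Rmult_le_compat_l; nra. }
  exists B. split; [lra|]. intros x K.
  assert (Hup : sum_n (fun k => om eps (x + l * INR k)) K <= B * (Phi (x + l * INR (S K)) - Phi x)).
  { induction K.
    - rewrite sum_O. simpl INR. rewrite Rmult_0_r, Rplus_0_r, Rmult_1_r. apply Hstep.
    - rewrite sum_n_Sr. assert (H := Hstep (x + l * INR (S K))).
      replace (x + l * INR (S K) + l) with (x + l * INR (S (S K))) in H by (rewrite (S_INR (S K)); ring). lra. }
  assert (Hdn : sum_n (fun k => om eps (x - l * INR (S k))) K <= B * (Phi x - Phi (x - l * INR (S K)))).
  { clear Hup. induction K.
    - rewrite sum_O. simpl INR. rewrite Rmult_1_r. assert (H := Hstep (x - l)).
      replace (x - l + l) with x in H by ring. auto.
    - rewrite sum_n_Sr. assert (H := Hstep (x - l * INR (S (S K)))).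
      replace (x - l * INR (S (S K)) + l) with (x - l * INR (S K)) in H by (rewrite (S_INR (S K)); ring). lra. }
  pose proof (HPhi x). pose proof (HPhi (x + l * INR (S K))). pose proof (HPhi (x - l * INR (S K))).
  split; [eapply Rle_trans; [apply Hup|]|eapply Rle_trans; [apply Hdn|]];
  rewrite <- (Rmult_1_r B) at 2; apply Rmult_le_compat_l; lra.
Qed.

(** That [B] does not depend on [x] is what makes the final estimate uniform in [m], which enters
    through [x = ln m]. *)
Lemma om_zseries eps l : 0 < eps -> 0 < l -> exists B, 0 <= B /\ forall x,
  zseries (fun j => om eps (x + l * IZR j)) /\
  Series (fun k => om eps (x + l * IZR (Z.of_nat k))) <= B /\
  Series (fun k => om eps (x + l * IZR (- Z.of_nat (S k)))) <= B.
Proof.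
  intros He Hl. destruct (om_sum eps l He Hl) as [B [HB0 HB]]. exists B. split; auto. intro x.
  assert (U : forall K, sum_n (fun k => om eps (x + l * IZR (Z.of_nat k))) K <= B).
  { intro K. rewrite (sum_n_ext _ (fun k => om eps (x + l * INR k))); [apply HB|].
    intro; now rewrite INR_IZR_INZ. }
  assert (D : forall K, sum_n (fun k => om eps (x + l * IZR (- Z.of_nat (S k)))) K <= B).
  { intro K. rewrite (sum_n_ext _ (fun k => om eps (x - l * INR (S k)))); [apply HB|].
    intro n; rewrite opp_IZR, <- INR_IZR_INZ. f_equal. ring. }
  assert (E1 : ex_series (fun k => om eps (x + l * IZR (Z.of_nat k)))).
  { apply (ex_series_nonneg_bounded _ B); auto. intro; left; apply om_pos. }
  assert (E2 : ex_series (fun k => om eps (x + l * IZR (- Z.of_nat (S k))))).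
  { apply (ex_series_nonneg_bounded _ B); auto. intro; left; apply om_pos. }
  split; [now split|]. split; apply Series_le_of_sums; auto.
Qed.

(** * Comparison of [(1-y)^m] with [e^(-my)] *)

Definition pospow (m y : R) : R := if Rlt_dec y 1 then exp (m * ln (1 - y)) else 0.

(** For [y < 1/2], [ln (1 - y) >= -y - 2 y^2] gives the error [2 m y^2 e^(-my)]. For [y >= 1/2],
    [4 m y^2 >= 1] makes the bound at least [e^(-my)] itself; this case fixes the constant 4. *)
Lemma pospow_bounds m y : 1 <= m -> 0 < y ->
  0 <= pospow m y <= exp (- (m * y)) /\ exp (- (m * y)) - pospow m y <= 4 * m * y ^ 2 * exp (- (m * y)).
Proof.
  intros Hm Hy. pose proof (exp_pos (- (m * y))) as HP. unfold pospow.
  assert (Big : 1 / 2 <= y -> exp (- (m * y)) <= 4 * m * y ^ 2 * exp (- (m * y))).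
  { intro H. rewrite <- (Rmult_1_l (exp _)) at 1. apply Rmult_le_compat_r; [lra|].
    assert (1 <= 4 * y ^ 2) by nra. nra. }
  destruct (Rlt_dec y 1) as [Hy1|Hy1].
  - assert (Hln : ln (1 - y) <= - y).
    { rewrite <- (ln_exp (- y)). apply ln_le; [lra|]. pose proof (exp_ineq1_le (- y)). lra. }
    assert (Hup : exp (m * ln (1 - y)) <= exp (- (m * y))) by (apply exp_le_mono; nra).
    pose proof (exp_pos (m * ln (1 - y))).
    split; [lra|]. destruct (Rle_dec (1 / 2) y) as [H2|H2]; [specialize (Big H2); lra|].
    assert (Hlow : - y - 2 * y ^ 2 <= ln (1 - y)).
    { assert (Hi : 0 < / (1 - y)) by (apply Rinv_0_lt_compat; lra).
      assert (H3 : ln (/ (1 - y)) <= / (1 - y) - 1).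
      { assert (H4 := exp_ineq1_le (ln (/ (1 - y)))). rewrite exp_ln in H4 by auto. lra. }
      rewrite ln_Rinv in H3 by lra.
      assert (H5 : / (1 - y) - 1 <= y + 2 * y ^ 2).
      { apply Rmult_le_reg_r with (1 - y); [lra|]. rewrite Rmult_minus_distr_r, Rinv_l by lra. nra. }
      lra. }
    replace (m * ln (1 - y)) with (- (m * y) + m * (ln (1 - y) + y)) by ring. rewrite exp_plus.
    pose proof (exp_ineq1_le (m * (ln (1 - y) + y))).
    assert (- (2 * m * y ^ 2) <= m * (ln (1 - y) + y)) by nra.
    assert (0 <= m * y ^ 2) by (apply Rmult_le_pos; nra).
    set (P := exp (- (m * y))) in *. set (Q := exp (m * (ln (1 - y) + y))) in *.
    replace (P - P * Q) with ((1 - Q) * P) by ring. apply Rmult_le_compat_r; lra.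
  - split; [lra|]. rewrite Rminus_0_r. apply Big. lra.
Qed.

(** * Real and complex powers *)

Lemma rcpow_real x m : 0 < x -> rcpow x (RtoC m) = RtoC (exp (m * ln x)).
Proof.
  intro Hx. rewrite rcpow_pos, cexp_mult_real by auto. simpl.
  rewrite Rmult_0_l, cos_0, sin_0, Rmult_1_r, Rmult_0_r. reflexivity.
Qed.

Lemma rcpow_0 m : 0 < m -> rcpow 0 (RtoC m) = RtoC 0.
Proof.
  intro Hm. unfold rcpow. destruct (Req_EM_T 0 0); [|lra]. simpl.
  destruct (Req_EM_T m 0); [lra|reflexivity].
Qed.

(** The conventions agree at the edge: [x = 0] corresponds to [y = 1], where both sides vanish. *)
Lemma rcpow_kappa_pospow kap x m : 0 < kap -> 0 <= x -> 0 < m ->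
  Cmult (rcpow kap (RtoC m)) (rcpow x (RtoC m)) = RtoC (pospow m (1 - kap * x)).
Proof.
  intros Hk [Hx| <-] Hm.
  - rewrite !rcpow_real by auto. rewrite <- RtoC_mult, <- exp_plus. f_equal.
    unfold pospow. assert (0 < kap * x) by now apply Rmult_lt_0_compat.
    destruct (Rlt_dec (1 - kap * x) 1); [|lra]. f_equal.
    replace (1 - (1 - kap * x)) with (kap * x) by ring. rewrite ln_mult by auto. ring.
  - rewrite rcpow_0, Cmult_0_r by auto. unfold pospow. rewrite Rmult_0_r, Rminus_0_r.
    destruct (Rlt_dec 1 1); [lra|reflexivity].
Qed.

Lemma cexp_plus z w : cexp (Cplus z w) = Cmult (cexp z) (cexp w).
Proof.
  unfold cexp. simpl. unfold Re, Im. rewrite exp_plus, cos_plus, sin_plus. apply Ceq; simpl; ring.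
Qed.

Lemma cexp_neq_0 z : cexp z <> RtoC 0.
Proof.
  intro H. assert (E := Cmod_cexp z). rewrite H, Cmod_0 in E. pose proof (exp_pos (Re z)). lra.
Qed.

Lemma lsum_scal {X : Type} z (g : X -> C) L : lsum (map (fun x => Cmult z (g x)) L) = Cmult z (lsum (map g L)).
Proof.
  induction L.
  - simpl. now rewrite Cmult_0_r.
  - simpl map. rewrite !lsum_cons, IHL, Cmult_plus_distr_l. reflexivity.
Qed.

(** * The double sum over levels and restricted integers *)

Section Main.

Variables (b : nat) (A : list nat) (s : C).
Hypothesis Hb : (2 <= b)%nat.
Hypothesis HND : NoDup A.
Hypothesis Hnil : A <> nil.
Hypothesis Hlt : List.Forall (fun a => (a < b)%nat) A.
Hypothesis Hmax : (0 < maxA A)%nat.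
Hypothesis Hs : ln (INR (length A)) / ln (INR b) < Re s.

Let l := ln (INR b).
Let kap := kappa b A.
Let lm := lam b A.
Let ch := chi b A.
(** Half the distance from [Re s] to the abscissa [log_b N], so that [Re s - eps] still lies beyond
    that abscissa. *)
Let eps := (Re s - ln (INR (length A)) / l) / 2.

Let l_pos : 0 < l.
Proof. now apply ln_b_pos. Qed.

Let b_pos : 0 < INR b.
Proof. apply lt_0_INR. lia. Qed.

Let eps_bounds : 0 < eps < Re s.
Proof.
  assert (0 <= ln (INR (length A)) / l).
  { apply Rmult_le_pos; [|left; now apply Rinv_0_lt_compat].
    rewrite <- ln_1. apply ln_le; [lra|]. now apply (length_A_ge_1 A). }
  fold l in Hs. unfold eps. lra.
Qed.

Let lm_ge_1 n : 1 <= lm n.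
Proof. now apply (lam_ge_1 b A). Qed.

Let ln_lm n : 0 <= ln (lm n).
Proof. rewrite <- ln_1. apply ln_le; [lra|apply lm_ge_1]. Qed.

Let q (n : nat) : R := ch n * exp (- (Re s - eps) * ln (lm n)).

Let q_pos n : 0 <= q n.
Proof. apply Rmult_le_pos; [apply (chi_nonneg b A)|left; apply exp_pos]. Qed.

Let q_series : ex_series q.
Proof. apply (summable_B b A); auto. fold l. fold l in Hs. unfold eps. lra. Qed.

(** The logarithm of [X = m b^j]. *)
Let xj (m : R) (j : Z) : R := ln m + l * IZR j.

Let term (m : R) (j : Z) (n : nat) : C :=
  Cmult (RtoC (ch n * exp (- (lm n * exp (xj m j))))) (cexp (Cmult s (RtoC (xj m j)))).

Let Cmod_term m j n : Cmod (term m j n) = ch n * exp (- (lm n * exp (xj m j))) * exp (Re s * xj m j).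
Proof.
  unfold term. rewrite Cmod_mult, Cmod_R, Cmod_cexp, Rabs_pos_eq.
  - do 2 f_equal. simpl. unfold Re. ring.
  - apply Rmult_le_pos; [apply (chi_nonneg b A)|left; apply exp_pos].
Qed.

(* [a] is the exponent of an extra power [(lam_n X)^a] with [X = e^x]. *)
Let weight_bound a : 0 <= a -> exists C, 0 < C /\ forall x n,
  ch n * exp (a * (x + ln (lm n)) - lm n * exp x) * exp (Re s * x) <= C * om eps x * q n.
Proof.
  intro Ha. destruct (exp_lin_minus_exp_le_om (Re s + a) eps) as [C [HC0 HC]]; [lra|].
  exists C. split; auto. intros x n. unfold q.
  assert (Hch := chi_nonneg b A n). fold ch in Hch.
  specialize (HC (x + ln (lm n))).
  rewrite exp_plus, exp_ln in HC by (pose proof (lm_ge_1 n); lra).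
  assert (HO := om_shift eps x (ln (lm n)) ltac:(lra) (ln_lm n)).
  replace (exp (a * (x + ln (lm n)) - lm n * exp x) )
    with (exp (- Re s * ln (lm n)) * exp (- (Re s * x)) * exp ((Re s + a) * (x + ln (lm n)) - exp x * lm n))
    by (rewrite <- !exp_plus; f_equal; ring).
  replace (ch n * (exp (- Re s * ln (lm n)) * exp (- (Re s * x)) * exp ((Re s + a) * (x + ln (lm n)) - exp x * lm n)) * exp (Re s * x))
    with (ch n * exp (- Re s * ln (lm n)) * exp ((Re s + a) * (x + ln (lm n)) - exp x * lm n)).
  2:{ rewrite exp_Ropp. field. pose proof (exp_pos (Re s * x)). lra. }
  replace (C * om eps x * (ch n * exp (- (Re s - eps) * ln (lm n))))
    with (ch n * exp (- Re s * ln (lm n)) * (C * (exp (eps * ln (lm n)) * om eps x))).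
  2:{ replace (- (Re s - eps) * ln (lm n)) with (- Re s * ln (lm n) + eps * ln (lm n)) by ring.
      rewrite exp_plus. ring. }
  apply Rmult_le_compat_l.
  - apply Rmult_le_pos; auto. left; apply exp_pos.
  - eapply Rle_trans; [apply HC|]. apply Rmult_le_compat_l; [lra|auto].
Qed.

Let term_bound : exists C, 0 < C /\ forall m j n, Cmod (term m j n) <= C * om eps (xj m j) * q n.
Proof.
  destruct (weight_bound 0 ltac:(lra)) as [C [HC0 HC]]. exists C. split; auto. intros m j n.
  rewrite Cmod_term. specialize (HC (xj m j) n). rewrite Rmult_0_l, Rminus_0_l in HC. exact HC.
Qed.

Let om_xj m : zseries (fun j => om eps (xj m j)).
Proof.
  destruct (om_zseries eps l) as [B [_ HB]]; [lra|auto|]. apply (HB (ln m)).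
Qed.

Let term_eq m j n : 0 < m -> term m j n =
  Cmult (Cmult (rcpow m s) (rcpow (INR b) (Cmult (RtoC (IZR j)) s)))
    (if inB b A n then RtoC (exp (- (kappa b A * INR n + 1) * powerRZ (INR b) j * m)) else RtoC 0).
Proof.
  intro Hm. rewrite !rcpow_pos by auto.
  assert (E : exp (xj m j) = m * powerRZ (INR b) j).
  { unfold xj, l. rewrite exp_plus, exp_ln by auto. f_equal.
    rewrite powerRZ_Rpower by auto. unfold Rpower. f_equal. ring. }
  rewrite <- cexp_plus. unfold term. rewrite E.
  replace (Cmult s (RtoC (xj m j))) with (Cplus (Cmult s (RtoC (ln m))) (Cmult (Cmult (RtoC (IZR j)) s) (RtoC (ln (INR b))))).
  2:{ unfold xj, l. apply Ceq; simpl; ring. }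
  rewrite Cmult_comm. f_equal. unfold ch, chi, lm, lam.
  destruct (inB b A n).
  - rewrite Rmult_1_l. do 2 f_equal. ring.
  - now rewrite Rmult_0_l.
Qed.

Lemma Gs2_eq_terms m : 0 < m -> Gs2 b A s m = zsum (fun j => csum (term m j)).
Proof.
  intro Hm. destruct term_bound as [C [HC0 HC]].
  set (E := fun j n => if inB b A n then RtoC (exp (- (kappa b A * INR n + 1) * powerRZ (INR b) j * m)) else RtoC 0).
  set (Z := fun j => rcpow (INR b) (Cmult (RtoC (IZR j)) s)).
  assert (Hm0 : rcpow m s <> RtoC 0) by (rewrite rcpow_pos by auto; apply cexp_neq_0).
  assert (HZ0 : forall j, Z j <> RtoC 0) by (intro; unfold Z; rewrite rcpow_pos by auto; apply cexp_neq_0).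
  assert (Hin : forall j, csum (term m j) = Cmult (rcpow m s) (Cmult (Z j) (csum (E j)))).
  { intro j. rewrite Cmult_assoc, <- csum_scal_neq0.
    - apply csum_ext. intro n. now apply term_eq.
    - now apply Cmult_neq_0.
    - apply (asum_le _ (fun n => C * om eps (xj m j) * q n)); [|now apply ex_series_scal_R].
      intro n. unfold E, Z. rewrite <- term_eq by auto. apply HC. }
  rewrite (zsum_ext _ _ Hin). unfold Gs2. symmetry. apply (zsum_scal_neq0 (rcpow m s) (fun j => Cmult (Z j) (csum (E j)))); auto.
  destruct (zasum_csum (term m) (fun j => C * om eps (xj m j)) q) as [Z1 Z2]; auto.
  { now apply zseries_scal. }
  split; [apply (ex_series_ext _ _ (fun k => f_equal Cmod (Hin (Z.of_nat k))) Z1)|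
          apply (ex_series_ext _ _ (fun k => f_equal Cmod (Hin (- Z.of_nat (S k))%Z)) Z2)].
Qed.

(** * Fourier coefficients of the limit function *)

Definition Gcoeff (k : Z) : C :=
  Cmult (RtoC (1 / ln (INR b))) (Cmult (Gamma (zk b s k)) (Dser b A (zk b s k))).

Let Dterm (k : Z) (n : nat) : C :=
  Cmult (Cmult (RtoC (ch n)) (cexp (Cmult s (RtoC (- ln (lm n)))))) (cis (2 * PI * IZR k / l * ln (lm n))).

Let Cmod_Dterm k n : Cmod (Dterm k n) <= q n.
Proof.
  unfold Dterm, q. rewrite !Cmod_mult, Cmod_cis, Cmod_cexp, Cmod_R, Rmult_1_r, Rabs_pos_eq by apply (chi_nonneg b A).
  apply Rmult_le_compat_l; [apply (chi_nonneg b A)|]. apply exp_le_mono. simpl.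
  assert (0 <= eps * ln (lm n)) by (apply Rmult_le_pos; [lra|auto]). unfold Re in *. lra.
Qed.

Let Dser_eq k : Dser b A (zk b s k) = csum (Dterm k).
Proof.
  apply csum_ext. intro n. unfold Dterm, ch, chi. destruct (inB b A n).
  - fold (lam b A n). change (lam b A n) with (lm n). assert (Hn := lm_ge_1 n). rewrite rcpow_pos by lra.
    unfold cis. rewrite Cmult_1_l, <- cexp_plus. unfold Cdiv. rewrite Cmult_1_l.
    set (w := Cmult (zk b s k) (RtoC (ln (lm n)))).
    replace (Cplus (Cmult s (RtoC (- ln (lm n)))) (0%R, (2 * PI * IZR k / l * ln (lm n))%R)) with (Copp w).
    + assert (H : Cmult (cexp w) (cexp (Copp w)) = RtoC 1).
      { rewrite <- cexp_plus. unfold cexp. simpl. rewrite !Rplus_opp_r, exp_0, cos_0, sin_0. apply Ceq; simpl; ring. }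
      rewrite <- (Cmult_1_r (Cinv (cexp w))), <- H, Cmult_assoc, Cinv_l, Cmult_1_l; auto. apply cexp_neq_0.
    + unfold w, zk. apply Ceq; simpl; unfold l; field; fold l; lra.
  - rewrite !Cmult_0_l. reflexivity.
Qed.

(** The Dirichlet series over B is bounded on the whole vertical line, its terms having moduli
    independent of [k]; all the decay comes from [Gamma]. *)
Lemma rapid_Gcoeff : rapid Gcoeff.
Proof.
  apply (rapid_le (fun k => Gamma (zkl l s k)) _ (Rabs (1 / l) * (2 * Series q))).
  - intro k. unfold Gcoeff. fold l. rewrite !Cmod_mult, Cmod_R, Dser_eq, Rmult_assoc.
    apply Rmult_le_compat_l; [apply Rabs_pos|]. rewrite Rmult_comm.
    apply Rmult_le_compat_r; [apply Cmod_ge_0|]. apply csum_bound; auto.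
  - apply Rmult_le_pos; [apply Rabs_pos|]. apply Rmult_le_pos; [lra|]. now apply Series_nonneg.
  - apply rapid_Gamma; auto. lra.
Qed.

Lemma Gs_eq_trig m : Gs b A s m = trig Gcoeff (logb b m).
Proof.
  assert (HZ : zasum (fun k => Cmult (RtoC (1 / l)) (Cmult (Cmult (cis (2 * PI * IZR k * logb b m)) (Gamma (zk b s k))) (Dser b A (zk b s k))))).
  { apply (zasum_le _ (fun k => Cmod (Gcoeff k))); [|apply rapid_zasum, rapid_Gcoeff].
    intro k. unfold Gcoeff. rewrite !Cmod_mult, Cmod_cis, Rmult_1_l. apply Rle_refl. }
  change (Gs b A s m) with (Cmult (RtoC (1 / l)) (zsum (fun k => Cmult (Cmult (cis (2 * PI * IZR k * logb b m)) (Gamma (zk b s k))) (Dser b A (zk b s k))))).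
  rewrite <- (zsum_scal_neq0 (RtoC (1 / l))
    (fun k => Cmult (Cmult (cis (2 * PI * IZR k * logb b m)) (Gamma (zk b s k))) (Dser b A (zk b s k)))); auto.
  - apply zsum_ext. intro k. unfold Gcoeff. fold l.
    generalize (Gamma (zk b s k)) (Dser b A (zk b s k)) (cis (2 * PI * IZR k * logb b m)) (RtoC (1 / l)).
    intros u1 u2 u3 u4. apply Ceq; simpl; ring.
  - intro H. apply RtoC_inj in H. assert (0 < 1 / l) by (apply Rdiv_lt_0_compat; lra). lra.
Qed.

(** Two interchanges surround the Poisson formula: [j] with [n] under the weight [om], then [n] with
    [k] under the rapid decrease of [Gamma]. For each [n] the formula is used at
    [x = ln m + ln lam_n]. *)
Lemma Gs_eq_Gs2 m : 0 < m -> Gs b A s m = Gs2 b A s m.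
Proof.
  intro Hm. rewrite Gs2_eq_terms by auto. destruct term_bound as [C [HC0 HC]].
  assert (Hs0 : 0 < Re s) by lra.
  transitivity (csum (fun n => zsum (fun j => term m j n))).
  2:{ symmetry. apply (zsum_csum_swap (term m) (fun j => C * om eps (xj m j)) q); auto.
      - now apply zseries_scal.
      - intro j. apply Rmult_le_pos; [lra|left; apply om_pos]. }
  pose (F := fun n k => Cmult (RtoC (1 / l)) (Cmult (cis (2 * PI * IZR k / l * (ln m + ln (lm n)))) (Gamma (zkl l s k)))).
  (* The kernel at [x + ln lam_n] carries an extra [lam_n^s], which [c0 n] removes; it also carries
     the indicator of B. *)
  pose (c0 := fun n => Cmult (RtoC (ch n)) (cexp (Cmult s (RtoC (- ln (lm n)))))).
  assert (HF : forall n, zsum (fun j => term m j n) = zsum (fun k => Cmult (c0 n) (F n k))).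
  { intro n.
    assert (ZF := zasum_Gamma_coeff l s (ln m + ln (lm n)) l_pos Hs0).
    assert (PF := Gamma_poisson l s (ln m + ln (lm n)) l_pos Hs0).
    rewrite (zsum_scal (c0 n) (F n) ZF). unfold F. rewrite <- PF.
    rewrite <- (zsum_scal (c0 n) _ (zasum_gker l s (ln m + ln (lm n)) l_pos Hs0)).
    apply zsum_ext. intro j. unfold term, c0.
    replace (ln m + ln (lm n) + l * IZR j) with (xj m j + ln (lm n)) by (unfold xj; ring).
    set (x := xj m j). set (y := ln (lm n)).
    assert (E : gker s (x + y) = Cmult (RtoC (exp (- (lm n * exp x)))) (cexp (Cmult s (RtoC (x + y))))).
    { rewrite cexp_mult_real. unfold gker, y. rewrite exp_plus, exp_ln by (pose proof (lm_ge_1 n); lra).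
      unfold Rminus. rewrite (exp_plus _ (- _)), (Rmult_comm (exp x)). apply Ceq; simpl; ring. }
    rewrite E. replace (Cmult s (RtoC (x + y))) with (Cplus (Cmult s (RtoC x)) (Cmult s (RtoC y))) by (apply Ceq; simpl; ring).
    rewrite cexp_plus.
    assert (E1 : Cmult (cexp (Cmult s (RtoC (- y)))) (cexp (Cmult s (RtoC y))) = RtoC 1).
    { rewrite <- cexp_plus. replace (Cplus _ _) with (RtoC 0) by (apply Ceq; simpl; ring).
      unfold cexp. simpl. rewrite exp_0, cos_0, sin_0. apply Ceq; simpl; ring. }
    rewrite RtoC_mult.
    transitivity (Cmult (Cmult (RtoC (ch n)) (Cmult (RtoC (exp (- (lm n * exp x)))) (cexp (Cmult s (RtoC x)))))
       (Cmult (cexp (Cmult s (RtoC (- y)))) (cexp (Cmult s (RtoC y))))).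
    - rewrite E1. rewrite Cmult_1_r, Cmult_assoc. reflexivity.
    - ring. }
  rewrite (csum_ext _ _ HF).
  assert (HFD : forall k n, Cmult (c0 n) (F n k) =
     Cmult (Cmult (RtoC (1 / l)) (Cmult (cis (2 * PI * IZR k * logb b m)) (Gamma (zk b s k)))) (Dterm k n)).
  { intros k n. unfold F, Dterm, c0.
    replace (2 * PI * IZR k / l * (ln m + ln (lm n))) with (2 * PI * IZR k * logb b m + 2 * PI * IZR k / l * ln (lm n))
      by (unfold logb; fold l; field; lra).
    rewrite cis_plus. change (zkl l s k) with (zk b s k). ring. }
  rewrite <- (zsum_csum_swap (fun k n => Cmult (c0 n) (F n k)) (fun k => Rabs (1 / l) * Cmod (Gamma (zk b s k))) q).
  - rewrite Gs_eq_trig. apply zsum_ext. intro k.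
    rewrite (csum_ext _ _ (HFD k)), csum_scal by (apply (asum_le _ q); auto).
    unfold Gcoeff. rewrite Dser_eq. fold l. ring.
  - intros k n. rewrite HFD, !Cmod_mult, Cmod_cis, Rmult_1_l, Cmod_R.
    apply Rmult_le_compat_l; [|apply Cmod_Dterm]. apply Rmult_le_pos; [apply Rabs_pos|apply Cmod_ge_0].
  - apply zseries_scal. apply rapid_zasum. now apply rapid_Gamma.
  - auto.
  - intro k. apply Rmult_le_pos; [apply Rabs_pos|apply Cmod_ge_0].
  - auto.
Qed.

(** * Comparison of the scaled moments with the limit function *)

Let uterm (m : R) (j : Z) (n : nat) : C :=
  Cmult (RtoC (ch n * pospow m (lm n * exp (xj m j) / m))) (cexp (Cmult s (RtoC (xj m j)))).

(** With [y = lam_n X / m], the error [4 m y^2 e^(-my)] equals [4 / m] times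
    [(lam_n X)^2 e^(-lam_n X)]. The gain [1 / m] is thus explicit, and the square is the extra power
    that [weight_bound] admits. *)
Let uterm_bound m j n : 1 <= m -> Cmod (uterm m j n) <= Cmod (term m j n) /\
  Cmod (Cminus (uterm m j n) (term m j n)) <=
    4 / m * (ch n * exp (2 * (xj m j + ln (lm n)) - lm n * exp (xj m j)) * exp (Re s * xj m j)).
Proof.
  intro Hm. assert (Hch := chi_nonneg b A n). fold ch in Hch.
  assert (Hn := lm_ge_1 n). pose proof (exp_pos (xj m j)) as HX.
  set (y := lm n * exp (xj m j) / m).
  assert (Hy : 0 < y) by (apply Rdiv_lt_0_compat; [apply Rmult_lt_0_compat; lra|lra]).
  destruct (pospow_bounds m y Hm Hy) as [[B1 B2] B3].
  assert (Emy : m * y = lm n * exp (xj m j)) by (unfold y; field; lra).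
  rewrite Emy in *.
  assert (Es : exp (Re (Cmult s (RtoC (xj m j)))) = exp (Re s * xj m j)).
  { f_equal. simpl. unfold Re. ring. }
  split.
  - rewrite Cmod_term. unfold uterm. rewrite Cmod_mult, Cmod_R, Cmod_cexp, Es.
    apply Rmult_le_compat_r; [left; apply exp_pos|].
    fold y. rewrite Rabs_pos_eq by now apply Rmult_le_pos. now apply Rmult_le_compat_l.
  - unfold uterm, term. fold y.
    set (E := exp (- (lm n * exp (xj m j)))) in *. set (Z := cexp (Cmult s (RtoC (xj m j)))).
    replace (Cminus (Cmult (RtoC (ch n * pospow m y)) Z) (Cmult (RtoC (ch n * E)) Z))
      with (Cmult (RtoC (ch n * (pospow m y - E))) Z).
    2:{ apply Ceq; simpl; ring. }
    unfold Z. rewrite Cmod_mult, Cmod_R, Cmod_cexp, Es, <- Rmult_assoc.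
    apply Rmult_le_compat_r; [left; apply exp_pos|].
    rewrite Rabs_mult, (Rabs_pos_eq (ch n)), (Rabs_minus_sym (pospow m y)), (Rabs_pos_eq (E - _)) by lra.
    rewrite <- Rmult_assoc, (Rmult_comm (4 / m)), Rmult_assoc. apply Rmult_le_compat_l; auto.
    eapply Rle_trans; [apply B3|]. right.
    assert (E2 : exp (2 * (xj m j + ln (lm n)) - lm n * exp (xj m j)) = (m * y) ^ 2 * E).
    { unfold Rminus. rewrite exp_plus. fold E. f_equal. rewrite Emy.
      replace (2 * (xj m j + ln (lm n))) with (xj m j + ln (lm n) + (xj m j + ln (lm n))) by ring.
      rewrite !exp_plus, exp_ln by lra. ring. }
    rewrite E2. field. lra.
Qed.

(** For [j >= 0] the argument [lam_n b^j] is at least 1, where the truncated power vanishes. Only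
    negative levels remain, [-(i+1)] belonging to words of length [i + 1]. *)
Let uterm_nonneg_index m k n : 1 <= m -> uterm m (Z.of_nat k) n = RtoC 0.
Proof.
  intro Hm. unfold uterm, pospow. destruct (Rlt_dec _ 1) as [H|H]; [|rewrite Rmult_0_r; apply Cmult_0_l].
  exfalso. apply (Rlt_not_le _ _ H).
  assert (Hn := lm_ge_1 n). unfold xj. rewrite exp_plus, exp_ln by lra.
  replace (lm n * (m * exp (l * IZR (Z.of_nat k))) / m) with (lm n * exp (l * IZR (Z.of_nat k))) by (field; lra).
  assert (1 <= exp (l * IZR (Z.of_nat k))).
  { rewrite <- exp_0. apply exp_le_mono. rewrite <- INR_IZR_INZ. apply Rmult_le_pos; [lra|apply pos_INR]. }
  nra.
Qed.

(** Since [lam_n >= n + 1], truncation removes every [n] that is too large to come from a word of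
    length [i + 1]; the infinite sum over B becomes the finite sum over words. *)
Let uterm_zero m i n : 1 <= m -> (b ^ S i <= n)%nat -> uterm m (- Z.of_nat (S i)) n = RtoC 0.
Proof.
  intros Hm Hn. unfold uterm, pospow. destruct (Rlt_dec _ 1) as [H|H]; [|rewrite Rmult_0_r; apply Cmult_0_l].
  exfalso. apply (Rlt_not_le _ _ H).
  assert (HX : exp (xj m (- Z.of_nat (S i))) = m / INR b ^ S i).
  { unfold xj, l. rewrite exp_plus, exp_ln by lra. unfold Rdiv. f_equal.
    rewrite opp_IZR, <- INR_IZR_INZ. replace (ln (INR b) * - INR (S i)) with (- (INR (S i) * ln (INR b))) by ring.
    now rewrite exp_Ropp, <- exp_pow_n, exp_ln. }
  rewrite HX. assert (HP : 0 < INR b ^ S i) by now apply pow_lt.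
  replace (lm n * (m / INR b ^ S i) / m) with (lm n / INR b ^ S i) by (field; lra).
  apply Rmult_le_reg_r with (INR b ^ S i); auto. unfold Rdiv. rewrite Rmult_assoc, Rinv_l, Rmult_1_r, Rmult_1_l by lra.
  apply le_INR in Hn. rewrite pow_INR in Hn.
  assert (HL := lam_ge b A Hb Hnil Hlt Hmax n). change (lam b A n) with (lm n) in HL. lra.
Qed.

Let digval_nonneg w : 0 <= digval b w.
Proof.
  induction w as [|a w IH]; simpl; [lra|]. fold (digval b w).
  apply Rmult_le_pos; [|left; now apply Rinv_0_lt_compat]. pose proof (pos_INR a). lra.
Qed.

(** The factor [m^s b^(-(i+1)s)] is [X^s], and [kappa^m] times the power of the digit value is the
    truncated power at [lam_n / b^(i+1)]. *)
Let u_level m i : 1 <= m ->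
  Cmult (Cmult (rcpow kap (RtoC m)) (rcpow m s))
    (lsum (map (fun w => Cmult (rcpow (digval b w) (RtoC m)) (rcpow (INR b) (Cmult (RtoC (- INR (S i))) s))) (words A (S i))))
  = csum (uterm m (- Z.of_nat (S i))).
Proof.
  intro Hm. rewrite (csum_finite _ (b ^ S i)) by (intros; now apply uterm_zero).
  rewrite <- lsum_scal.
  set (Z := cexp (Cmult s (RtoC (xj m (- Z.of_nat (S i)))))).
  assert (HX : exp (xj m (- Z.of_nat (S i))) = m / INR b ^ S i).
  { unfold xj, l. rewrite exp_plus, exp_ln by lra. unfold Rdiv. f_equal.
    rewrite opp_IZR, <- INR_IZR_INZ. replace (ln (INR b) * - INR (S i)) with (- (INR (S i) * ln (INR b))) by ring.
    now rewrite exp_Ropp, <- exp_pow_n, exp_ln. }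
  assert (HZ : Cmult (rcpow m s) (rcpow (INR b) (Cmult (RtoC (- INR (S i))) s)) = Z).
  { rewrite !rcpow_pos by (auto; lra). rewrite <- cexp_plus. unfold Z. f_equal.
    unfold xj, l. rewrite opp_IZR, <- INR_IZR_INZ. apply Ceq; cbn -[INR]; ring. }
  transitivity (lsum (map (fun w => (fun n => Cmult (RtoC (pospow m (lm n * exp (xj m (- Z.of_nat (S i))) / m))) Z) (wval b A w)) (words A (S i)))).
  - f_equal. apply map_ext_in. intros w Hw. apply words_length in Hw. destruct Hw as [Hlen Hw].
    rewrite <- HZ.
    assert (HK : 1 <= kap) by now apply (kappa_ge_1 b A).
    assert (E : pospow m (lm (wval b A w) * exp (xj m (- Z.of_nat (S i))) / m) = pospow m (1 - kap * digval b w)).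
    { f_equal. unfold kap. rewrite (kappa_digval b A Hb Hnil Hlt Hmax w Hw), Hlen, HX. fold (lam b A (wval b A w)). fold lm.
      assert (0 < INR b ^ S i) by now apply pow_lt. unfold lm. field. lra. }
    rewrite E, <- rcpow_kappa_pospow by (auto; lra). ring.
  - etransitivity; [apply (words_sum b A Hb HND Hnil Hlt Hmax (S i)
      (fun n => Cmult (RtoC (pospow m (lm n * exp (xj m (- Z.of_nat (S i))) / m))) Z))|].
    f_equal. apply map_ext. intro n.
    unfold uterm, ch, chi. destruct (inB b A n).
    + now rewrite Rmult_1_l.
    + rewrite Rmult_0_l, Cmult_0_l. reflexivity.
Qed.

Lemma scaled_u_eq_terms m : 1 <= m -> scaled_u b A s m = zsum (fun j => csum (uterm m j)).
Proof.
  intro Hm. destruct term_bound as [C [HC0 HC]].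
  unfold zsum. rewrite (csum_ext (fun k => csum (uterm m (Z.of_nat k))) (fun _ => RtoC 0)).
  2:{ intro k. rewrite (csum_ext _ (fun _ => RtoC 0)); [apply csum_0|]. intro n. now apply uterm_nonneg_index. }
  (* The contribution [0^m] of the atom at 0 vanishes because [m >= 1]. *)
  rewrite csum_0, Cplus_0_l. unfold scaled_u, u. rewrite rcpow_0, Cplus_0_l by lra.
  assert (HK : 1 <= kap) by now apply (kappa_ge_1 b A).
  rewrite <- csum_scal_neq0.
  - apply csum_ext. intro i. now apply u_level.
  - apply Cmult_neq_0; rewrite rcpow_pos by (fold kap; lra); apply cexp_neq_0.
  - destruct (zasum_csum (uterm m) (fun j => C * om eps (xj m j)) q) as [Z1 Z2]; auto.
    + intros j n. eapply Rle_trans; [now apply uterm_bound|apply HC].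
    + now apply zseries_scal.
    + apply (ex_series_ext _ _ (fun i => f_equal Cmod (eq_sym (u_level m i Hm))) Z2).
Qed.

Lemma scaled_u_asymptotic : exists K, 0 <= K /\ forall m, 1 <= m ->
  Cmod (Cminus (scaled_u b A s m) (Gs b A s m)) <= K / m.
Proof.
  destruct term_bound as [C [HC0 HC]].
  destruct (weight_bound 2 ltac:(lra)) as [C' [HC'0 HC']].
  destruct (om_zseries eps l) as [B [HB0 HB]]; [lra|auto|].
  assert (HQ : 0 <= Series q) by now apply Series_nonneg.
  (* 32 is the 4 of the truncated power, a factor 2 for each of the two complex sums, and 2 for the
     two halves of the sum over [j]. *)
  exists (32 * C' * Series q * B). split.
  { repeat apply Rmult_le_pos; lra. }
  intros m Hm. destruct (HB (ln m)) as [Z0 [B1 B2]].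
  rewrite Gs_eq_Gs2, Gs2_eq_terms, scaled_u_eq_terms by lra.
  assert (HU : forall j n, Cmod (uterm m j n) <= C * om eps (xj m j) * q n).
  { intros j n. eapply Rle_trans; [now apply uterm_bound|apply HC]. }
  assert (ZC : zseries (fun j => C * om eps (xj m j))) by now apply zseries_scal.
  rewrite <- zsum_minus
    by first [exact (zasum_csum (uterm m) _ q HU ZC q_series) | exact (zasum_csum (term m) _ q (HC m) ZC q_series)].
  rewrite (zsum_ext _ (fun j => csum (fun n => Cminus (uterm m j n) (term m j n)))).
  2:{ intro j. symmetry. apply csum_minus; (eapply asum_le; [|apply (ex_series_scal_R (C * om eps (xj m j)) q q_series)]); auto. }
  eapply Rle_trans.
  - apply (zsum_bound _ (fun j => 8 / m * C' * Series q * om eps (xj m j))).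
    + intro j. replace (8 / m * C' * Series q * om eps (xj m j)) with (2 * Series (fun n => 4 / m * C' * om eps (xj m j) * q n)).
      * apply csum_bound; [|now apply ex_series_scal_R].
        intro n. eapply Rle_trans; [now apply uterm_bound|].
        rewrite !Rmult_assoc. apply Rmult_le_compat_l.
        { left. apply Rdiv_lt_0_compat; lra. }
        rewrite <- !Rmult_assoc. apply HC'.
      * rewrite Series_scal_l. field. lra.
    + now apply zseries_scal.
  - rewrite !Series_scal_l. unfold xj.
    replace (32 * C' * Series q * B / m) with (2 * (8 / m * C' * Series q * B + 8 / m * C' * Series q * B)) by (field; lra).
    assert (0 <= 8 / m * C' * Series q).
    { repeat apply Rmult_le_pos; try lra. left. apply Rinv_0_lt_compat. lra. }
    apply Rmult_le_compat_l; [lra|]. apply Rplus_le_compat; now apply Rmult_le_compat_l.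
Qed.

(** * Averages over one period of the logarithmic scale *)

Lemma logb_pow p : logb b (INR (b ^ p)) = INR p.
Proof. unfold logb. rewrite pow_INR, ln_pow by auto. fold l. field. lra. Qed.

Lemma Gcoeff_0 : Gcoeff 0 = Cmult (Cdiv (Gamma s) (RtoC (ln (INR b)))) (Dser b A s).
Proof.
  unfold Gcoeff. replace (zk b s 0) with s.
  - replace (RtoC (1 / ln (INR b))) with (Cinv (RtoC (ln (INR b)))).
    + unfold Cdiv. ring.
    + fold l. rewrite <- RtoC_inv by lra. f_equal. field. lra.
  - unfold zk. apply Ceq; simpl; unfold Re, Im; fold l; field; lra.
Qed.

(** Fewer than [b^(p+1)] steps, each with an error [O(b^(-2p))], leave a total error [O(b^(-p))]. *)
Lemma avg_sum_bound : exists K, 0 <= K /\ forall p,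
  Cmod (Cminus (avg_sum b A s p) (Gcoeff 0)) <= K / INR (b ^ p).
Proof.
  destruct scaled_u_asymptotic as [K [HK0 HK]].
  destruct (trig_primitive_taylor Gcoeff rapid_Gcoeff) as [M [HM0 HM]].
  (* A step has length [h <= 1 / (l P)] with [P = b^p]. Replacing the moment by [Gs] costs
     [K h / P], the rectangle rule costs [M h^2], and together they are at most [E / P^2]. *)
  pose (E := K / l + M / l ^ 2).
  assert (HE : 0 <= E).
  { unfold E. assert (0 < / l) by now apply Rinv_0_lt_compat.
    assert (0 < / l ^ 2) by (apply Rinv_0_lt_compat; now apply pow_lt).
    unfold Rdiv. assert (0 <= K * / l) by (apply Rmult_le_pos; lra).
    assert (0 <= M * / l ^ 2) by (apply Rmult_le_pos; lra). lra. }
  exists (E * INR b). split; [apply Rmult_le_pos; lra|]. intro p.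
  set (P := INR (b ^ p)).
  assert (HP : 1 <= P).
  { unfold P. change 1 with (INR 1). apply le_INR. apply Nat.neq_0_lt_0, Nat.pow_nonzero. lia. }
  assert (IND : forall n, Cmod (Cminus (lsum (map (fun i => let m := INR (b ^ p + 1 + i) in
      Cmult (scaled_u b A s m) (RtoC (logb b (m / (m - 1))))) (seq 0 n)))
      (Cminus (trig_primitive Gcoeff (logb b (INR (b ^ p + n)))) (trig_primitive Gcoeff (logb b P)))) <= INR n * (E / P ^ 2)).
  { induction n.
    - rewrite Nat.add_0_r. fold P. simpl. replace (Cminus _ _) with (RtoC 0) by (apply Ceq; simpl; ring).
      rewrite Cmod_0. lra.
    - rewrite seq_S, map_app, lsum_app. cbv zeta in *. rewrite Nat.add_0_l. simpl map.
      rewrite lsum_cons. change (lsum nil) with (RtoC 0). rewrite Cplus_0_r.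
      replace (b ^ p + S n)%nat with (b ^ p + 1 + n)%nat by lia.
      set (m := INR (b ^ p + 1 + n)).
      assert (Hm1 : INR (b ^ p + n) = m - 1).
      { unfold m. rewrite !plus_INR. simpl. ring. }
      assert (HmP : P <= m - 1).
      { rewrite <- Hm1, plus_INR. fold P. pose proof (pos_INR n). lra. }
      rewrite Hm1 in IHn.
      set (h := logb b (m / (m - 1))).
      assert (Hh : logb b (m - 1) = logb b m - h).
      { unfold h, logb. rewrite ln_div by lra. fold l. field. lra. }
      assert (Hh2 : 0 <= h <= / (l * P)).
      { unfold h, logb. fold l.
        assert (Em : m / (m - 1) = 1 + / (m - 1)) by (field; lra). rewrite Em.
        assert (Hi : 0 < / (m - 1)) by (apply Rinv_0_lt_compat; lra).
        assert (Hil : 0 < / l) by now apply Rinv_0_lt_compat.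
        assert (HiP : / (m - 1) <= / P) by (apply Rinv_le_contravar; lra).
        assert (L0 : 0 <= ln (1 + / (m - 1))) by (rewrite <- ln_1; apply ln_le; lra).
        assert (L1 : ln (1 + / (m - 1)) <= / (m - 1)).
        { rewrite <- (ln_exp (/ (m - 1))) at 2. apply ln_le; [lra|apply exp_ineq1_le]. }
        split; [apply Rmult_le_pos; lra|].
        rewrite Rinv_mult, Rmult_comm. unfold Rdiv. apply Rmult_le_compat; lra. }
      specialize (HK m ltac:(lra)). specialize (HM (logb b m) h). rewrite <- Hh in HM.
      rewrite <- Gs_eq_trig in HM.
      set (X := lsum _) in *.
      match goal with |- Cmod ?z <= _ => replace z with
        (Cplus (Cminus X (Cminus (trig_primitive Gcoeff (logb b (m - 1))) (trig_primitive Gcoeff (logb b P))))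
          (Cplus (Cmult (Cminus (scaled_u b A s m) (Gs b A s m)) (RtoC h))
            (Cminus (Cmult (Gs b A s m) (RtoC h)) (Cminus (trig_primitive Gcoeff (logb b m)) (trig_primitive Gcoeff (logb b (m - 1))))))) by ring end.
      eapply Rle_trans; [apply Cmod_triangle|]. rewrite S_INR, Rmult_plus_distr_r, Rmult_1_l.
      apply Rplus_le_compat; [exact IHn|].
      eapply Rle_trans; [apply Cmod_triangle|].
      assert (HlP : 0 < / (l * P)) by (apply Rinv_0_lt_compat; apply Rmult_lt_0_compat; lra).
      assert (T1 : Cmod (Cmult (Cminus (scaled_u b A s m) (Gs b A s m)) (RtoC h)) <= K / P * / (l * P)).
      { rewrite Cmod_mult, Cmod_R, (Rabs_pos_eq h) by lra.
        apply Rmult_le_compat; [apply Cmod_ge_0|lra| |lra].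
        eapply Rle_trans; [apply HK|]. apply Rmult_le_compat_l; auto. apply Rinv_le_contravar; lra. }
      assert (T2 : M * h ^ 2 <= M * (/ (l * P)) ^ 2).
      { apply Rmult_le_compat_l; auto. apply pow_incr; lra. }
      replace (E / P ^ 2) with (K / P * / (l * P) + M * (/ (l * P)) ^ 2) by (unfold E; field; lra).
      lra. }
  specialize (IND (b ^ (p + 1) - b ^ p)%nat).
  assert (Hpow : (b ^ p <= b ^ (p + 1))%nat) by (apply Nat.pow_le_mono_r; lia).
  replace (b ^ p + (b ^ (p + 1) - b ^ p))%nat with (b ^ (p + 1))%nat in IND by lia.
  (* From [b^p] to [b^(p+1)] the variable [log_b m] runs through exactly one period, so the
     telescoped primitive leaves the constant coefficient. *)
  unfold P in IND at 1. rewrite !logb_pow, plus_INR, trig_primitive_period in IND.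
  eapply Rle_trans; [apply IND|].
  apply Rle_trans with (INR (b ^ (p + 1)) * (E / P ^ 2)).
  - apply Rmult_le_compat_r.
    + apply Rmult_le_pos; auto. left. apply Rinv_0_lt_compat. apply pow_lt; lra.
    + apply le_INR. lia.
  - rewrite Nat.add_1_r, Nat.pow_succ_r', mult_INR. fold P. right. field. lra.
Qed.

End Main.

Theorem theorem2 (b : nat) (A : list nat) (s : C) :
  (2 <= b)%nat ->
  NoDup A -> A <> nil -> List.Forall (fun a => (a < b)%nat) A ->
  (0 < maxA A)%nat ->
  ln (INR (length A)) / ln (INR b) < Re s ->
  (exists K M : R, forall m : R, M <= m ->
      Cmod (Cminus (scaled_u b A s m) (Gs b A s m)) <= K / m)
  /\ (exists P : R -> C, smoothC P /\ (forall t, P (t + 1) = P t) /\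
        forall m, 0 < m -> Gs b A s m = P (logb b m))
  /\ (forall m, 0 < m -> Gs b A s m = Gs2 b A s m)
  /\ filterlim (avg_sum b A s) eventually
       (locally (Cmult (Cdiv (Gamma s) (RtoC (ln (INR b)))) (Dser b A s))).
Proof.
  intros Hb HND Hnil Hlt Hmax Hs. split; [|split; [|split]].
  - destruct (scaled_u_asymptotic b A s Hb HND Hnil Hlt Hmax Hs) as [K [_ HK]].
    exists K, 1. exact HK.
  - exists (trig (Gcoeff b A s)). split; [|split].
    + apply trig_smooth. now apply rapid_Gcoeff.
    + apply trig_periodic.
    + intros m _. now apply Gs_eq_trig.
  - intros m Hm. now apply Gs_eq_Gs2.
  - rewrite <- (Gcoeff_0 b A s Hb).
    destruct (avg_sum_bound b A s Hb HND Hnil Hlt Hmax Hs) as [K [HK0 HK]].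
    apply filterlim_locally. intro eps.
    (* Since [b^p > p >= N], this choice makes [K / b^p] smaller than [eps]. *)
    destruct (INR_unbounded (K / eps)) as [N HN]. exists N. intros p Hp.
    assert (Hsmall : Cmod (Cminus (avg_sum b A s p) (Gcoeff b A s 0)) < eps).
    { eapply Rle_lt_trans; [apply HK|].
      assert (Hpp : (p < b ^ p)%nat) by (apply Nat.pow_gt_lin_r; lia).
      assert (HNP : (N <= b ^ p)%nat) by lia. apply le_INR in HNP.
      pose proof (cond_pos eps). assert (0 <= K / eps) by (apply Rmult_le_pos; auto; left; now apply Rinv_0_lt_compat).
      apply Rmult_lt_reg_r with (INR (b ^ p)); [lra|]. unfold Rdiv at 1. rewrite Rmult_assoc, Rinv_l, Rmult_1_r by lra.
      replace K with (eps * (K / eps)) by (field; lra). apply Rmult_lt_compat_l; lra. }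
    split.
    + eapply Rle_lt_trans; [|apply Hsmall]. apply (re_le_Cmod (Cminus (avg_sum b A s p) (Gcoeff b A s 0))).
    + eapply Rle_lt_trans; [|apply Hsmall]. apply (im_le_Cmod (Cminus (avg_sum b A s p) (Gcoeff b A s 0))).
Qed.
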